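(* Let $Q(x,y)=rx^2+sxy+ty^2$ be a primitive indefinite integral binary quadratic form whose discriminant $D=s^2-4rt$ is not a square and is such that $D$ or $-D/3$ is a fundamental discriminant. For every $\mu_Q$-continuity set $W\subseteq[\gamma_Q]$, \[\lim_{X\to\infty}\frac{N_{\mathrm{rings}}(Q;X,W)}{N_{\mathrm{rings}}(Q;X)}=\frac{\mu_Q(W)}{\mu_Q([\gamma_Q])},\] where $N_{\mathrm{rings}}(Q;X,W)$ is the number of isomorphism classes of orders $R$ in complex cubic fields with $[T_R^{\perp\prime}]=[Q]$, $|\Delta(R)|<X$ and $\mathrm{sh}(R)\in W$, and $N_{\mathrm{rings}}(Q;X)=N_{\mathrm{rings}}(Q;X,[\gamma_Q])$.
   Context: A complex cubic field has one real and two complex embeddings $\sigma_1,\sigma_2,\sigma_3$. For an order $R$ with $\mathbf{Z}$-basis $1,\alpha_1,\alpha_2$, put $\alpha^\perp=3\alpha-\mathrm{Tr}(\alpha)$, $T(x,y)=\mathrm{Tr}((x\alpha_1^\perp+y\alpha_2^\perp)^2)$, $M(x,y)=\sum_i|\sigma_i(x\alpha_1^\perp+y\alpha_2^\perp)|^2$. $T_R^{\perp\prime}$ is $T$ divided by the gcd of its coefficients, and $[\cdot]$ denotes $\mathrm{GL}_2(\mathbf{Z})$-equivalence (action $(g\cdot Q)(x,y)=Q((x,y)g)$). For positive definite $rx^2+sxy+ty^2$, $z=\frac{s}{2r}+i\frac{\sqrt{4rt-s^2}}{2r}$; $\mathrm{sh}(R)$ is the image of $z(M)$ in $\mathrm{GL}_2(\mathbf{Z})\backslash\mathfrak{H}$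 (action $z\mapsto\frac{az+b}{cz+d}$ if $\det=1$, $z\mapsto\frac{a\bar z+b}{c\bar z+d}$ if $\det=-1$), identified with the Gauss domain $\{x+iy:0\le x\le\frac12,x^2+y^2\ge1\}$. $\gamma_Q$ is the hyperbolic geodesic in $\mathfrak{H}$ joining the two points of $\mathbf{R}\cup\{\infty\}$ where $Q$ vanishes; $[\gamma_Q]$ is its image in $\mathrm{GL}_2(\mathbf{Z})\backslash\mathfrak{H}$ with measure $\mu_Q$ induced by hyperbolic arc length; a $\mu_Q$-continuity set has boundary of $\mu_Q$-measure $0$. *)

(* Defs.v *)
From HB Require Import structures.
From mathcomp Require Import all_boot all_order all_algebra all_field.
From mathcomp Require Import complex ring lra.
From mathcomp Require Import all_classical all_reals all_analysis.

Set Implicit Arguments.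
Unset Strict Implicit.
Unset Printing Implicit Defensive.

Import Order.TTheory GRing.Theory Num.Theory.
Import numFieldNormedType.Exports.

Local Open Scope classical_set_scope.
Local Open Scope ring_scope.

Record bqf (A : Type) := BQF { bqf_r : A; bqf_s : A; bqf_t : A }.

Definition bqf_map (A B : Type) (f : A -> B) (Q : bqf A) : bqf B :=
  BQF (f (bqf_r Q)) (f (bqf_s Q)) (f (bqf_t Q)).

Definition bqf_eval (A : comNzRingType) (Q : bqf A) (x y : A) : A :=
  bqf_r Q * x ^+ 2 + bqf_s Q * x * y + bqf_t Q * y ^+ 2.

(* The coefficients (r, s, t) of F, for F (x, y) = r x^2 + s x y + t y^2. *)
Definition bqf_of (A : zmodType) (F : int -> int -> A) : bqf A :=
  BQF (F 1 0) (F 1 1 - F 1 0 - F 0 1) (F 0 1).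

Definition bqf_disc (A : comNzRingType) (Q : bqf A) : A :=
  bqf_s Q ^+ 2 - 4%:R * bqf_r Q * bqf_t Q.

Definition bqf_content (Q : bqf int) : int :=
  gcdz (gcdz (bqf_r Q) (bqf_s Q)) (bqf_t Q).

Definition bqf_primitive (Q : bqf int) : Prop := bqf_content Q = 1.

Definition bqf_indefinite (Q : bqf int) : Prop :=
  (exists x y : int, 0 < bqf_eval Q x y) /\
  (exists x y : int, bqf_eval Q x y < 0).

Definition bqf_reduce (Q : bqf int) : bqf int :=
  bqf_map (fun c : int => (c %/ bqf_content Q)%Z) Q.

(* GL_2(Z) is the set of g : 'M[int]_2 with g \in unitmx, i.e. \det g = +-1;
   (g . Q)(x, y) = Q((x, y) g). *)
Definition bqf_act (g : 'M[int]_2) (Q : bqf int) : bqf int :=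
  bqf_of (fun x y => bqf_eval Q (x * g 0 0 + y * g 1 0)
                                (x * g 0 1 + y * g 1 1)).

Definition bqf_equiv (Q1 Q2 : bqf int) : Prop :=
  exists2 g : 'M[int]_2, g \in unitmx & Q1 = bqf_act g Q2.

Definition squarefreez (m : int) : Prop :=
  forall p : nat, prime p -> ~~ (p%:Z ^+ 2 %| m)%Z.

Definition fundamental_discriminant (d : int) : Prop :=
  (d = 1 %[mod 4])%Z /\ squarefreez d \/
  exists m : int, [/\ d = 4 * m,
    (m = 2 %[mod 4])%Z \/ (m = 3 %[mod 4])%Z & squarefreez m].

(* The elements of P meet exactly n classes of the equivalence relation E.
   (A cardinal in the sense of cardinality.v is not available here for reasons
   of universe levels: fieldExtType rat is too large to be the base of a set.) *)
Definition meets_classes (T : Type) (E : T -> T -> Prop) (P : T -> Prop)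
    (n : nat) : Prop :=
  exists f : 'I_n -> T,
    [/\ forall i, P (f i),
        forall i j, E (f i) (f j) -> i = j &
        forall x, P x -> exists i, E (f i) x].

Section CubicOrders.
Variable R : realType.

Definition embeddings (K : fieldExtType rat) : set (K -> R[i]) :=
  range (fun s : {rmorphism K -> R[i]} => s : K -> R[i]).

Definition real_valued (K : fieldExtType rat) (f : K -> R[i]) : Prop :=
  forall a : K, complex.Im (f a) = 0.

Definition complex_cubic (K : fieldExtType rat) : Prop :=
  [/\ \dim {:K} = 3%N,
      ([set f | @embeddings K f /\ real_valued f] #= `I_1)%card &
      ([set f | @embeddings K f /\ ~ real_valued f] #= `I_2)%card].

Definition is_zbasis (K : fieldExtType rat) (A : set K) (b : seq K) : Prop :=
  basis_of fullv b /\
  A = [set x | exists n : 'I_(size b) -> int, x = \sum_(i < size b) b`_i *~ n i].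

Definition is_order (K : fieldExtType rat) (A : set K) : Prop :=
  [/\ A 1,
      (forall x y, A x -> A y -> A (x - y)),
      (forall x y, A x -> A y -> A (x * y)) &
      exists b : seq K, is_zbasis A b].

Record cubic_order := CubicOrder {
  order_field : fieldExtType rat;
  order_set : set order_field;
  order_field_cubic : complex_cubic order_field;
  order_setP : is_order order_set
}.
Arguments order_set : clear implicits.

Definition order_iso (O1 O2 : cubic_order) : Prop :=
  exists f : order_field O1 -> order_field O2,
    [/\ set_bij (order_set O1) (order_set O2) f, f 1 = 1,
        (forall x y, order_set O1 x -> order_set O1 y -> f (x + y) = f x + f y) &
        (forall x y, order_set O1 x -> order_set O1 y -> f (x * y) = f x * f y)].

Definition field_trace (K : fieldExtType rat) (a : K) : rat :=
  \tr (VectorInternalTheory.f2mx (amull a)).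

Section Basis.
Variables (K : fieldExtType rat) (a1 a2 : K).

Definition basis_disc : rat :=
  let b := [:: 1; a1; a2] in
  \det (\matrix_(i < 3, j < 3) field_trace (b`_i * b`_j)).

Definition perp (a : K) : K := a *+ 3 - (field_trace a)%:A.

Definition perp_comb (x y : int) : K := perp a1 *~ x + perp a2 *~ y.

(* When a1 and a2 lie in an order these traces are integers, so numq only
   changes the type of the coefficients. *)
Definition trace_form : bqf int :=
  bqf_map numq (bqf_of (fun x y => field_trace (perp_comb x y ^+ 2))).

Definition minkowski_form : bqf R :=
  bqf_of (fun x y : int =>
    \sum_(f \in @embeddings K)
      ((complex.Re (f (perp_comb x y))) ^+ 2 +
       (complex.Im (f (perp_comb x y))) ^+ 2)).

End Basis.

Definition bqf_point (M : bqf R) : R[i] :=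
  Complex (bqf_s M / (2%:R * bqf_r M))
          (Num.sqrt (- bqf_disc M) / (2%:R * bqf_r M)).

Definition moebius (g : 'M[int]_2) (z : R[i]) : R[i] :=
  let w := if \det g == 1 then z else conjc z in
  ((g 0 0)%:~R * w + (g 0 1)%:~R) / ((g 1 0)%:~R * w + (g 1 1)%:~R).

Definition gauss_domain : set R[i] :=
  [set z | [/\ 0 <= complex.Re z <= 2%:R^-1, 0 < complex.Im z &
               1 <= complex.Re z ^+ 2 + complex.Im z ^+ 2]].

(* Points of GL_2(Z) \ H are represented by points of the Gauss domain. *)
Definition is_image (z w : R[i]) : Prop :=
  gauss_domain w /\ exists2 g : 'M[int]_2, g \in unitmx & w = moebius g z.

(* The geodesic with endpoints a < b, as the image of the geodesic u |-> i e^u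
   under the isometry z |-> (b z + a) / (z + 1), which maps 0 to a and oo to b. *)
Definition geodesic (a b u : R) : R[i] :=
  let z := Complex 0 (expR u) in (b%:C%C * z + a%:C%C) / (z + 1).

Lemma geodesicE (a b u : R) : geodesic a b u =
  Complex ((a + b * expR u ^+ 2) / (1 + expR u ^+ 2))
          ((b - a) * expR u / (1 + expR u ^+ 2)).
Proof.
have h : 1 + expR u ^+ 2 != 0 by rewrite gt_eqF// ltr_wpDr// sqr_ge0.
rewrite /geodesic /=; set z := (X in _ / X).
have z0 : z != 0 by rewrite /z eq_complex /= addr0 gt_eqF ?expR_gt0 ?andbF.
apply: (mulIf z0); rewrite divfK//; apply/eqP; rewrite eq_complex /=.
by apply/andP; split; apply/eqP; field.
Qed.

(* The hyperbolic line element is sqrt (dx^2 + dy^2) / y. *)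
Lemma geodesic_unit_speed (a b u : R) : a < b ->
  Num.sqrt (derive1 (fun v => complex.Re (geodesic a b v)) u ^+ 2 +
            derive1 (fun v => complex.Im (geodesic a b v)) u ^+ 2) /
  complex.Im (geodesic a b u) = 1.
Proof.
move=> ab.
have h v : 1 + expR v ^+ 2 != 0 :> R by rewrite gt_eqF// ltr_wpDr// sqr_ge0.
have -> : (fun v => complex.Re (geodesic a b v)) =
    (fun v => (a + b * expR v ^+ 2) / (1 + expR v ^+ 2)).
  by apply/funext => v; rewrite geodesicE.
have -> : (fun v => complex.Im (geodesic a b v)) =
    (fun v => (b - a) * expR v / (1 + expR v ^+ 2)).
  by apply/funext => v; rewrite geodesicE.
have hi : is_derive u 1 (fun v => (1 + expR v ^+ 2)^-1)
    (- (1 + expR u ^+ 2) ^- 2 *: (2 * expR u * expR u)).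
  by apply: is_deriveV => //; apply: is_derive_eq; rewrite /GRing.scale /=; ring.
rewrite !derive1E.
have -> : 'D_1 (fun v => (a + b * expR v ^+ 2) / (1 + expR v ^+ 2)) u =
   2 * (b - a) * expR u ^+ 2 / (1 + expR u ^+ 2) ^+ 2.
  by apply: derive_val => //; apply: is_derive_eq; rewrite /GRing.scale /=; field.
have -> : 'D_1 (fun v => (b - a) * expR v / (1 + expR v ^+ 2)) u =
   (b - a) * expR u * (1 - expR u ^+ 2) / (1 + expR u ^+ 2) ^+ 2.
  by apply: derive_val => //; apply: is_derive_eq; rewrite /GRing.scale /=; field.
rewrite geodesicE /=.
set I := (b - a) * expR u / (1 + expR u ^+ 2).
have I0 : 0 < I by rewrite divr_gt0 ?mulr_gt0 ?subr_gt0 ?expR_gt0// ltr_wpDr// sqr_ge0.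
rewrite [X in Num.sqrt X](_ : _ = I ^+ 2); last by rewrite /I; field.
by rewrite sqrtr_sqr gtr0_norm// divff// gt_eqF.
Qed.

(* When bqf_disc Q is not a square, oo is not a zero of Q. Taking x / y or - x / y
   for the zero (x, y) does not matter modulo z |-> - z^*. *)
Definition zeros (Q : bqf int) : set (R * R) :=
  [set ab | [/\ ab.1 < ab.2, bqf_eval (bqf_map intr Q) ab.1 1 = 0 &
                bqf_eval (bqf_map intr Q) ab.2 1 = 0]].

Definition gamma_geodesic (Q : bqf int) : set R[i] :=
  [set z | exists2 ab : R * R, zeros Q ab & exists u, z = geodesic ab.1 ab.2 u].

Definition gamma_image (Q : bqf int) : set R[i] :=
  [set w | exists2 z, gamma_geodesic Q z & is_image z w].

(* For W a subset of gamma_image Q: inside the Gauss domain, gamma_image Q is a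
   union of pieces of the translates of gamma_geodesic Q, i.e. of the geodesics of
   the forms equivalent to Q, and the arc length of W is the sum of its arc
   lengths on these (two of them meet in at most one point). Summing over
   endpoints takes every translate once, as Q' and - Q' have the same geodesic.
   By geodesic_unit_speed, arc length is Lebesgue measure in u. *)
Definition gamma_measure (Q : bqf int) (W : set R[i]) : \bar R :=
  (\esum_(ab in [set ab | exists2 Q', bqf_equiv Q' Q & zeros Q' ab])
    lebesgue_measure [set u : R | W (geodesic ab.1 ab.2 u)])%E.

(* Topological boundary of W in the subspace S of the complex plane. *)
Definition boundary_in (S W : set (R[i] : numFieldType)) : set R[i] :=
  S `&` closure W `&` closure (S `\` W).

Definition counted (Q : bqf int) (X : R) (W : set R[i]) (O : cubic_order) : Prop :=
  exists a1 a2 : order_field O,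
    [/\ is_zbasis (order_set O) [:: 1; a1; a2],
        bqf_equiv (bqf_reduce (trace_form a1 a2)) Q,
        `|ratr (basis_disc a1 a2)| < X &
        exists2 w, W w & is_image (bqf_point (minkowski_form a1 a2)) w].

(* xget would give 0 if there were infinitely many classes. *)
Definition N_rings (Q : bqf int) (X : R) (W : set R[i]) : nat :=
  xget 0%N [set n | meets_classes order_iso (counted Q X W) n].

Definition continuity_set (Q : bqf int) (W : set R[i]) : Prop :=
  gamma_measure Q (boundary_in (gamma_image Q) W) = 0%E.

End CubicOrders.

(* Main.v *)
(* Orders correspond to integral binary cubic forms C up to GL_2(Z), and T^perp to 6 times
   the Hessian of C. Fix Q0 equivalent to Q with negative leading coefficient. The forms C
   whose Hessian is a multiple n Q0 form a lattice of rank 2; with al < be the roots of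
   Q0 (x, 1) they are k1^3 (x - al y)^3 + k2^3 (x - be y)^3, the shape of the order is the
   image of the point of parameter ln (k2 / k1) of the geodesic of Q0, and n is an
   indefinite binary quadratic form on the lattice, with |Delta| = n^2 D / 3. So the
   orders with shape in W are counted by the lattice points with 0 < n < sqrt (3 X / D)
   whose argument ln (k2 / k1) lies in a bounded set. The group of automorphs of Q0 is
   avoided by cutting the geodesic, in the Gauss domain, into the arcs of the finitely many
   equivalent forms E that meet it, with one transport from Q0 to each E.
   Lattice points with argument in [x, y] number c (y - x) sqrt X + o (sqrt X), whence the
   same for bounded sets of arguments with null boundary. Reducible forms C are negligible:
   a root p / q of C satisfies |q|^3, p^2 = O (a), and a, p, q determine C. *)
From HB Require Import structures.
Require Import Defs.
From mathcomp Require Import all_boot all_order all_algebra all_field complex ring lra zify.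
From mathcomp Require Import all_classical all_reals all_analysis.
From mathcomp Require measurable_realfun.
Import Order.TTheory GRing.Theory Num.Theory.
Import numFieldNormedType.Exports.
Local Open Scope classical_set_scope.
Local Open Scope ring_scope.
Set Implicit Arguments.
Unset Strict Implicit.
Unset Printing Implicit Defensive.

(** * Binary quadratic forms and the upper half plane *)

Lemma det_mx22 (A : comNzRingType) (M : 'M[A]_2) :
  \det M = M 0 0 * M 1 1 - M 0 1 * M 1 0.
Proof.
pose f i j := M (inord i) (inord j).
have fE i j : M i j = f i j by rewrite /f !inord_val.
rewrite (expand_det_row M 0) !big_ord_recl big_ord0 /cofactor !det_mx11 !mxE !fE /=.
by rewrite expr0 expr1; ring.
Qed.

Lemma det_mx33 (A : comNzRingType) (M : 'M[A]_3) :
  \det M = M 0 0 * (M 1 1 * M 2%:R 2%:R - M 1 2%:R * M 2%:R 1)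
          - M 0 1 * (M 1 0 * M 2%:R 2%:R - M 1 2%:R * M 2%:R 0)
          + M 0 2%:R * (M 1 0 * M 2%:R 1 - M 1 1 * M 2%:R 0).
Proof.
pose f i j := M (inord i) (inord j).
have fE i j : M i j = f i j by rewrite /f !inord_val.
rewrite (expand_det_row M 0) !big_ord_recl big_ord0 /cofactor !det_mx22 !mxE !fE /=.
by rewrite expr0 expr1 expr2; ring.
Qed.

Definition bqf_flip (Q : bqf int) : bqf int := BQF (bqf_r Q) (- bqf_s Q) (bqf_t Q).

Definition bqf_scale (k : int) (Q : bqf int) : bqf int := bqf_map (fun c => k * c) Q.

Lemma unimodP (g : 'M[int]_2) : reflect (\det g = 1 \/ \det g = -1) (g \in unitmx).
Proof.
rewrite unitmxE; apply: (iffP idP) => [h|[->|->] //].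
by case/orP: (h : (\det g == 1) || (\det g == -1)) => /eqP; [left | right].
Qed.

Lemma mulmx2E (A : comNzRingType) (g h : 'M[A]_2) i j :
  (g *m h) i j = g i 0 * h 0 j + g i 1 * h 1 j.
Proof.
rewrite mxE !big_ord_recl big_ord0 addr0.
by congr (_ + g _ _ * h _ _); apply: val_inj.
Qed.

Lemma mx2P (A : Type) (g h : 'M[A]_2) : g 0 0 = h 0 0 -> g 0 1 = h 0 1 ->
  g 1 0 = h 1 0 -> g 1 1 = h 1 1 -> g = h.
Proof.
move=> e00 e01 e10 e11; have o (i : 'I_2) : i = 0 \/ i = 1.
  by case: i => -[|[|//]] hi; [left | right]; apply: val_inj.
by apply/matrixP => i j; case: (o i) => ->; case: (o j) => ->.
Qed.

Lemma bqf_eq (A : Type) (Q1 Q2 : bqf A) : bqf_r Q1 = bqf_r Q2 ->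
  bqf_s Q1 = bqf_s Q2 -> bqf_t Q1 = bqf_t Q2 -> Q1 = Q2.
Proof. by case: Q1; case: Q2 => ? ? ? ? ? ? /= -> -> ->. Qed.

Lemma bqf_eval_act (g : 'M[int]_2) (Q : bqf int) (x y : int) :
  bqf_eval (bqf_act g Q) x y =
  bqf_eval Q (x * g 0 0 + y * g 1 0) (x * g 0 1 + y * g 1 1).
Proof. by rewrite /bqf_act /bqf_of /bqf_eval /=; ring. Qed.

Lemma bqf_of_eval (Q : bqf int) : bqf_of (bqf_eval Q) = Q.
Proof. by apply: bqf_eq; rewrite /bqf_of /bqf_eval /=; ring. Qed.

Lemma bqf_ext (Q1 Q2 : bqf int) :
  (forall x y, bqf_eval Q1 x y = bqf_eval Q2 x y) -> Q1 = Q2.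
Proof. by move=> h; rewrite -[Q1]bqf_of_eval -[Q2]bqf_of_eval /bqf_of !h. Qed.

Lemma bqf_actM (g h : 'M[int]_2) (Q : bqf int) :
  bqf_act g (bqf_act h Q) = bqf_act (g *m h) Q.
Proof.
apply: bqf_ext => x y; rewrite !bqf_eval_act !mulmx2E.
by congr bqf_eval; ring.
Qed.

Lemma bqf_act1 (Q : bqf int) : bqf_act 1%:M Q = Q.
Proof. by apply: bqf_ext => x y; rewrite bqf_eval_act !mxE /=; congr bqf_eval; ring. Qed.

Lemma bqf_actN (g : 'M[int]_2) (Q : bqf int) : bqf_act (- g) Q = bqf_act g Q.
Proof. by apply: bqf_ext => x y; rewrite !bqf_eval_act !mxE /bqf_eval /=; ring. Qed.

Lemma bqf_act_scale (g : 'M[int]_2) (k : int) (Q : bqf int) :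
  bqf_act g (bqf_scale k Q) = bqf_scale k (bqf_act g Q).
Proof. by rewrite /bqf_act /bqf_scale /bqf_map /bqf_of /bqf_eval /=; congr BQF; ring. Qed.

Lemma bqf_scale_inj (k : int) : k != 0 -> injective (bqf_scale k).
Proof. by move=> k0 [? ? ?] [? ? ?] [] /(mulfI k0)-> /(mulfI k0)-> /(mulfI k0)->. Qed.

Lemma bqf_disc_scale (k : int) (Q : bqf int) :
  bqf_disc (bqf_scale k Q) = k ^+ 2 * bqf_disc Q.
Proof. by rewrite /bqf_disc /=; ring. Qed.

Lemma bqf_disc_flip (Q : bqf int) : bqf_disc (bqf_flip Q) = bqf_disc Q.
Proof. by rewrite /bqf_disc /=; ring. Qed.

Lemma bqf_disc_act (g : 'M[int]_2) (Q : bqf int) :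
  g \in unitmx -> bqf_disc (bqf_act g Q) = bqf_disc Q.
Proof.
move=> /unimodP ug; rewrite -[RHS]mul1r.
have -> : 1 = (\det g) ^+ 2 by case: ug => ->.
by rewrite det_mx22 /bqf_disc /= /bqf_eval; ring.
Qed.

Lemma bqf_equiv_refl Q : bqf_equiv Q Q.
Proof. by exists 1%:M; rewrite ?unitmx1 ?bqf_act1. Qed.

Lemma bqf_equiv_act g Q : g \in unitmx -> bqf_equiv (bqf_act g Q) Q.
Proof. by move=> ug; exists g. Qed.

Lemma bqf_equiv_sym Q1 Q2 : bqf_equiv Q1 Q2 -> bqf_equiv Q2 Q1.
Proof.
case=> g ug ->; exists (invmx g); first by rewrite unitmx_inv.
by rewrite bqf_actM mulVmx // bqf_act1.
Qed.

Lemma bqf_equiv_trans Q1 Q2 Q3 : bqf_equiv Q1 Q2 -> bqf_equiv Q2 Q3 -> bqf_equiv Q1 Q3.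
Proof.
case=> g ug -> [h uh ->]; exists (g *m h); first by rewrite unitmx_mul ug.
by rewrite bqf_actM.
Qed.

Definition flip_mx : 'M[int]_2 := \matrix_(i, j) (if i == j then (if i == 0 then 1 else - 1) else 0).

Lemma flip_mx_unit : flip_mx \in unitmx.
Proof. by apply/unimodP; right; rewrite det_mx22 !mxE. Qed.

Lemma bqf_flipE Q : bqf_flip Q = bqf_act flip_mx Q.
Proof. by apply: bqf_ext => x y; rewrite bqf_eval_act !mxE /bqf_eval /bqf_flip /=; ring. Qed.

Lemma bqf_flipK Q : bqf_flip (bqf_flip Q) = Q.
Proof. by case: Q => r s t; rewrite /bqf_flip /= opprK. Qed.

Lemma bqf_equiv_flip Q : bqf_equiv (bqf_flip Q) Q.
Proof. by rewrite bqf_flipE; apply/bqf_equiv_act/flip_mx_unit. Qed.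

Lemma bqf_primitiveP (Q : bqf int) : bqf_primitive Q <->
  (forall k : int, (k %| bqf_r Q)%Z -> (k %| bqf_s Q)%Z -> (k %| bqf_t Q)%Z -> (k %| 1)%Z).
Proof.
rewrite /bqf_primitive /bqf_content; split=> [e k kr ks kt|].
  by rewrite -[X in (_ %| X)%Z]e !dvdz_gcd kr ks kt.
set c := gcdz _ _ => h.
have : (c %| 1)%Z.
  have c1 : (c %| gcdz (bqf_r Q) (bqf_s Q))%Z by exact: dvdz_gcdl.
  apply: h; rewrite ?dvdz_gcdr //.
    by apply: dvdz_trans c1 _; exact: dvdz_gcdl.
  by apply: dvdz_trans c1 _; exact: dvdz_gcdr.
by rewrite dvdz1 /c => /eqP; rewrite /gcdz /=; lia.
Qed.

Lemma bqf_primitive_equiv Q1 Q2 : bqf_equiv Q1 Q2 -> bqf_primitive Q2 -> bqf_primitive Q1.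
Proof.
move=> /bqf_equiv_sym [g ug ->] /bqf_primitiveP h; apply/bqf_primitiveP => k kr ks kt.
apply: h; rewrite /bqf_act /= /bqf_eval.
- by rewrite !rpredD // !dvdz_mulr.
- rewrite (_ : _ - _ - _ = bqf_r Q1 * (2 * g 0 0 * g 1 0) + bqf_s Q1 * (g 0 0 * g 1 1 + g 0 1 * g 1 0)
     + bqf_t Q1 * (2 * g 0 1 * g 1 1)); last by ring.
  by rewrite !rpredD // !dvdz_mulr.
- by rewrite !rpredD // !dvdz_mulr.
Qed.

Lemma bqf_reduce_scale (k : int) (Q : bqf int) : 0 < k -> bqf_primitive Q ->
  bqf_reduce (bqf_scale k Q) = Q.
Proof.
move=> k0 hQ; have k00 : k != 0 by rewrite gt_eqF.
have c : bqf_content (bqf_scale k Q) = k.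
  have ka : (`|k|%N : int) = k by rewrite gez0_abs // ltW.
  by rewrite /bqf_content /= -mulz_gcdr ka -mulz_gcdr ka -/(bqf_content Q) hQ mulr1.
rewrite /bqf_reduce c; apply: bqf_eq => /=; exact: mulKz.
Qed.

Lemma bqf_scale_reduce (Q : bqf int) : bqf_disc Q != 0 ->
  0 < bqf_content Q /\ Q = bqf_scale (bqf_content Q) (bqf_reduce Q).
Proof.
move=> d0; have c0 : bqf_content Q != 0.
  apply/eqP => c0; move/eqP: c0; rewrite /bqf_content gcdz_eq0 => /andP[].
  rewrite gcdz_eq0 => /andP[/eqP r0 /eqP s0] /eqP t0.
  by move/eqP: d0; apply; rewrite /bqf_disc r0 s0 t0.
split; first by rewrite lt_neqAle eq_sym c0 /bqf_content /gcdz.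
have c1 : (bqf_content Q %| gcdz (bqf_r Q) (bqf_s Q))%Z by exact: dvdz_gcdl.
have cr : (bqf_content Q %| bqf_r Q)%Z by apply: dvdz_trans c1 _; exact: dvdz_gcdl.
have cs : (bqf_content Q %| bqf_s Q)%Z by apply: dvdz_trans c1 _; exact: dvdz_gcdr.
have ct : (bqf_content Q %| bqf_t Q)%Z by exact: dvdz_gcdr.
by apply: bqf_eq => /=; rewrite mulrC divzK.
Qed.

Section Moebius.
Variable R : realType.

Lemma moebiusE (g : 'M[int]_2) (z : R[i]) : g \in unitmx ->
  let x := complex.Re z in let y := complex.Im z in
  let N := ((g 1 0)%:~R * x + (g 1 1)%:~R) ^+ 2 + ((g 1 0)%:~R * y) ^+ 2 in
  moebius g z =
  Complex ((((g 0 0)%:~R * x + (g 0 1)%:~R) * ((g 1 0)%:~R * x + (g 1 1)%:~R) +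
     (g 0 0)%:~R * (g 1 0)%:~R * y ^+ 2) / N) (y / N).
Proof.
move=> ug; case: z => x y /=.
have ci (n : int) : n%:~R = (n%:~R : R)%:C%C by rewrite rmorph_int.
have : (\det g)%:~R = (g 0 0)%:~R * (g 1 1)%:~R - (g 0 1)%:~R * (g 1 0)%:~R :> R.
  by rewrite det_mx22 !(rmorphM, rmorphB).
rewrite /moebius !ci; move: (g 0 0)%:~R (g 0 1)%:~R (g 1 0)%:~R (g 1 1)%:~R => A B C D hd.
case/unimodP: ug hd => -> /=; rewrite ?rmorphN1 ?rmorph1 => hd;
  apply/eqP; rewrite eq_complex /= !(mul0r, addr0, add0r, subr0, mulrN, opprK) ?sqrrN.
  by apply/andP; split; apply/eqP; [|rewrite -[RHS]mul1r hd]; ring.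
have {}hd : 1 = B * C - A * D by rewrite -[LHS]opprK hd; ring.
by apply/andP; split; apply/eqP; [|rewrite -[RHS]mul1r hd]; ring.
Qed.

Lemma moebius_den (g : 'M[int]_2) (z : R[i]) : g \in unitmx -> 0 < complex.Im z ->
  0 < ((g 1 0)%:~R * complex.Re z + (g 1 1)%:~R) ^+ 2 + ((g 1 0)%:~R * complex.Im z) ^+ 2.
Proof.
move=> /unimodP ug y0; rewrite lt_neqAle addr_ge0 ?sqr_ge0 // andbT eq_sym.
rewrite paddr_eq0 ?sqr_ge0 // !sqrf_eq0; apply/negP => /andP[h].
rewrite mulf_eq0 (gt_eqF y0) orbF intr_eq0 => /eqP c0.
move: h; rewrite c0 mul0r add0r intr_eq0 => /eqP d0.
by move: ug; rewrite det_mx22 c0 d0 !mulr0 subr0 => -[].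
Qed.

Lemma moebius_Im_gt0 (g : 'M[int]_2) (z : R[i]) : g \in unitmx -> 0 < complex.Im z ->
  0 < complex.Im (moebius g z).
Proof. by move=> ug y0; rewrite moebiusE //= divr_gt0 // moebius_den. Qed.

Let lfrac (g : 'M[int]_2) (w : R[i]) : R[i] :=
  ((g 0 0)%:~R * w + (g 0 1)%:~R) / ((g 1 0)%:~R * w + (g 1 1)%:~R).

Lemma lfrac_den (g : 'M[int]_2) (w : R[i]) : g \in unitmx -> complex.Im w != 0 ->
  (g 1 0)%:~R * w + (g 1 1)%:~R != 0.
Proof.
move=> /unimodP ug y0; have ci (n : int) : n%:~R = (n%:~R : R)%:C%C by rewrite rmorph_int.
apply/negP; rewrite !ci; case: w y0 => x y /= y0; rewrite eq_complex /= => /andP[].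
rewrite !mul0r subr0 !addr0 => h; rewrite mulf_eq0 (negbTE y0) orbF intr_eq0 => /eqP c0.
move: h; rewrite c0 mul0r add0r intr_eq0 => /eqP d0.
by move: ug; rewrite det_mx22 c0 d0 !mulr0 subr0 => -[].
Qed.

Lemma lfrac_mul (g h : 'M[int]_2) (w : R[i]) : g \in unitmx -> h \in unitmx ->
  complex.Im w != 0 -> lfrac g (lfrac h w) = lfrac (g *m h) w.
Proof.
move=> ug uh y0; have d1 := lfrac_den uh y0.
have ugh : g *m h \in unitmx by rewrite unitmx_mul ug.
have := lfrac_den ugh y0; rewrite /lfrac !mulmx2E !(intrD, intrM) => d3.
by field; rewrite d1 d3.
Qed.

Lemma conjc_lfrac (g : 'M[int]_2) (w : R[i]) : conjc (lfrac g w) = lfrac g (conjc w).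
Proof. by rewrite /lfrac rmorphM fmorphV !rmorphD !rmorphM /= !rmorph_int. Qed.

Lemma moebius_mul (g h : 'M[int]_2) (z : R[i]) : g \in unitmx -> h \in unitmx ->
  0 < complex.Im z -> moebius g (moebius h z) = moebius (g *m h) z.
Proof.
move=> ug uh y0; have y1 : complex.Im z != 0 by rewrite gt_eqF.
have y2 : complex.Im (conjc z) != 0 by case: z y1 {y0} => x y /=; rewrite oppr_eq0.
have mE (k : 'M[int]_2) : moebius k = fun v => lfrac k (if \det k == 1 then v else conjc v) by [].
rewrite !mE det_mulmx.
case/unimodP: (ug) => ->; case/unimodP: (uh) => -> /=;
  by rewrite ?conjc_lfrac ?conjcK lfrac_mul.
Qed.

Lemma moebius1 (z : R[i]) : moebius 1%:M z = z.
Proof. by rewrite /moebius det1 eqxx !mxE /= mul1r mul0r !addr0 add0r divr1. Qed.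

Lemma moebiusK (g : 'M[int]_2) (z : R[i]) : g \in unitmx -> 0 < complex.Im z ->
  moebius (invmx g) (moebius g z) = z.
Proof. by move=> ug y0; rewrite moebius_mul ?unitmx_inv // mulVmx // moebius1. Qed.

Definition gauss_interior : set R[i] :=
  [set z | [/\ 0 < complex.Re z < 2%:R^-1, 0 < complex.Im z &
               1 < complex.Re z ^+ 2 + complex.Im z ^+ 2]].

Lemma int_form_ge1 (c d : int) : (c != 0) || (d != 0) -> 1 <= c ^+ 2 + c * d + d ^+ 2.
Proof.
have sq (k : int) : k != 0 -> 1 <= k ^+ 2 by nia.
have h : 4 * (c ^+ 2 + c * d + d ^+ 2) = (2 * c + d) ^+ 2 + 3 * d ^+ 2 by ring.
have [->|d0 _] := eqVneq d 0; first by rewrite orbF mulr0 !addr0 => /sq.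
have := sq _ d0; have := sqr_ge0 (2 * c + d); move: (_ ^+ 2) (d ^+ 2) (_ + _) h; lia.
Qed.

Lemma gauss_den_bound (c d : int) (x : R) : 0 <= x <= 2%:R^-1 -> (c != 0) || (d != 0) ->
  1 <= 2%:R * x * (c%:~R * d%:~R) + c%:~R ^+ 2 + d%:~R ^+ 2.
Proof.
move=> /andP[x0 x1] cd.
have h1 := int_form_ge1 cd; have h2 : 1 <= c ^+ 2 + c * (- d) + d ^+ 2.
  by rewrite -(sqrrN d); apply: int_form_ge1; rewrite oppr_eq0.
move: h1 h2; rewrite -!(ler_int R) !(rmorphD, rmorphXn, intrM, rmorphN) /= rmorph1.
by nra.
Qed.

Let gauss_den (c d x y : R) : (c * x + d) ^+ 2 + (c * y) ^+ 2 =
  c ^+ 2 * (x ^+ 2 + y ^+ 2 - 1) + (2%:R * x * (c * d) + c ^+ 2 + d ^+ 2).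
Proof. by ring. Qed.

Lemma gauss_den_ge1 (c d : int) (z : R[i]) : gauss_domain z -> (c != 0) || (d != 0) ->
  1 <= (c%:~R * complex.Re z + d%:~R) ^+ 2 + (c%:~R * complex.Im z) ^+ 2.
Proof.
case: z => x y [/= x01 y0 n1] cd; rewrite gauss_den ler_wpDl ?gauss_den_bound //.
by rewrite mulr_ge0 ?sqr_ge0 ?subr_ge0.
Qed.

Lemma gauss_den_gt1 (c d : int) (z : R[i]) : gauss_interior z -> c != 0 ->
  1 < (c%:~R * complex.Re z + d%:~R) ^+ 2 + (c%:~R * complex.Im z) ^+ 2.
Proof.
case: z => x y [/= /andP[x0 x1] y0 n1] c0; rewrite gauss_den ltr_pwDl //.
  by rewrite mulr_gt0 ?subr_gt0 // exprn_even_gt0 //= intr_eq0.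
by rewrite gauss_den_bound ?c0 // !ltW.
Qed.

Lemma gauss_unique (g : 'M[int]_2) (z : R[i]) : g \in unitmx -> gauss_interior z ->
  gauss_domain (moebius g z) -> g = 1%:M \/ g = - 1%:M.
Proof.
move=> ug hz hw.
have y0 : 0 < complex.Im z by case: hz.
have c0 : g 1 0 = 0.
  apply/eqP/negPn/negP => c0; have hd := gauss_den_gt1 (g 1 1) hz c0.
  have ugi : invmx g \in unitmx by rewrite unitmx_inv.
  have y1 := moebius_Im_gt0 ug y0.
  have : complex.Im (moebius g z) < complex.Im z.
    by rewrite (moebiusE _ ug) /= ltr_pdivrMr ?moebius_den // -[X in X < _]mulr1 ltr_pM2l.
  rewrite -{2}(moebiusK ug y0) (moebiusE _ ugi) /= ltr_pdivlMr ?moebius_den //.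
  rewrite -[X in _ < X]mulr1 ltr_pM2l // ltNge gauss_den_ge1 //.
  rewrite -negb_and; apply/negP => /andP[/eqP e1 /eqP e2].
  by move/unimodP: ugi; rewrite det_mx22 e1 e2 !mulr0 subr0 => -[].
have := unimodP _ ug; rewrite det_mx22 c0 mulr0 subr0 => hdet.
move: hw; rewrite (moebiusE _ ug) /gauss_domain /= c0 !(mul0r, mulr0, add0r, addr0) expr0n addr0.
case: hz => /andP[x0 x1] _ _ [hx _ _].
have hg : g = \matrix_(i, j) (if i == 0 then (if j == 0 then g 0 0 else g 0 1) else
    (if j == 0 then 0 else g 1 1)).
  apply/matrixP => -[[|[|//]] hi] [[|[|//]] hj]; rewrite mxE /=; try (by congr (g _ _); apply: val_inj).
  by rewrite -c0; congr (g _ _); apply: val_inj.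
move: (g 0 0) (g 1 1) (g 0 1) hdet hx hg => a d b hdet hx hg.
have dunit (u v : int) : u * v = 1 \/ u * v = -1 -> (v == 1) || (v == -1).
  case=> h; first exact: (intUnitRing.unitzPl h).
  by apply: (@intUnitRing.unitzPl v (- u)); rewrite mulNr h opprK.
have d2 : d ^+ 2 = 1.
  by case/orP: (dunit _ _ hdet) => /eqP->.
move: hx; rewrite -[d%:~R ^+ 2]rmorphXn /= d2 divr1 mulrDl mulrAC -!intrM.
have bd : b * d * d = b by rewrite -mulrA -expr2 d2 mulr1.
move: (b * d) bd => m bd; case: hdet => ad; rewrite ad ?rmorphN1 => /andP[h1 h2]; last first.
  have m1 : (0 : R) < m%:~R by lra.
  have m2 : m%:~R < (1 : R) by lra.
  move: m1 m2; rewrite -(rmorph0 (intmul 1)) -(rmorph1 (intmul 1)) !ltr_int; lia.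
have m1 : (-1 : R) < m%:~R by lra.
have m2 : m%:~R < (1 : R) by lra.
have m0 : m = 0.
  by move: m1 m2; rewrite -(rmorphN1 (intmul 1)) -(rmorph1 (intmul 1)) !ltr_int; lia.
have b0 : b = 0 by rewrite -bd m0 mul0r.
case/orP: (dunit a d (or_introl ad)) => /eqP d1; [left | right]; rewrite hg;
  have -> : a = d by (move: ad; rewrite d1; lia).
  all: rewrite d1 b0;
  apply/matrixP => -[[|[|//]] hi] [[|[|//]] hj]; rewrite !mxE /= ?oppr0 //.
Qed.

End Moebius.

Section GeodesicTransport.
Variable R : realType.

(* If the basis 1, w1, w2 is transformed by g, the point of the Minkowski form is
   transformed by anti_mx g. *)
Definition anti_mx (g : 'M[int]_2) : 'M[int]_2 :=
  \matrix_(i, j) g (rev_ord i) (rev_ord j).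

Lemma anti_mxE (g : 'M[int]_2) : [/\ anti_mx g 0 0 = g 1 1, anti_mx g 0 1 = g 1 0,
  anti_mx g 1 0 = g 0 1 & anti_mx g 1 1 = g 0 0].
Proof. by split; rewrite mxE; congr (g _ _); apply: val_inj. Qed.

Lemma anti_mxK : involutive anti_mx.
Proof. by move=> g; apply/matrixP => i j; rewrite !mxE !rev_ordK. Qed.

Lemma anti_mx1 : anti_mx 1%:M = 1%:M.
Proof. by apply/matrixP => i j; rewrite !mxE (inj_eq rev_ord_inj). Qed.

Lemma anti_mxN g : anti_mx (- g) = - anti_mx g.
Proof. by apply/matrixP => i j; rewrite !mxE. Qed.

Lemma anti_mxM (g h : 'M[int]_2) : anti_mx (g *m h) = anti_mx g *m anti_mx h.
Proof.
apply/matrixP => i j; rewrite [RHS]mulmx2E [LHS]mxE mulmx2E !mxE addrC.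
by congr (g _ _ * h _ _ + g _ _ * h _ _); apply: val_inj.
Qed.

Lemma det_anti_mx g : \det (anti_mx g) = \det g.
Proof. by rewrite !det_mx22; case: (anti_mxE g) => -> -> -> ->; ring. Qed.

Lemma anti_mx_unit g : (anti_mx g \in unitmx) = (g \in unitmx).
Proof. by rewrite !unitmxE det_anti_mx. Qed.

Let sum_sq_neq0 (l m p p' q q' : R) : 0 < l -> 0 < m -> p * q' - p' * q != 0 ->
  l ^+ 2 * p ^+ 2 + m ^+ 2 * q ^+ 2 != 0.
Proof.
move=> l0 m0 d0; have [p0|p0] := eqVneq p 0.
  have q0 : q != 0 by apply: contra d0 => /eqP->; rewrite p0 mul0r mulr0 subrr.
  by rewrite p0 expr0n mulr0 add0r -exprMn sqrf_eq0 mulf_neq0 // gt_eqF.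
by rewrite gt_eqF // -!exprMn ltr_pwDl ?sqr_ge0 // exprn_even_gt0 //= mulf_neq0 // gt_eqF.
Qed.

(* The point of the form l^2 (x + al y)^2 + m^2 (x + be y)^2 composed with g,
   where p x + p' y is the image of the linear factor x + al y under g. *)
Lemma bqf_point_sum (l m p p' q q' : R) : 0 < l -> 0 < m -> p * q' - p' * q != 0 ->
  bqf_point (BQF (l ^+ 2 * p ^+ 2 + m ^+ 2 * q ^+ 2)
     (2%:R * (l ^+ 2 * p * p' + m ^+ 2 * q * q'))
     (l ^+ 2 * p' ^+ 2 + m ^+ 2 * q' ^+ 2)) =
  Complex ((l ^+ 2 * p * p' + m ^+ 2 * q * q') / (l ^+ 2 * p ^+ 2 + m ^+ 2 * q ^+ 2))
    (l * m * `|p * q' - p' * q| / (l ^+ 2 * p ^+ 2 + m ^+ 2 * q ^+ 2)).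
Proof.
move=> l0 m0 d0; rewrite /bqf_point /=.
have N0 := sum_sq_neq0 l0 m0 d0.
have -> : - bqf_disc (BQF (l ^+ 2 * p ^+ 2 + m ^+ 2 * q ^+ 2)
     (2%:R * (l ^+ 2 * p * p' + m ^+ 2 * q * q'))
     (l ^+ 2 * p' ^+ 2 + m ^+ 2 * q' ^+ 2)) = (2%:R * (l * m) * `|p * q' - p' * q|) ^+ 2.
  by rewrite exprMn real_normK ?num_real // /bqf_disc /=; ring.
rewrite sqrtr_sqr ger0_norm ?mulr_ge0 // ?(ltW l0) ?(ltW m0) // -!(mulrA 2%:R).
by move: N0; set N := _ + _ => N0; congr Complex; field.
Qed.

Lemma geodesic_ratio (al be l m : R) : 0 < l -> 0 < m ->
  geodesic al be (ln (m / l)) =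
  Complex ((l ^+ 2 * al + m ^+ 2 * be) / (l ^+ 2 + m ^+ 2))
          (l * m * (be - al) / (l ^+ 2 + m ^+ 2)).
Proof.
move=> l0 m0; rewrite geodesicE lnK ?posrE ?divr_gt0 //.
have l0' : l != 0 by rewrite gt_eqF.
have h : l ^+ 2 + m ^+ 2 != 0 by rewrite gt_eqF // addr_gt0 ?exprn_gt0.
have h' : 1 + (m / l) ^+ 2 != 0 by rewrite gt_eqF // addr_gt0 ?exprn_gt0 ?divr_gt0.
by apply/eqP; rewrite eq_complex /=; apply/andP; split; apply/eqP; field;
  rewrite ?l0' ?h // -expr2 addrC h.
Qed.

Lemma bqf_point_act (al be l m : R) (g : 'M[int]_2) : al < be -> 0 < l -> 0 < m ->
  g \in unitmx ->
  let p := (g 0 0)%:~R + al * (g 0 1)%:~R in let p' := (g 1 0)%:~R + al * (g 1 1)%:~R in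
  let q := (g 0 0)%:~R + be * (g 0 1)%:~R in let q' := (g 1 0)%:~R + be * (g 1 1)%:~R in
  bqf_point (BQF (l ^+ 2 * p ^+ 2 + m ^+ 2 * q ^+ 2)
     (2%:R * (l ^+ 2 * p * p' + m ^+ 2 * q * q'))
     (l ^+ 2 * p' ^+ 2 + m ^+ 2 * q' ^+ 2)) =
  moebius (anti_mx g) (geodesic al be (ln (m / l))).
Proof.
move=> ab l0 m0 ug p p' q q'; have d0 : 0 < be - al by rewrite subr_gt0.
have uga : anti_mx g \in unitmx by rewrite anti_mx_unit.
have hd : p * q' - p' * q = (\det g)%:~R * (be - al).
  by rewrite det_mx22 !(rmorphB, rmorphM) /p /p' /q /q'; ring.
have hd' : `|p * q' - p' * q| = be - al.
  rewrite hd; case/unimodP: (ug) => ->; rewrite ?rmorphN1 ?rmorph1 ?mul1r ?mulN1r ?normrN;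
  by rewrite gtr0_norm.
have hd0 : p * q' - p' * q != 0 by rewrite -normr_eq0 hd' gt_eqF.
rewrite bqf_point_sum // hd' geodesic_ratio // (moebiusE _ uga) /=.
case: (anti_mxE g) => -> -> -> ->.
have N0 := sum_sq_neq0 l0 m0 hd0.
have h : l ^+ 2 + m ^+ 2 != 0 by rewrite gt_eqF // addr_gt0 ?exprn_gt0.
have e : ((g 0 1)%:~R * ((l ^+ 2 * al + m ^+ 2 * be) / (l ^+ 2 + m ^+ 2)) + (g 0 0)%:~R) ^+ 2
  + ((g 0 1)%:~R * (l * m * (be - al) / (l ^+ 2 + m ^+ 2))) ^+ 2 =
  (l ^+ 2 * p ^+ 2 + m ^+ 2 * q ^+ 2) / (l ^+ 2 + m ^+ 2).
  by rewrite /p /q; field.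
rewrite e; apply/eqP; rewrite eq_complex /=; apply/andP; split; apply/eqP.
  apply: (mulIf N0); rewrite divfK // invf_div mulrA divfK //.
  by rewrite /p /q /p' /q'; field.
by move: N0 h; set N := l ^+ 2 * _ + _; set S := _ + _ => N0 h; field; rewrite N0 h.
Qed.

(* anti_mx g maps al to p'/p and be to q'/q. *)
Lemma geodesic_transport (al be : R) (g : 'M[int]_2) (al' be' : R) : g \in unitmx ->
  al < be -> al' < be' ->
  let p := (g 0 0)%:~R + al * (g 0 1)%:~R in let p' := (g 1 0)%:~R + al * (g 1 1)%:~R in
  let q := (g 0 0)%:~R + be * (g 0 1)%:~R in let q' := (g 1 0)%:~R + be * (g 1 1)%:~R in
  p != 0 -> q != 0 ->
  (p' / p = al' /\ q' / q = be') \/ (p' / p = be' /\ q' / q = al') ->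
  exists tau : R, (forall u, moebius (anti_mx g) (geodesic al be u) = geodesic al' be' (u + tau)) \/
             (forall u, moebius (anti_mx g) (geodesic al be u) = geodesic al' be' (tau - u)).
Proof.
move=> ug ab ab' p p' q q' p0 q0 h.
have d0 : 0 < be - al by rewrite subr_gt0.
have d0' : 0 < be' - al' by rewrite subr_gt0.
have hd : p * q' - p' * q = (\det g)%:~R * (be - al).
  by rewrite det_mx22 !(rmorphB, rmorphM) /p /p' /q /q'; ring.
have hd' : `|p * q' - p' * q| = be - al.
  rewrite hd; case/unimodP: (ug) => ->; rewrite ?rmorphN1 ?rmorph1 ?mul1r ?mulN1r ?normrN;
  by rewrite gtr0_norm.
have hd0 : p * q' - p' * q != 0 by rewrite -normr_eq0 hd' gt_eqF.
have e u : moebius (anti_mx g) (geodesic al be u) =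
   Complex ((1 ^+ 2 * p * p' + expR u ^+ 2 * q * q') / (1 ^+ 2 * p ^+ 2 + expR u ^+ 2 * q ^+ 2))
    (1 * expR u * `|p * q' - p' * q| / (1 ^+ 2 * p ^+ 2 + expR u ^+ 2 * q ^+ 2)).
  by rewrite -bqf_point_sum ?expR_gt0 // bqf_point_act ?expR_gt0 // divr1 expRK.
have np : 0 < `|p| by rewrite normr_gt0.
have nq : 0 < `|q| by rewrite normr_gt0.
have hN u : 1 ^+ 2 * p ^+ 2 + expR u ^+ 2 * q ^+ 2 =
  `|p| ^+ 2 + (expR u * `|q|) ^+ 2 by rewrite exprMn !real_normK ?num_real // expr1n mul1r.
have pos u : 0 < expR u * `|q| by rewrite mulr_gt0 ?expR_gt0.
have N0 u : `|p| ^+ 2 + (expR u * `|q|) ^+ 2 != 0 by rewrite gt_eqF // addr_gt0 ?exprn_gt0.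
case: h => -[hp hq].
  exists (ln (`|q| / `|p|)); left=> u.
  have -> : u + ln (`|q| / `|p|) = ln ((expR u * `|q|) / `|p|).
    by rewrite -mulrA lnM ?posrE ?expR_gt0 ?divr_gt0 // expRK.
  rewrite e hN geodesic_ratio //.
  have -> : `|p * q' - p' * q| = `|p| * `|q| * (be' - al').
    rewrite -{1}[be' - al']gtr0_norm // -hp -hq -normrM -normrM; congr `| _ |.
    by field; rewrite p0 q0.
  congr Complex; last by congr (_ / _); ring.
  congr (_ / _); rewrite -hp -hq exprMn !real_normK ?num_real //.
  by field; rewrite p0 q0.
exists (ln (`|p| / `|q|)); right=> u.
have -> : ln (`|p| / `|q|) - u = ln (`|p| / (expR u * `|q|)).
  rewrite invfM [_^-1 * _]mulrC mulrA lnM ?posrE ?invr_gt0 ?expR_gt0 ?divr_gt0 //.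
  by rewrite ln_div ?posrE ?divr_gt0 ?expR_gt0 // expRK ln_div ?posrE // lnV ?posrE.
rewrite e hN geodesic_ratio // [`|p| ^+ 2 + _]addrC.
have -> : `|p * q' - p' * q| = `|p| * `|q| * (be' - al').
  rewrite -{1}[be' - al']gtr0_norm // -hp -hq -normrM -normrM -[LHS]normrN; congr `| _ |.
  by field; rewrite p0 q0.
congr Complex; last by congr (_ / _); ring.
congr (_ / _); rewrite -hp -hq exprMn !real_normK ?num_real //.
by field; rewrite p0 q0.
Qed.

End GeodesicTransport.

(** * Cubic orders and binary cubic forms *)

(* The Delone-Faddeev table of the cubic form (a, b, c, d); its normalisation is that
   w1 w2 is an integer. *)
Definition cubic_table (A : comNzRingType) (w1 w2 a b c d : A) : Prop :=
  [/\ w1 ^+ 2 = - (a * c) + b * w1 + a * w2, w1 * w2 = a * d &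
      w2 ^+ 2 = - (b * d) + d * w1 + c * w2].

Definition int_table (A : comNzRingType) (w1 w2 : A) (C : int * int * int * int) : Prop :=
  let: (a, b, c, d) := C in
  cubic_table w1 w2 a%:~R b%:~R c%:~R d%:~R.

Section EndTrace.
Import VectorInternalTheory.

Lemma trace_coord (F : fieldType) (V : vectType F) (n : nat) (X : n.-tuple V)
    (f : 'End(V)) :
  basis_of fullv X -> \tr (f2mx f) = \sum_(i < n) coord X i (f X`_i).
Proof.
move=> bX.
pose B := \matrix_(i < n, k < dim V) (v2r X`_i) 0 k.
pose Bi := \matrix_(k < dim V, j < n) coord X j (r2v (delta_mx 0 k)).
have BiE (v : V) (j : 'I_n) : (v2r v *m Bi) 0 j = coord X j v.
  rewrite mxE -[in RHS](v2rK v) [X in r2v X]row_sum_delta linear_sum linear_sum /=.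
  by apply: eq_bigr => k _; rewrite !linearZ /= mxE.
have BBi : Bi *m B = 1%:M.
  apply/row_matrixP => k; rewrite row1 row_mul.
  transitivity (v2r (r2v (delta_mx 0 k) : V)); last by rewrite r2vK.
  rewrite [in RHS](coord_basis bX (memvf (r2v (delta_mx 0 k)))).
  rewrite linear_sum /=; apply/rowP => l.
  rewrite mxE summxE; apply: eq_bigr => j _.
  by rewrite linearZ /= !mxE.
rewrite -[f2mx f]mul1mx -BBi -mulmxA mxtrace_mulC /mxtrace.
apply: eq_bigr => i _; rewrite -BiE.
have -> : v2r (f X`_i) = v2r X`_i *m f2mx f by rewrite unlock /= r2vK.
rewrite !mxE; apply: eq_bigr => k _; congr (_ * _).
by rewrite !mxE; apply: eq_bigr => l _; rewrite mxE.
Qed.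

End EndTrace.

Lemma field_trace_coord (K : fieldExtType rat) (n : nat) (X : n.-tuple K) (a : K) :
  basis_of fullv X -> field_trace a = \sum_(i < n) coord X i (a * X`_i).
Proof.
move=> bX; rewrite /field_trace (trace_coord _ bX).
by apply: eq_bigr => i _; rewrite lfunE.
Qed.

Section Basis3.
Variables (K : fieldExtType rat) (w1 w2 : K).
Hypothesis hb : basis_of fullv [:: 1; w1; w2].

Definition coef3 (i : 'I_3) (x : K) : rat := coord [tuple 1; w1; w2] i x.

Lemma coef3E (x : K) : x = (coef3 0 x)%:A + coef3 1 x *: w1 + coef3 2%:R x *: w2.
Proof.
have := @coord_basis _ _ _ _ [tuple 1; w1; w2] x hb (memvf x).
by rewrite !big_ord_recr big_ord0 /= add0r => {1}->; congr (_ + _ + _);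
  congr (coord _ _ _ *: _); apply: val_inj.
Qed.

Lemma coef3_comb (x0 x1 x2 : rat) (i : 'I_3) :
  coef3 i (x0%:A + x1 *: w1 + x2 *: w2) = [:: x0; x1; x2]`_i.
Proof.
have fr : free [tuple 1; w1; w2] by exact: basis_free hb.
have c (j : 'I_3) : coef3 i [:: 1; w1; w2]`_j = (i == j)%:R.
  rewrite eq_sym; exact: (coord_free j i fr).
rewrite /coef3 !linearD /= !linearZ /= -!/(coef3 _ _).
rewrite (c 0) (c 1) (c 2%:R).
by case: i {c} => -[|[|[|//]]] /= hi; rewrite ?mulr1 ?mulr0 ?addr0 ?add0r.
Qed.

Lemma free3 (x0 x1 x2 y0 y1 y2 : rat) :
  x0%:A + x1 *: w1 + x2 *: w2 = y0%:A + y1 *: w1 + y2 *: w2 :> K ->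
  [/\ x0 = y0, x1 = y1 & x2 = y2].
Proof.
move=> /(congr1 (fun z => (coef3 0 z, coef3 1 z, coef3 2%:R z))).
by rewrite !coef3_comb /= => -[].
Qed.

Lemma free3_int (x0 x1 x2 y0 y1 y2 : int) :
  x0%:~R + x1%:~R * w1 + x2%:~R * w2 = y0%:~R + y1%:~R * w1 + y2%:~R * w2 :> K ->
  [/\ x0 = y0, x1 = y1 & x2 = y2].
Proof.
have h (z : int) (w : K) : z%:~R * w = z%:~R *: w by rewrite mulrzl scaler_int.
rewrite -[x0%:~R]mulr1 -[y0%:~R]mulr1 !h => /free3 [].
by move=> /eqP + /eqP + /eqP; rewrite !eqr_int => /eqP-> /eqP-> /eqP->.
Qed.

End Basis3.

Lemma alg_int (K : fieldExtType rat) (z : int) : (z%:~R)%:A = z%:~R :> K.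
Proof. by rewrite scaler_int. Qed.

Section Table.
Variables (K : fieldExtType rat) (w1 w2 : K).
Hypothesis hb : basis_of fullv [:: 1; w1; w2].
Variables (a b c d : int).
Hypothesis hC : int_table w1 w2 (a, b, c, d).

Let ra : rat := a%:~R.  Let rb : rat := b%:~R.
Let rc : rat := c%:~R.  Let rd : rat := d%:~R.

Lemma table_mul (x0 x1 x2 y0 y1 y2 : rat) :
  (x0%:A + x1 *: w1 + x2 *: w2) * (y0%:A + y1 *: w1 + y2 *: w2) =
  (x0 * y0 - ra * rc * x1 * y1 + ra * rd * (x1 * y2 + x2 * y1) - rb * rd * x2 * y2)%:A
  + (x0 * y1 + x1 * y0 + rb * x1 * y1 + rd * x2 * y2) *: w1
  + (x0 * y2 + x2 * y0 + ra * x1 * y1 + rc * x2 * y2) *: w2.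
Proof.
case: hC; rewrite -!alg_int -/ra -/rb -/rc -/rd => h1 h2 h3.
have hz (z : rat) (w : K) : z *: w = z%:A * w by rewrite mulr_algl.
rewrite (hz x1) (hz x2) (hz y1) (hz y2) (hz _ w1) (hz _ w2).
have hm (y z : rat) : (y * z)%:A = y%:A * z%:A :> K := rmorphM (in_alg K) y z.
have hd (y z : rat) : (y + z)%:A = y%:A + z%:A :> K := rmorphD (in_alg K) y z.
have hn (y : rat) : (- y)%:A = - y%:A :> K := rmorphN (in_alg K) y.
rewrite !(hm, hd, hn).
move: x0%:A x1%:A x2%:A y0%:A y1%:A y2%:A ra%:A rb%:A rc%:A rd%:A h1 h2 h3.
move=> X0 X1 X2 Y0 Y1 Y2 A B C D h1 h2 h3.
have -> : (X0 + X1 * w1 + X2 * w2) * (Y0 + Y1 * w1 + Y2 * w2) =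
  X0 * Y0 + (X0 * Y1 + X1 * Y0) * w1 + (X0 * Y2 + X2 * Y0) * w2 +
  X1 * Y1 * w1 ^+ 2 + (X1 * Y2 + X2 * Y1) * (w1 * w2) + X2 * Y2 * w2 ^+ 2 by ring.
by rewrite h1 h2 h3; ring.
Qed.

Lemma table_trace (x0 x1 x2 : rat) :
  field_trace (x0%:A + x1 *: w1 + x2 *: w2) = 3%:R * x0 + rb * x1 + rc * x2.
Proof.
rewrite (@field_trace_coord _ _ [tuple 1; w1; w2] _ hb).
rewrite !big_ord_recr big_ord0 /= add0r -!/(coef3 _ _ _ _).
have e (v : K) y0 y1 y2 : v = y0%:A + y1 *: w1 + y2 *: w2 ->
  (x0%:A + x1 *: w1 + x2 *: w2) * v =
  (x0%:A + x1 *: w1 + x2 *: w2) * (y0%:A + y1 *: w1 + y2 *: w2) by move->.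
rewrite (e 1 1 0 0); last by rewrite !scale0r !addr0 scale1r.
rewrite (e w1 0 1 0); last by rewrite !scale0r addr0 add0r scale1r.
rewrite (e w2 0 0 1); last by rewrite !scale0r !add0r scale1r.
by rewrite !table_mul -!/(coef3 _ _ _ _) !coef3_comb //=; ring.
Qed.

End Table.

Section TableHom.
Variables (K : fieldExtType rat) (w1 w2 : K).
Hypothesis hb : basis_of fullv [:: 1; w1; w2].
Variable C : int * int * int * int.
Hypothesis hC : int_table w1 w2 C.
Variables (F : comNzRingType) (io : {rmorphism rat -> F}) (v1 v2 : F).
Hypothesis hv : int_table v1 v2 C.

Definition table_hom (x : K) : F :=
  io (coef3 w1 w2 0 x) + io (coef3 w1 w2 1 x) * v1 + io (coef3 w1 w2 2%:R x) * v2.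

Lemma table_hom_comb (x0 x1 x2 : rat) :
  table_hom (x0%:A + x1 *: w1 + x2 *: w2) = io x0 + io x1 * v1 + io x2 * v2.
Proof. by rewrite /table_hom !coef3_comb. Qed.

Lemma table_hom_w1 : table_hom w1 = v1.
Proof.
have -> : w1 = 0%:A + 1 *: w1 + 0 *: w2 by rewrite !scale0r scale1r add0r addr0.
by rewrite table_hom_comb !rmorph0 rmorph1; ring.
Qed.

Lemma table_hom_w2 : table_hom w2 = v2.
Proof.
have -> : w2 = 0%:A + 0 *: w1 + 1 *: w2 by rewrite !scale0r scale1r !add0r.
by rewrite table_hom_comb !rmorph0 rmorph1; ring.
Qed.

Lemma table_hom1 : table_hom 1 = 1.
Proof.
have -> : 1 = 1%:A + 0 *: w1 + 0 *: w2 by rewrite !scale0r scale1r !addr0.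
by rewrite table_hom_comb !rmorph0 rmorph1; ring.
Qed.

Lemma table_homB : {morph table_hom : x y / x - y}.
Proof. by move=> x y; rewrite /table_hom /coef3 !linearB /= !rmorphB; ring. Qed.

Lemma table_homM : {morph table_hom : x y / x * y}.
Proof.
case: C hC hv => [[[a b] c] d] hC' [h1 h2 h3] x y.
rewrite (coef3E hb x) (coef3E hb y) (table_mul hC') !table_hom_comb.
move: (coef3 w1 w2 0 x) (coef3 w1 w2 1 x) (coef3 w1 w2 2%:R x).
move: (coef3 w1 w2 0 y) (coef3 w1 w2 1 y) (coef3 w1 w2 2%:R y).
move=> y0 y1 y2 x0 x1 x2.
rewrite !(rmorphD, rmorphN, rmorphM, rmorph_int) /=.
move: (io x0) (io x1) (io x2) (io y0) (io y1) (io y2) => X0 X1 X2 Y0 Y1 Y2.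
have -> : (X0 + X1 * v1 + X2 * v2) * (Y0 + Y1 * v1 + Y2 * v2) =
  X0 * Y0 + (X0 * Y1 + X1 * Y0) * v1 + (X0 * Y2 + X2 * Y0) * v2 +
  X1 * Y1 * v1 ^+ 2 + (X1 * Y2 + X2 * Y1) * (v1 * v2) + X2 * Y2 * v2 ^+ 2 by ring.
by rewrite h1 h2 h3; ring.
Qed.

Lemma table_hom_rmorphism : exists f : {rmorphism K -> F}, f =1 table_hom.
Proof.
pose a := GRing.isZmodMorphism.Build K F table_hom table_homB.
pose m := GRing.isMonoidMorphism.Build K F table_hom (conj table_hom1 table_homM).
pose f : {rmorphism K -> F} := HB.pack table_hom a m.
by exists f.
Qed.

End TableHom.

Section TableForms.
Variables (K : fieldExtType rat) (w1 w2 : K).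
Hypothesis hb : basis_of fullv [:: 1; w1; w2].
Variables (a b c d : int).
Hypothesis hC : int_table w1 w2 (a, b, c, d).

Definition hess (C : int * int * int * int) : bqf int :=
  let: (a, b, c, d) := C in
  BQF (b ^+ 2 - 3 * a * c) (b * c - 9 * a * d) (c ^+ 2 - 3 * b * d).

Definition cubic_disc (C : int * int * int * int) : int :=
  let: (a, b, c, d) := C in
  b ^+ 2 * c ^+ 2 - 4 * a * c ^+ 3 - 4 * b ^+ 3 * d - 27 * a ^+ 2 * d ^+ 2
  + 18 * a * b * c * d.

Lemma hess_disc C : bqf_disc (hess C) = - 3 * cubic_disc C.
Proof. by case: C => [[[? ?] ?] ?]; rewrite /bqf_disc /=; ring. Qed.

Lemma table_a_neq0 : a != 0.
Proof.
apply/eqP => a0; case: hC => h1 _ _; move: h1; rewrite a0 !mul0r oppr0 add0r addr0.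
move/eqP; rewrite expr2 -subr_eq0 -mulrBl mulf_eq0 => /orP[|] /eqP h.
  have := @free3_int _ _ _ hb 0 1 0 b 0 0.
  rewrite !mul0r !addr0 mul1r add0r -[X in _ -> X]/(_) => /(_ _)[]//.
  by move/eqP: h; rewrite subr_eq0 => /eqP.
have := @free3_int _ _ _ hb 0 1 0 0 0 0.
by rewrite !mul0r !addr0 mul1r add0r => /(_ h)[].
Qed.

Lemma table_perp (x y : int) : perp_comb w1 w2 x y =
  (- (b * x + c * y))%:~R%:A + (3 * x)%:~R *: w1 + (3 * y)%:~R *: w2.
Proof.
have tr1 : field_trace w1 = b%:~R.
  have := table_trace hb hC 0 1 0; rewrite !scale0r scale1r addr0 add0r => ->.
  by rewrite !mulr0 mulr1 add0r addr0.
have tr2 : field_trace w2 = c%:~R.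
  have := table_trace hb hC 0 0 1; rewrite !scale0r scale1r !add0r => ->.
  by rewrite !mulr0 mulr1 !add0r.
have hz (z : int) (w : K) : z%:~R *: w = z%:~R * w by rewrite scaler_int mulrzl.
rewrite /perp_comb /perp tr1 tr2 -[_ *~ x]mulrzl -[_ *~ y]mulrzl !hz !(intrD, intrM, rmorphN) /=.
by ring.
Qed.

Lemma table_perp_sq (x y : int) : field_trace (perp_comb w1 w2 x y ^+ 2) =
  (6 * bqf_eval (bqf_flip (hess (a, b, c, d))) x y)%:~R.
Proof.
rewrite table_perp expr2 (table_mul hC) (table_trace hb hC).
by rewrite /bqf_eval /bqf_flip /=; ring.
Qed.

Lemma table_trace_form :
  trace_form w1 w2 = bqf_scale 6 (bqf_flip (hess (a, b, c, d))).
Proof.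
rewrite /trace_form /bqf_of /bqf_map !table_perp_sq -!rmorphB !numq_int.
by rewrite /bqf_eval /bqf_scale /bqf_map /=; congr BQF; ring.
Qed.

Lemma table_basis_disc (n1 n2 : int) :
  basis_disc (w1 + n1%:~R) (w2 + n2%:~R) = (cubic_disc (a, b, c, d))%:~R.
Proof.
have tr (x0 x1 x2 y0 y1 y2 : rat) v v' : v = x0%:A + x1 *: w1 + x2 *: w2 :> K ->
   v' = y0%:A + y1 *: w1 + y2 *: w2 :> K -> field_trace (v * v') = _ :=
  fun e e' => etrans (congr1 _ (etrans (congr2 _ e e') (table_mul hC _ _ _ _ _ _)))
    (table_trace hb hC _ _ _).
have e0 : 1 = 1%:A + 0 *: w1 + 0 *: w2 by rewrite !scale0r scale1r !addr0.
have e1 : w1 + n1%:~R = n1%:~R%:A + 1 *: w1 + 0 *: w2.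
  by rewrite scale0r scale1r addr0 scaler_int addrC.
have e2 : w2 + n2%:~R = n2%:~R%:A + 0 *: w1 + 1 *: w2.
  by rewrite scale0r scale1r addr0 scaler_int addrC.
rewrite /basis_disc /= det_mx33 !mxE /=.
rewrite ?(tr _ _ _ _ _ _ _ _ e0 e0) ?(tr _ _ _ _ _ _ _ _ e0 e1) ?(tr _ _ _ _ _ _ _ _ e0 e2).
rewrite ?(tr _ _ _ _ _ _ _ _ e1 e0) ?(tr _ _ _ _ _ _ _ _ e1 e1) ?(tr _ _ _ _ _ _ _ _ e1 e2).
rewrite ?(tr _ _ _ _ _ _ _ _ e2 e0) ?(tr _ _ _ _ _ _ _ _ e2 e1) ?(tr _ _ _ _ _ _ _ _ e2 e2).
by rewrite /cubic_disc; ring.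
Qed.

Lemma perp_shift (x : K) (n : int) : perp (x + n%:~R) = perp x.
Proof.
rewrite /perp (coef3E hb x).
set x0 := coef3 _ _ _ _; set x1 := coef3 _ _ _ _; set x2 := coef3 _ _ _ _.
have -> : x0%:A + x1 *: w1 + x2 *: w2 + n%:~R = (x0 + n%:~R)%:A + x1 *: w1 + x2 *: w2.
  by rewrite scalerDl scaler_int; ring.
rewrite !(table_trace hb hC) mulrDr !scalerDl.
have -> : 3%:R * n%:~R = (3 * n)%:~R :> rat by rewrite intrM.
by rewrite !scaler_int intrM /=; ring.
Qed.

End TableForms.

Section ZBasis.
Variable K : fieldExtType rat.

Lemma is_zbasis3P (A : set K) (w1 w2 : K) :
  is_zbasis A [:: 1; w1; w2] <->
  basis_of fullv [:: 1; w1; w2] /\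
  (forall x, A x <-> exists n0 n1 n2 : int, x = n0%:~R + n1%:~R * w1 + n2%:~R * w2).
Proof.
have E (n : 'I_3 -> int) : \sum_(i < 3) [:: 1; w1; w2]`_i *~ n i =
    (n 0)%:~R + (n 1)%:~R * w1 + (n 2%:R)%:~R * w2.
  by rewrite !big_ord_recl big_ord0 /= addr0 !mulrzl addrA;
    congr (_ *~ n _ + _ *~ n _ + _ *~ n _); apply: val_inj.
split=> -[hb hA]; split=> //.
  move=> x; rewrite hA; split=> [[n]|[n0 [n1 [n2 ->]]]].
    by rewrite E => ->; exists (n 0), (n 1), (n 2%:R).
  by exists (fun i : 'I_3 => [:: n0; n1; n2]`_i); rewrite E.
apply/seteqP; split=> x; rewrite hA.
  case=> n0 [n1 [n2 ->]].
  by exists (fun i : 'I_3 => [:: n0; n1; n2]`_i); rewrite E.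
by case=> n; rewrite E => ->; exists (n 0), (n 1), (n 2%:R).
Qed.

Lemma basis3_span (w1 w2 a1 a2 : K) : basis_of fullv [:: 1; w1; w2] ->
  w1 \in span [:: 1; a1; a2] -> w2 \in span [:: 1; a1; a2] ->
  basis_of fullv [:: 1; a1; a2].
Proof.
move=> hb h1 h2; have d3 : \dim {: K} = 3%N.
  by rewrite -(size_basis (X := [tuple 1; w1; w2]) hb).
rewrite basisEdim d3 leqnn andbT; apply/subvP => x _; rewrite (coef3E hb x).
by rewrite !rpredD ?rpredZ // memv_span // !inE eqxx.
Qed.

Lemma basis3_shift (w1 w2 : K) (n1 n2 : int) :
  basis_of fullv [:: 1; w1; w2] ->
  basis_of fullv [:: 1; w1 + n1%:~R; w2 + n2%:~R].
Proof.
move=> hb; have s3 u : u \in [:: 1; w1 + n1%:~R; w2 + n2%:~R] ->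
    u \in span [:: 1; w1 + n1%:~R; w2 + n2%:~R] by apply: memv_span.
have sn (n : int) : n%:~R \in span [:: 1; w1 + n1%:~R; w2 + n2%:~R].
  by rewrite -[n%:~R](alg_int K) rpredZ // s3 // !inE eqxx.
apply: (basis3_span hb).
  by have := rpredB (s3 (w1 + n1%:~R) _) (sn n1); rewrite addrK; apply; rewrite !inE eqxx ?orbT.
by have := rpredB (s3 (w2 + n2%:~R) _) (sn n2); rewrite addrK; apply; rewrite !inE eqxx ?orbT.
Qed.

Lemma zbasis_shift (A : set K) (w1 w2 : K) (n1 n2 : int) :
  is_zbasis A [:: 1; w1; w2] -> is_zbasis A [:: 1; w1 + n1%:~R; w2 + n2%:~R].
Proof.
rewrite !is_zbasis3P => -[hb hA]; split; first exact: basis3_shift.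
move=> x; rewrite hA; split=> -[m0 [m1 [m2 ->]]].
  exists (m0 - m1 * n1 - m2 * n2), m1, m2.
  by rewrite !(intrD, intrM, rmorphN) /=; ring.
exists (m0 + m1 * n1 + m2 * n2), m1, m2.
by rewrite !(intrD, intrM) /=; ring.
Qed.

Lemma zbasis_mem (A : set K) (w1 w2 : K) : is_zbasis A [:: 1; w1; w2] -> A w1 /\ A w2.
Proof.
rewrite is_zbasis3P => -[hb hA]; split; apply/hA.
  by exists 0, 1, 0; rewrite !mul0r mul1r add0r addr0.
by exists 0, 0, 1; rewrite !mul0r mul1r !add0r.
Qed.

Lemma normalize (A : set K) (a1 a2 : K) : is_order A -> is_zbasis A [:: 1; a1; a2] ->
  exists n1 n2 : int, exists C, int_table (a1 + n1%:~R) (a2 + n2%:~R) C.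
Proof.
move=> [_ _ AM _] hz; have [A1 A2] := zbasis_mem hz.
have [hb hA] := (iffLR (is_zbasis3P _ _ _)) hz.
have [m0 [m1 [m2 e12]]] := (iffLR (hA _)) (AM _ _ A1 A2).
exists (- m2), (- m1).
set w1 := a1 + _; set w2 := a2 + _.
have hz' : is_zbasis A [:: 1; w1; w2] by apply: zbasis_shift.
have [hb' hA'] := (iffLR (is_zbasis3P _ _ _)) hz'; have [W1 W2] := zbasis_mem hz'.
have [e1 [b [a h1]]] := (iffLR (hA' _)) (AM _ _ W1 W1).
have [e2 [d [c h3]]] := (iffLR (hA' _)) (AM _ _ W2 W2).
have h2 : w1 * w2 = (m0 + m1 * m2)%:~R.
  have -> : w1 * w2 = a1 * a2 - m1%:~R * a1 - m2%:~R * a2 + m1%:~R * m2%:~R.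
    by rewrite /w1 /w2 !rmorphN; ring.
  by rewrite e12 intrD intrM; ring.
move: {e12} (m0 + m1 * m2) h2 => e0 h2.
have c1 : (a * e2)%:~R + (b * e0)%:~R + (e1 + a * c)%:~R * w2 + (a * d)%:~R * w1 = e0%:~R * w1.
  rewrite -h2 -[RHS]mulrA [w2 * w1]mulrC [RHS]mulrC.
  have -> : w1 * w2 * w1 = w1 * w1 * w2 by ring.
  rewrite h1 !(intrD, intrM) -h2.
  have -> : (e1%:~R + b%:~R * w1 + a%:~R * w2) * w2 = e1%:~R * w2 + b%:~R * (w1 * w2) + a%:~R * (w2 * w2) by ring.
  by rewrite h3; ring.
have c2 : (d * e1)%:~R + (c * e0)%:~R + (e2 + d * b)%:~R * w1 + (a * d)%:~R * w2 = e0%:~R * w2.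
  rewrite -h2.
  have -> : w1 * w2 * w2 = w2 * w2 * w1 by ring.
  rewrite h3 !(intrD, intrM) -h2.
  have -> : (e2%:~R + d%:~R * w1 + c%:~R * w2) * w1 = e2%:~R * w1 + d%:~R * (w1 * w1) + c%:~R * (w1 * w2) by ring.
  by rewrite h1; ring.
have [_ f1 f2] := @free3_int _ _ _ hb' (a * e2 + b * e0) (a * d) (e1 + a * c) 0 e0 0
  ltac:(by rewrite mul0r add0r addr0 -c1 intrD; ring).
have [_ g1 g2] := @free3_int _ _ _ hb' (d * e1 + c * e0) (e2 + d * b) (a * d) 0 0 e0
  ltac:(by rewrite mul0r !add0r -c2 intrD; ring).
have ee1 : e1 = - (a * c) by lia.
have ee2 : e2 = - (b * d) by lia.
exists (a, b, c, d); split; rewrite ?expr2 ?h1 ?h3 ?h2 ?ee1 ?ee2 -?f1 !(rmorphN, intrM) //=;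
  by rewrite intrM.
Qed.

End ZBasis.

(* A cubic form with Hessian proportional to (x - al y)(x - be y) is
   k1^3 (x - al y)^3 + k2^3 (x - be y)^3. *)
Definition cubic_coords (R : comNzRingType) (al be k1 k2 : R)
    (C : int * int * int * int) : Prop :=
  let: (a, b, c, d) := C in
  [/\ a%:~R = k1 ^+ 3 + k2 ^+ 3,
      b%:~R = - 3%:R * (al * k1 ^+ 3 + be * k2 ^+ 3),
      c%:~R = 3%:R * (al ^+ 2 * k1 ^+ 3 + be ^+ 2 * k2 ^+ 3) &
      d%:~R = - (al ^+ 3 * k1 ^+ 3 + be ^+ 3 * k2 ^+ 3)].

Section RootValues.
Variables (A : comNzRingType) (al be k1 k2 : A).
Let q := - (be - al) * k1 ^+ 2 * k2.
Let r := (be - al) * k1 * k2 ^+ 2.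
Let p1 := - (al * k1 ^+ 3 + be * k2 ^+ 3).
Let p2 := al ^+ 2 * k1 ^+ 3 + be ^+ 2 * k2 ^+ 3.

Definition root1 (z : A) : A := p1 + z * q + z ^+ 2 * r.
Definition root2 (z : A) : A := p2 + z * (al * q) + z ^+ 2 * (be * r).

Lemma root_table (z : A) (C : int * int * int * int) :
  cubic_coords al be k1 k2 C -> z ^+ 3 = 1 -> int_table (root1 z) (root2 z) C.
Proof.
case: C => [[[a b] c] d] [ea eb ec ed] z3.
have prd (s0 s1 s2 t0 t1 t2 : A) :
    (s0 + z * s1 + z ^+ 2 * s2) * (t0 + z * t1 + z ^+ 2 * t2) =
    (s0 * t0 + s1 * t2 + s2 * t1) + z * (s0 * t1 + s1 * t0 + s2 * t2) +
    z ^+ 2 * (s0 * t2 + s1 * t1 + s2 * t0).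
  transitivity ((s0 * t0 + z ^+ 3 * (s1 * t2 + s2 * t1)) +
    z * (s0 * t1 + s1 * t0 + z ^+ 3 * (s2 * t2)) +
    z ^+ 2 * (s0 * t2 + s1 * t1 + s2 * t0)); first by ring.
  by rewrite z3; ring.
rewrite /int_table /cubic_table /root1 /root2 !(expr2 (_ + _)) !prd ea eb ec ed /q /r /p1 /p2.
by split; ring.
Qed.

Lemma root1_poly (z x : A) (C : int * int * int * int) :
  cubic_coords al be k1 k2 C -> z ^+ 2 = - 1 - z ->
  (x - root1 1) * (x - root1 z) * (x - root1 (- 1 - z)) =
  x ^+ 3 - (C.1.1.2)%:~R * x ^+ 2 + (C.1.1.1)%:~R * (C.1.2)%:~R * x -
  (C.1.1.1)%:~R ^+ 2 * (C.2)%:~R.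
Proof.
case: C => [[[a b] c] d] [ea eb ec ed] z2 /=.
have -> : root1 (- 1 - z) = p1 + (- 1 - z) * q + z * r.
  rewrite /root1; congr (_ + _ * _).
  have -> : (-1 - z) ^+ 2 = 1 + 2%:R * z + z ^+ 2 by ring.
  by rewrite z2; ring.
have -> : root1 z = p1 + z * q + (- 1 - z) * r by rewrite /root1 z2.
transitivity ((x - p1) ^+ 3 - q ^+ 3 - r ^+ 3 - 3%:R * q * r * (x - p1)).
  have h (y u v : A) : (y - (u + v)) * (y - (z * u + (- 1 - z) * v))
      * (y - ((- 1 - z) * u + z * v)) = y ^+ 3 - u ^+ 3 - v ^+ 3 - 3%:R * u * v * y.
    have hs : z + (- 1 - z) = - 1 by ring.
    have hp : z * (- 1 - z) = 1 by rewrite mulrBr -expr2 z2; ring.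
    move: (- 1 - z) hs hp => s hs hp.
    transitivity ((y - (u + v)) * (y ^+ 2 - (z + s) * y * (u + v) + z * s * u ^+ 2 +
      ((z + s) ^+ 2 - 2%:R * (z * s)) * u * v + z * s * v ^+ 2)); first by ring.
    by rewrite hs hp; ring.
  rewrite -h; rewrite /root1; congr (_ * _ * _); ring.
by rewrite ea eb ec ed /q /r /p1; ring.
Qed.

End RootValues.

Section Embeddings.
Variable R : realType.
Variables (al be k1 k2 : R) (C : int * int * int * int).
Hypotheses (ltab : al < be) (k10 : 0 < k1) (k20 : 0 < k2).
Hypothesis hk : cubic_coords al be k1 k2 C.
Variables (K : fieldExtType rat) (w1 w2 : K).
Hypothesis hb : basis_of fullv [:: 1; w1; w2].
Hypothesis hC : int_table w1 w2 C.

Definition zeta3 : R[i] := Complex (- 2%:R^-1) (Num.sqrt 3%:R / 2%:R).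

Lemma zeta3_sqr : zeta3 ^+ 2 = - 1 - zeta3.
Proof.
have s3 : Num.sqrt 3%:R ^+ 2 = 3%:R :> R by rewrite sqr_sqrtr.
apply/eqP; rewrite expr2 eq_complex /=; apply/andP; split; apply/eqP.
  by rewrite -[X in _ - X]expr2 expr_div_n s3; field.
by field.
Qed.

Let rt1 (z : R[i]) : R[i] := root1 al%:C%C be%:C%C k1%:C%C k2%:C%C z.
Let rt2 (z : R[i]) : R[i] := root2 al%:C%C be%:C%C k1%:C%C k2%:C%C z.
Let A1 := - (be - al) * k1 ^+ 2 * k2.
Let A2 := (be - al) * k1 * k2 ^+ 2.

Lemma cubic_coordsC : cubic_coords al%:C%C be%:C%C k1%:C%C k2%:C%C C.
Proof.
case: C hk => [[[a b] c] d] [ea eb ec ed].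
split; [move: ea | move: eb | move: ec | move: ed];
  move=> /(congr1 (fun x : R => x%:C%C)); rewrite rmorph_int => ->;
  by rewrite !(rmorphD, rmorphN, rmorphM, rmorphXn, rmorph_nat).
Qed.

Lemma embedding_roots (f : {rmorphism K -> R[i]}) :
  [\/ f w1 = rt1 1, f w1 = rt1 zeta3 | f w1 = rt1 (- 1 - zeta3)].
Proof.
have := root1_poly (f w1) cubic_coordsC zeta3_sqr.
rewrite -/(rt1 _) -/(rt1 _) -/(rt1 _); case: C hC => [[[a b] c] d] [h1 h2 _] /=.
have hK : w1 ^+ 3 - b%:~R * w1 ^+ 2 + a%:~R * c%:~R * w1 - a%:~R ^+ 2 * d%:~R = 0.
  have -> : w1 ^+ 3 = - (a%:~R * c%:~R) * w1 + b%:~R * w1 ^+ 2 + a%:~R * (w1 * w2).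
    by rewrite exprSr [in LHS]h1; ring.
  by rewrite h2; ring.
have := congr1 f hK; rewrite !(rmorphB, rmorphD, rmorphM, rmorphXn, rmorph_int, rmorph0) => ->.
move/eqP; rewrite !mulf_eq0 !subr_eq0 => /orP[/orP[]|] /eqP->;
  by [constructor 1 | constructor 2 | constructor 3].
Qed.

Lemma embedding_eq (f g : {rmorphism K -> R[i]}) : f w1 = g w1 -> f =1 g.
Proof.
case: C hC => [[[a b] c] d] hC' e1 x.
have a0 := table_a_neq0 hb hC'; case: hC' => h1 _ _.
have e2 : f w2 = g w2.
  have aC : a%:~R != 0 :> R[i] by rewrite intr_eq0.
  apply: (mulfI aC); rewrite -{1}(rmorph_int f) -(rmorph_int g) -!rmorphM.
  have -> : a%:~R * w2 = w1 ^+ 2 + a%:~R * c%:~R - b%:~R * w1 by rewrite h1; ring.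
  by rewrite !(rmorphB, rmorphD, rmorphM, rmorphXn, rmorph_int) e1.
have er (h : {rmorphism K -> R[i]}) (y : rat) : h y%:A = ratr y.
  by rewrite -(fmorph_eq_rat (h \o in_alg K)).
rewrite (coef3E hb x) -[_ *: w1]mulr_algl -[_ *: w2]mulr_algl.
by rewrite !rmorphD !rmorphM !er e1 e2.
Qed.

Lemma exists_embedding (z : R[i]) : z ^+ 3 = 1 ->
  exists f : {rmorphism K -> R[i]}, f w1 = rt1 z /\ f w2 = rt2 z.
Proof.
move=> z3; have ht := root_table cubic_coordsC z3.
have [f fE] := table_hom_rmorphism hb hC (ratr : {rmorphism rat -> R[i]}) ht.
by exists f; rewrite !fE (table_hom_w1 hb) (table_hom_w2 hb).
Qed.

Lemma embedding_perp (f : {rmorphism K -> R[i]}) (z : R[i]) (x y : int) :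
  f w1 = rt1 z -> f w2 = rt2 z ->
  f (perp_comb w1 w2 x y) = z * (3%:R * A1 * (x%:~R + al * y%:~R))%:C%C +
                       z ^+ 2 * (3%:R * A2 * (x%:~R + be * y%:~R))%:C%C.
Proof.
move=> e1 e2; have er (q : int) : f q%:~R = q%:~R by rewrite rmorph_int.
have := cubic_coordsC; case: C hC => [[[a b] c] d] hC' [_ eb ec _].
have hz (n : int) (w : K) : n%:~R *: w = n%:~R * w by rewrite scaler_int mulrzl.
rewrite (table_perp hb hC') !hz mulr1.
rewrite !(rmorphD, rmorphM, rmorphN, rmorph_int, rmorph1) /= e1 e2 eb ec.
by rewrite /rt1 /rt2 /root1 /root2; ring.
Qed.

Lemma table_embeddings : exists f : 'I_3 -> {rmorphism K -> R[i]},
  [/\ forall j, f j w1 = rt1 (zeta3 ^+ j) /\ f j w2 = rt2 (zeta3 ^+ j),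
      @embeddings R K = [set (f j : K -> R[i]) | j in setT],
      injective (fun j => f j : K -> R[i]) &
      forall j, real_valued (f j) <-> j = 0].
Proof.
have z3 : zeta3 ^+ 3 = 1.
  by rewrite exprS zeta3_sqr mulrBr mulrN mulr1 -expr2 zeta3_sqr; ring.
have z3j (j : nat) : (zeta3 ^+ j) ^+ 3 = 1 by rewrite -exprM mulnC exprM z3 expr1n.
have [f0 h0] := exists_embedding (z3j 0%N).
have [f1 h1] := exists_embedding (z3j 1%N).
have [f2 h2] := exists_embedding (z3j 2%N).
pose f (j : 'I_3) := if j == 0 then f0 else if j == 1 then f1 else f2.
have hf j : f j w1 = rt1 (zeta3 ^+ j) /\ f j w2 = rt2 (zeta3 ^+ j).
  by case: j => -[|[|[|//]]] hj.
have s30 : Num.sqrt 3%:R / 2%:R != 0 :> R by rewrite mulf_neq0 ?invr_eq0 ?pnatr_eq0 // gt_eqF // sqrtr_gt0.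
have z2 : zeta3 ^+ 2 = - 1 - zeta3 := zeta3_sqr.
have A10 : A1 < 0 by rewrite /A1 mulNr mulNr oppr_lt0 !mulr_gt0 ?exprn_gt0 ?subr_gt0.
have A20 : 0 < A2 by rewrite !mulr_gt0 ?exprn_gt0 ?subr_gt0.
have im (j : 'I_3) : complex.Im (f j w1) =
    [:: 0; (A1 - A2) * (Num.sqrt 3%:R / 2%:R); - ((A1 - A2) * (Num.sqrt 3%:R / 2%:R))]`_j.
  have [-> _] := hf j.
  have -> : rt1 (zeta3 ^+ j) = (- (al * k1 ^+ 3 + be * k2 ^+ 3))%:C%C +
     zeta3 ^+ j * A1%:C%C + (zeta3 ^+ j) ^+ 2 * A2%:C%C.
    by rewrite /rt1 /root1 !(rmorphXn, rmorphM, rmorphD, rmorphN).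
  case: j => -[|[|[|//]]] hj; rewrite [nth _ _ _]/= [nat_of_ord _]/=.
  - by rewrite ?expr0 ?expr1n ?mul1r /=; ring.
  - by rewrite expr1 z2 /=; field.
  - by rewrite -exprM (exprD _ 3 1) z3 mul1r expr1 z2 /=; field.
have fim j : j != 0 -> complex.Im (f j w1) != 0.
  rewrite im; case: j => -[|[|[|//]]] hj //= _;
  by rewrite ?oppr_eq0 mulf_neq0 // subr_eq0 lt_eqF // (lt_trans A10).
have fi : injective (fun j => f j : K -> R[i]).
  move=> i j /(congr1 (fun g => complex.Im (g w1))); rewrite !im.
  have hne : (A1 - A2) * (Num.sqrt 3%:R / 2%:R) != 0.
    by rewrite mulf_neq0 // subr_eq0 lt_eqF // (lt_trans A10).
  have hne2 : (A1 - A2) * (Num.sqrt 3%:R / 2%:R) != - ((A1 - A2) * (Num.sqrt 3%:R / 2%:R)).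
    by rewrite -subr_eq0 opprK -mulr2n mulrn_eq0.
  move: hne hne2; set t := (A1 - A2) * _ => t0 t1.
  case: i => -[|[|[|//]]] hi; case: j => -[|[|[|//]]] hj /= /eqP h;
    first [by apply: val_inj | exfalso; move: h;
      rewrite ?(eq_sym 0 t) ?(eq_sym 0 (- t)) ?(eq_sym (- t) t) ?oppr_eq0 ?(negbTE t0) ?(negbTE t1) //].
exists f; split=> //.
  apply/seteqP; split=> g /=.
    case=> h _ <-; have := embedding_roots h.
    have key (j : 'I_3) : h w1 = rt1 (zeta3 ^+ j) -> exists2 j, setT j & (f j : K -> R[i]) = h.
      move=> e; exists j => //; apply/funext; apply: embedding_eq.
      by rewrite e; case: (hf j).
    by case=> e; [apply: (key 0) | apply: (key 1) | apply: (key 2%:R)]; rewrite e /= ?z2.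
  by case=> j _ <-; exists (f j).
move=> j; split=> [rv|->].
  by apply/eqP/negPn/negP => /fim; rewrite rv eqxx.
move=> x; rewrite (coef3E hb x) -[_ *: w1]mulr_algl -[_ *: w2]mulr_algl !rmorphD !rmorphM.
have er (y : rat) : f 0 y%:A = (ratr y : R)%:C%C.
  have -> : f 0 y%:A = ratr y := fmorph_eq_rat (f 0 \o in_alg K) y.
  exact/esym/(fmorph_eq_rat (real_complex R \o ratr) y).
have [-> ->] := hf 0; rewrite !er expr0 /rt1 /rt2 /root1 /root2 !mul1r expr1n !mul1r.
by rewrite -!(rmorphXn, rmorphM, rmorphD, rmorphN).
Qed.

Lemma table_complex_cubic : complex_cubic R K.
Proof.
have [f [hf he fi fr]] := table_embeddings.
have d3 : \dim {: K} = 3%N by rewrite -(size_basis (X := [tuple 1; w1; w2]) hb).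
split=> //.
  rewrite (_ : [set g | _] = [set (f 0 : K -> R[i])]); first exact: card_set1.
  rewrite he; apply/seteqP; split=> g /=; first by case=> -[j _ <-] /fr ->.
  by move=> ->; split; [exists 0 | apply/fr].
rewrite (_ : [set g | _] = [set (f 1 : K -> R[i]); (f 2%:R : K -> R[i])]).
  apply/eq_cardSP; exists (f 1 : K -> R[i]); first by left.
  rewrite (_ : _ `\` _ = [set (f 2%:R : K -> R[i])]); first exact: card_set1.
  apply/seteqP; split=> g /=; first by case=> -[].
  by move=> ->; split; [right | move/fi].
rewrite he; apply/seteqP; split=> g /=.
  case=> -[j _ <-] nr; have j0 : j <> 0 by move/fr.
  case: j j0 {nr} => -[|[|[|//]]] hj j0.
  - by case: j0; apply: val_inj.
  - by left; congr (f _ : K -> R[i]); apply: val_inj.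
  - by right; congr (f _ : K -> R[i]); apply: val_inj.
by case=> ->; (split; [by eexists | by move/fr]).
Qed.

Lemma embedding_sum (x y : int) :
  \sum_(f \in @embeddings R K)
      ((complex.Re (f (perp_comb w1 w2 x y))) ^+ 2 +
       (complex.Im (f (perp_comb w1 w2 x y))) ^+ 2) =
  27%:R * (A1 ^+ 2 * (x%:~R + al * y%:~R) ^+ 2 + A2 ^+ 2 * (x%:~R + be * y%:~R) ^+ 2).
Proof.
have [f [hf -> fi fr]] := table_embeddings.
rewrite (reindex_fsbig (fun j => f j : K -> R[i]) setT); last first.
  by split=> // i j _ _; exact: fi.
rewrite (_ : setT = [set` enum 'I_3]); last first.
  by apply/seteqP; split=> // j _ /=; rewrite mem_enum.
rewrite -fsbig_seq ?enum_uniq // big_enum /= !big_ord_recl big_ord0.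
have s3 : Num.sqrt 3%:R ^+ 2 = 3%:R :> R by rewrite sqr_sqrtr.
have e (j : 'I_3) := embedding_perp x y (hf j).1 (hf j).2.
set X := 3%:R * A1 * (x%:~R + al * y%:~R) in e *.
set Y := 3%:R * A2 * (x%:~R + be * y%:~R) in e *.
have z3 : zeta3 ^+ 3 = 1.
  by rewrite exprS zeta3_sqr mulrBr mulrN mulr1 -expr2 zeta3_sqr; ring.
have e0 : f ord0 (perp_comb w1 w2 x y) = (X + Y)%:C%C.
  by rewrite e [nat_of_ord _]/= expr0 expr1n !mul1r rmorphD.
have e1 : f (lift ord0 ord0) (perp_comb w1 w2 x y) = zeta3 * X%:C%C + (- 1 - zeta3) * Y%:C%C.
  by rewrite e [nat_of_ord _]/= expr1 zeta3_sqr.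
have e2 : f (lift ord0 (lift ord0 ord0)) (perp_comb w1 w2 x y) =
    (- 1 - zeta3) * X%:C%C + zeta3 * Y%:C%C.
  by rewrite e [nat_of_ord _]/= -exprM (exprD _ 3 1) z3 mul1r expr1 zeta3_sqr.
rewrite e0 e1 e2 /=.
transitivity (3%:R / 2%:R * (X + Y) ^+ 2 + Num.sqrt 3%:R ^+ 2 * (X - Y) ^+ 2 / 2%:R); first by field.
by rewrite s3 /X /Y; field.
Qed.

End Embeddings.

(** * Change of basis and isomorphism of orders *)

Section BaseChange.
Variable K : fieldExtType rat.

Definition base_change (g : 'M[int]_2) (n1 n2 : int) (w1 w2 a1 a2 : K) : Prop :=
  a1 = n1%:~R + (g 0 0)%:~R * w1 + (g 0 1)%:~R * w2 /\
  a2 = n2%:~R + (g 1 0)%:~R * w1 + (g 1 1)%:~R * w2.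

Lemma base_change_mul (g h : 'M[int]_2) (m1 m2 n1 n2 : int) (w1 w2 a1 a2 b1 b2 : K) :
  base_change h n1 n2 w1 w2 a1 a2 -> base_change g m1 m2 a1 a2 b1 b2 ->
  base_change (g *m h) (m1 + g 0 0 * n1 + g 0 1 * n2) (m2 + g 1 0 * n1 + g 1 1 * n2)
     w1 w2 b1 b2.
Proof.
by case=> -> -> [-> ->]; split; rewrite !mulmx2E !(intrD, intrM); ring.
Qed.

Lemma unimod_of_mul (g h : 'M[int]_2) : h *m g = 1%:M -> g \in unitmx.
Proof. by move=> e; case/mulmx1_unit: e. Qed.

Lemma zbasis_related (A : set K) (w1 w2 a1 a2 : K) :
  is_zbasis A [:: 1; w1; w2] -> is_zbasis A [:: 1; a1; a2] ->
  exists (g : 'M[int]_2) (n1 n2 : int), g \in unitmx /\ base_change g n1 n2 w1 w2 a1 a2.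
Proof.
have half (u1 u2 v1 v2 : K) : is_zbasis A [:: 1; u1; u2] -> is_zbasis A [:: 1; v1; v2] ->
    exists g n1 n2, base_change g n1 n2 u1 u2 v1 v2.
  move=> /is_zbasis3P[_ hu] hv; have [/hu [n1 [x [y ->]]] /hu[n2 [x' [y' ->]]]] := zbasis_mem hv.
  exists (\matrix_(i, j) (if i == 0 then (if j == 0 then x else y) else (if j == 0 then x' else y'))).
  by exists n1, n2; split; rewrite !mxE.
move=> hw ha; have [g [n1 [n2 hg]]] := half _ _ _ _ hw ha.
have [h [m1 [m2 hh]]] := half _ _ _ _ ha hw.
exists g, n1, n2; split=> //; apply: (@unimod_of_mul g h).
have [hb _] := (iffLR (is_zbasis3P _ _ _)) hw.
have [e1 e2] := base_change_mul hg hh.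
have [_ f1 f2] : [/\ 0 = m1 + h 0 0 * n1 + h 0 1 * n2, 1 = (h *m g) 0 0 & 0 = (h *m g) 0 1].
  by apply: (free3_int hb); rewrite -e1; ring.
have [_ f3 f4] : [/\ 0 = m2 + h 1 0 * n1 + h 1 1 * n2, 0 = (h *m g) 1 0 & 1 = (h *m g) 1 1].
  by apply: (free3_int hb); rewrite -e2; ring.
by apply: mx2P; rewrite [RHS]mxE.
Qed.

Lemma zbasis_change (A : set K) (w1 w2 : K) (g : 'M[int]_2) : g \in unitmx ->
  is_zbasis A [:: 1; w1; w2] ->
  is_zbasis A [:: 1; (g 0 0)%:~R * w1 + (g 0 1)%:~R * w2; (g 1 0)%:~R * w1 + (g 1 1)%:~R * w2].
Proof.
move=> ug /is_zbasis3P [hb hA]; apply/is_zbasis3P.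
set a1 := (X in [:: 1; X; _]); set a2 := (X in [:: 1; _; X]).
have hgi := mulVmx ug; set h := invmx g in hgi.
have i00 := congr1 (fun M : 'M[int]_2 => M 0 0) hgi; have i01 := congr1 (fun M : 'M[int]_2 => M 0 1) hgi.
have i10 := congr1 (fun M : 'M[int]_2 => M 1 0) hgi; have i11 := congr1 (fun M : 'M[int]_2 => M 1 1) hgi.
move: i00 i01 i10 i11; rewrite /= !mulmx2E !mxE /= => i00 i01 i10 i11.
have ev (F : comNzRingType) (u v : int) (w1' w2' : F) (u' v' : int) :
    u = u' -> v = v' -> u%:~R * w1' + v%:~R * w2' = u'%:~R * w1' + v'%:~R * w2' by move=> -> ->.
have e1 : w1 = (h 0 0)%:~R * a1 + (h 0 1)%:~R * a2.
  have := ev K _ _ w1 w2 _ _ i00 i01; rewrite mul1r mul0r addr0 => <-.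
  by rewrite /a1 /a2 !(intrD, intrM); ring.
have e2 : w2 = (h 1 0)%:~R * a1 + (h 1 1)%:~R * a2.
  have := ev K _ _ w1 w2 _ _ i10 i11; rewrite mul1r mul0r add0r => <-.
  by rewrite /a1 /a2 !(intrD, intrM); ring.
have hz (n : int) (y : K) : n%:~R * y = n%:~R *: y by rewrite scaler_int mulrzl.
have ha1 : a1 \in span [:: 1; a1; a2] by rewrite memv_span // !inE eqxx orbT.
have ha2 : a2 \in span [:: 1; a1; a2] by rewrite memv_span // !inE eqxx !orbT.
split.
  by apply: (basis3_span hb); rewrite ?e1 ?e2 -/a1 -/a2 !hz rpredD ?rpredZ.
move=> x; rewrite hA; split=> -[n0 [n1 [n2 ->]]].
  exists n0, (n1 * h 0 0 + n2 * h 1 0), (n1 * h 0 1 + n2 * h 1 1).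
  transitivity (n0%:~R + n1%:~R * ((h 0 0)%:~R * a1 + (h 0 1)%:~R * a2) +
    n2%:~R * ((h 1 0)%:~R * a1 + (h 1 1)%:~R * a2)); first by rewrite -e1 -e2.
  by rewrite -/a1 -/a2 !(intrD, intrM); ring.
exists n0, (n1 * g 0 0 + n2 * g 1 0), (n1 * g 0 1 + n2 * g 1 1).
by rewrite /a1 /a2 !(intrD, intrM); ring.
Qed.

Lemma table_inj (w1 w2 : K) (C C' : int * int * int * int) :
  basis_of fullv [:: 1; w1; w2] -> int_table w1 w2 C -> int_table w1 w2 C' -> C' = C.
Proof.
move=> hb hC; move: hC.
case: C => [[[a b] c] d] [h1 h2 h3]; case: C' => [[[a' b'] c'] d'] [h1' h2' h3'].
have [_ -> ->] : [/\ - (a' * c') = - (a * c), b' = b & a' = a].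
  by apply: (free3_int hb); rewrite !rmorphN !rmorphM /= -h1 -h1'.
have [_ -> ->] : [/\ - (b' * d') = - (b * d), d' = d & c' = c].
  by apply: (free3_int hb); rewrite !rmorphN !rmorphM /= -h3 -h3'.
by [].
Qed.

Section WithTable.
Variables (w1 w2 : K) (C : int * int * int * int).
Hypothesis hb : basis_of fullv [:: 1; w1; w2].
Hypothesis hC : int_table w1 w2 C.

Lemma perp_comb_change (g : 'M[int]_2) (n1 n2 : int) (a1 a2 : K) (x y : int) :
  base_change g n1 n2 w1 w2 a1 a2 ->
  perp_comb a1 a2 x y =
  perp_comb w1 w2 (x * g 0 0 + y * g 1 0) (x * g 0 1 + y * g 1 1).
Proof.
case: C hC => [[[a b] c] d] hC' [-> ->].
have hz (n : int) (w : K) : n%:~R *: w = n%:~R * w by rewrite scaler_int mulrzl.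
have hp (n0 u v : int) : perp (n0%:~R + u%:~R * w1 + v%:~R * w2) =
   (- (b * u + c * v))%:~R + (3 * u)%:~R * w1 + (3 * v)%:~R * w2.
  rewrite /perp -(mulr1 n0%:~R) -!hz (table_trace hb hC') !hz mulr1.
  have -> : 3%:R * n0%:~R + b%:~R * u%:~R + c%:~R * v%:~R = (3 * n0 + b * u + c * v)%:~R :> rat.
    by rewrite !(intrD, intrM).
  by rewrite scaler_int !(intrD, intrM, rmorphN) /=; ring.
rewrite (table_perp hb hC') !hz /perp_comb !hp -[_ *~ x]mulrzl -[_ *~ y]mulrzl.
by rewrite mulr1 !(intrD, intrM, rmorphN) /=; ring.
Qed.

Lemma hess_change (g : 'M[int]_2) (n1 n2 : int) (a1 a2 : K) (C' : int * int * int * int) :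
  basis_of fullv [:: 1; a1; a2] -> int_table a1 a2 C' ->
  base_change g n1 n2 w1 w2 a1 a2 ->
  bqf_flip (hess C') = bqf_act g (bqf_flip (hess C)).
Proof.
case: C hC => [[[a b] c] d] hC'; case: C' => [[[a' b'] c'] d'] hb' hC'' hg.
apply: bqf_ext => x y; rewrite bqf_eval_act.
have := table_perp_sq hb' hC'' x y; rewrite (perp_comb_change x y hg) (table_perp_sq hb hC').
by move=> /eqP; rewrite eqr_int => /eqP; lia.
Qed.

Lemma trace_form_change (n1 n2 : int) :
  trace_form (w1 + n1%:~R) (w2 + n2%:~R) = bqf_scale 6 (bqf_flip (hess C)).
Proof.
case: C hC => [[[a b] c] d] hC'; rewrite -(table_trace_form hb hC').
by rewrite /trace_form /perp_comb !(perp_shift hb hC').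
Qed.

Lemma table_neg : int_table (- w1) (- w2) (- C.1.1.1, - C.1.1.2, - C.1.2, - C.2).
Proof.
case: C hC => [[[a b] c] d] [h1 h2 h3] /=; split; rewrite ?sqrrN ?mulrNN ?h1 ?h2 ?h3 !rmorphN /=; ring.
Qed.

(* The normalisation w1 w2 in Z rigidifies the choice of a basis modulo Z. *)
Lemma table_rigid (g : 'M[int]_2) (n1 n2 : int) (a1 a2 : K) C' : int_table a1 a2 C' ->
  base_change g n1 n2 w1 w2 a1 a2 -> g = 1%:M \/ g = - 1%:M ->
  C' = C \/ C' = (- C.1.1.1, - C.1.1.2, - C.1.2, - C.2).
Proof.
have key (u1 u2 : K) D D' (m1 m2 : int) : basis_of fullv [:: 1; u1; u2] -> int_table u1 u2 D ->
    int_table (u1 + m1%:~R) (u2 + m2%:~R) D' -> m1 = 0 /\ m2 = 0.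
  case: D => [[[a b] c] d]; case: D' => [[[a' b'] c'] d'] hu [_ h2 _] [_ h2' _].
  have [_ -> ->] // : [/\ a * d + m1 * m2 = a' * d', m2 = 0 & m1 = 0].
  apply: (free3_int hu); rewrite !mul0r !addr0 [RHS]intrM -h2' intrD !intrM -h2.
  by ring.
move=> hC' [e1 e2] [eg|eg]; move: e1 e2 hC'; rewrite eg !mxE /=.
  rewrite mulr0n mulr1n !mul0r !mul1r !addr0 => -> ->; rewrite addrC [n2%:~R + _]addrC => h.
  have [m1 m2] := key _ _ _ _ _ _ hb hC h; left.
  by move: h; rewrite m1 m2 !addr0 => /(table_inj hb hC).
rewrite mulr0n mulr1n oppr0 !mul0r !mulN1r !addr0 => -> ->; rewrite addrC [n2%:~R + _]addrC => h.
have hbN : basis_of fullv [:: 1; - w1; - w2].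
  by apply: (basis3_span hb); rewrite -rpredN memv_span // !inE eqxx ?orbT.
have [m1 m2] := key _ _ _ _ _ _ hbN table_neg h; right.
by move: h; rewrite m1 m2 !addr0; apply: table_inj hbN table_neg.
Qed.

End WithTable.

Lemma minkowski_point (R : realType) (al be k1 k2 : R) (C : int * int * int * int)
    (w1 w2 a1 a2 : K) (g : 'M[int]_2) (n1 n2 : int) :
  al < be -> 0 < k1 -> 0 < k2 -> cubic_coords al be k1 k2 C ->
  basis_of fullv [:: 1; w1; w2] -> int_table w1 w2 C -> g \in unitmx ->
  base_change g n1 n2 w1 w2 a1 a2 ->
  bqf_point (minkowski_form R a1 a2) = moebius (anti_mx g) (geodesic al be (ln (k2 / k1))).
Proof.
move=> ab k10 k20 hk hb hC ug hg.
have e x y := embedding_sum ab k10 k20 hk hb hC x y.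
rewrite /minkowski_form /bqf_of !(perp_comb_change hb hC _ _ hg) !e.
pose c := Num.sqrt 27%:R * (be - al) * k1 * k2.
have c0 : 0 < c by rewrite !mulr_gt0 ?subr_gt0 ?sqrtr_gt0.
have c2 : c ^+ 2 = 27%:R * (be - al) ^+ 2 * k1 ^+ 2 * k2 ^+ 2.
  by rewrite /c !exprMn sqr_sqrtr.
have -> : k2 / k1 = (c * k2) / (c * k1) by rewrite -mulf_div divff ?mul1r // gt_eqF.
clearbody c; have := bqf_point_act ab (mulr_gt0 c0 k10) (mulr_gt0 c0 k20) ug => /= <-.
apply: (congr1 (@bqf_point R)).
apply: bqf_eq; rewrite /= !exprMn c2 !(intrD, intrM) /=; ring.
Qed.

End BaseChange.

Section Isomorphisms.

Lemma basis3_free (K : fieldExtType rat) (a1 a2 : K) : \dim {: K} = 3%N ->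
  (forall x0 x1 x2 : rat, x0%:A + x1 *: a1 + x2 *: a2 = 0 -> [/\ x0 = 0, x1 = 0 & x2 = 0]) ->
  basis_of fullv [:: 1; a1; a2].
Proof.
move=> d3 hf; rewrite basisEfree subvf d3 /= andbT.
suff : free [tuple 1; a1; a2] by [].
apply/freeP => k; rewrite !big_ord_recl big_ord0 /= addr0 addrA => /hf [k0 k1 k2].
by case=> -[|[|[|//]]] hi; [rewrite -k0 | rewrite -k1 | rewrite -k2]; congr (k _); apply: val_inj.
Qed.

Lemma table_hom_inj (K L : fieldExtType rat) (w1 w2 : K) (v1 v2 : L)
    (hb : basis_of fullv [:: 1; w1; w2]) (hb' : basis_of fullv [:: 1; v1; v2]) :
  cancel (table_hom w1 w2 (in_alg L : {rmorphism rat -> L}) v1 v2)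
         (table_hom v1 v2 (in_alg K : {rmorphism rat -> K}) w1 w2).
Proof.
move=> x; rewrite [in RHS](coef3E hb x) {2}/table_hom /= !mulr_algl.
by rewrite (table_hom_comb hb') /= !mulr_algl.
Qed.

Variable R : realType.

Lemma same_table_iso (O1 O2 : cubic_order R) (w1 w2 : order_field O1)
    (v1 v2 : order_field O2) C :
  is_zbasis (@Defs.order_set R O1) [:: 1; w1; w2] -> int_table w1 w2 C ->
  is_zbasis (@Defs.order_set R O2) [:: 1; v1; v2] -> int_table v1 v2 C -> order_iso O1 O2.
Proof.
move=> /is_zbasis3P[hb hA] hC /is_zbasis3P[hb' hA'] hC'.
have hint (K L : fieldExtType rat) (x1 x2 : K) (y1 y2 : L) (n0 n1 n2 : int) :
    basis_of fullv [:: 1; x1; x2] ->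
    table_hom x1 x2 (in_alg L : {rmorphism rat -> L}) y1 y2
      (n0%:~R + n1%:~R * x1 + n2%:~R * x2) = n0%:~R + n1%:~R * y1 + n2%:~R * y2.
  move=> hx; have -> : n0%:~R + n1%:~R * x1 + n2%:~R * x2 =
      n0%:~R%:A + n1%:~R *: x1 + n2%:~R *: x2 by rewrite !scaler_int !mulrzl.
  by rewrite (table_hom_comb hx) !rmorph_int.
pose f := table_hom w1 w2 (in_alg (order_field O2) : {rmorphism rat -> order_field O2}) v1 v2.
have [g fg] := table_hom_rmorphism hb hC (in_alg (order_field O2) : {rmorphism rat -> _}) hC'.
exists f; split; rewrite /f.
- split.
  + by move=> x /hA [n0 [n1 [n2 ->]]]; rewrite hint //; apply/hA'; exists n0, n1, n2.
  + by move=> x y _ _ e; rewrite -(table_hom_inj hb hb' x) e (table_hom_inj hb hb').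
  + move=> y /hA' [n0 [n1 [n2 ->]]]; exists (n0%:~R + n1%:~R * w1 + n2%:~R * w2).
      by apply/hA; exists n0, n1, n2.
    by rewrite hint.
- by rewrite -fg rmorph1.
- by move=> x y _ _; rewrite -!fg rmorphD.
- by move=> x y _ _; rewrite -!fg rmorphM.
Qed.

Lemma order_iso_trans (O1 O2 O3 : cubic_order R) :
  order_iso O1 O2 -> order_iso O2 O3 -> order_iso O1 O3.
Proof.
case=> f [bf f1 fD fM] [g [bg g1 gD gM]]; have [ff _ _] := bf.
exists (g \o f); split.
- by apply: set_bij_comp bf bg.
- by rewrite /= f1.
- by move=> x y Ax Ay; rewrite /= fD // gD //; apply: ff.
- by move=> x y Ax Ay; rewrite /= fM // gM //; apply: ff.
Qed.

Lemma order_iso_sym (O1 O2 : cubic_order R) : order_iso O1 O2 -> order_iso O2 O1.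
Proof.
case=> f [[ff fi fs] f1 fD fM].
have hg y : {x | Defs.order_set y -> Defs.order_set x /\ f x = y}.
  apply: cid; have [hy|hy] := pselect (Defs.order_set y); last by exists 0.
  by have [x hx <-] := fs _ hy; exists x.
pose g y := sval (hg y); have gP y : Defs.order_set y -> Defs.order_set (g y) /\ f (g y) = y := svalP (hg y).
have [A1 AB AM _] := order_setP O1; have [B1 BB BM _] := order_setP O2.
have AD x y : Defs.order_set x -> Defs.order_set y -> @Defs.order_set R O1 (x + y).
  by move=> hx hy; have := AB _ _ hx (AB _ _ (AB _ _ A1 A1) hy); rewrite subrr sub0r opprK.
have BD x y : Defs.order_set x -> Defs.order_set y -> @Defs.order_set R O2 (x + y).
  by move=> hx hy; have := BB _ _ hx (BB _ _ (BB _ _ B1 B1) hy); rewrite subrr sub0r opprK.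
have fI x y : Defs.order_set x -> Defs.order_set y -> f x = f y -> x = y.
  by move=> hx hy; apply: fi; rewrite inE.
exists g; split.
- split.
  + by move=> y /gP [].
  + move=> x y; rewrite !inE => /gP[_ ex] /gP[_ ey] e; by rewrite -ex e.
  + move=> x hx; have hy := ff _ hx; exists (f x) => //.
    by have [h1 h2] := gP _ hy; apply: fI.
- by have [h1 h2] := gP _ B1; apply: fI => //; rewrite h2.
- move=> x y hx hy; have [h1 h2] := gP _ hx; have [h3 h4] := gP _ hy.
  have [h5 h6] := gP _ (BD _ _ hx hy).
  by apply: fI => //; [exact: AD | rewrite h6 fD // h2 h4].
- move=> x y hx hy; have [h1 h2] := gP _ hx; have [h3 h4] := gP _ hy.
  have [h5 h6] := gP _ (BM _ _ hx hy).
  by apply: fI => //; [exact: AM | rewrite h6 fM // h2 h4].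
Qed.

Lemma order_iso_zbasis (O1 O2 : cubic_order R) (w1 w2 : order_field O1) C :
  order_iso O1 O2 -> is_zbasis (@Defs.order_set R O1) [:: 1; w1; w2] -> int_table w1 w2 C ->
  exists v1 v2, is_zbasis (@Defs.order_set R O2) [:: 1; v1; v2] /\ int_table v1 v2 C.
Proof.
case=> f [[ff fi fs] f1 fD fM] hz hC; have [hb hA] := (iffLR (is_zbasis3P _ _ _)) hz.
have [W1 W2] := zbasis_mem hz.
have [A1 AB AM _] := order_setP O1.
have A0 : @Defs.order_set R O1 0 by rewrite -(subrr 1); apply: AB.
have AN x : Defs.order_set x -> @Defs.order_set R O1 (- x) by move=> hx; rewrite -sub0r; apply: AB.
have f0 : f 0 = 0 by apply: (addrI (f 0)); rewrite -fD // !addr0.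
have fN x : Defs.order_set x -> f (- x) = - f x.
  by move=> hx; apply: (addIr (f x)); rewrite -fD ?addNr //; exact: AN.
have An (n : nat) x : Defs.order_set x -> @Defs.order_set R O1 (x *+ n) /\ f (x *+ n) = f x *+ n.
  move=> hx; elim: n => [|n [ih1 ih2]]; first by rewrite !mulr0n.
  rewrite !mulrS; split; last by rewrite fD // ih2.
  by rewrite -[_ *+ n]opprK; apply: AB => //; exact: AN.
have Az (n : int) x : Defs.order_set x -> @Defs.order_set R O1 (n%:~R * x) /\ f (n%:~R * x) = n%:~R * f x.
  move=> hx; rewrite !mulrzl; case: n => n; first exact: An.
  have [h1 h2] := An n.+1 _ hx; rewrite NegzE !mulrNz; split; first exact: AN.
  by rewrite fN // h2.
have AD x y : Defs.order_set x -> Defs.order_set y -> @Defs.order_set R O1 (x + y).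
  by move=> hx hy; rewrite -[y]opprK; apply: AB => //; apply: AN.
have fc (n0 n1 n2 : int) : f (n0%:~R + n1%:~R * w1 + n2%:~R * w2) =
    n0%:~R + n1%:~R * f w1 + n2%:~R * f w2.
  have [h01 h02] := Az n0 _ A1; have [h11 h12] := Az n1 _ W1; have [h21 h22] := Az n2 _ W2.
  have hs := AD _ _ h01 h11.
  by rewrite -[n0%:~R]mulr1 (fD _ _ hs h21) (fD _ _ h01 h11) h02 h12 h22 f1 mulr1.
exists (f w1), (f w2).
have hfree (x0 x1 x2 : rat) : x0%:A + x1 *: f w1 + x2 *: f w2 = 0 -> [/\ x0 = 0, x1 = 0 & x2 = 0].
  move=> e; pose m := denq x0 * denq x1 * denq x2.
  have m0 : m != 0 by rewrite !mulf_neq0 ?denq_neq0.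
  have e' : (numq x0 * denq x1 * denq x2)%:~R + (numq x1 * denq x0 * denq x2)%:~R * f w1 +
     (numq x2 * denq x0 * denq x1)%:~R * f w2 = 0.
    have := congr1 ( *:%R (m%:~R : rat)) e; rewrite scaler0 => <-.
    rewrite !scalerDr !scalerA -[(_ * _ * _)%:~R](alg_int (order_field O2)).
    rewrite !mulrzl -!scaler_int /m !intrM !numqE.
    by congr (_ *: _ + _ *: _ + _ *: _); ring.
  have : f ((numq x0 * denq x1 * denq x2)%:~R + (numq x1 * denq x0 * denq x2)%:~R * w1 +
     (numq x2 * denq x0 * denq x1)%:~R * w2) = f (0%:~R + 0%:~R * w1 + 0%:~R * w2).
    by rewrite fc e' !mul0r !addr0 f0.
  move/(fi _ _); rewrite !inE => /(_ _ _)/(free3_int hb) [].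
  - by apply/hA; do 3! eexists.
  - by apply/hA; do 3! eexists.
  move=> /eqP + /eqP + /eqP; rewrite !mulf_eq0 !(negbTE (denq_neq0 _)) !orbF !numq_eq0.
  by move=> /eqP-> /eqP-> /eqP->.
have hb' : basis_of fullv [:: 1; f w1; f w2].
  by apply: basis3_free hfree; case: (order_field_cubic O2).
split.
  apply/is_zbasis3P; split=> // y; split.
    by move=> /fs [x /hA[n0 [n1 [n2 ->]]] <-]; exists n0, n1, n2.
  move=> [n0 [n1 [n2 ->]]]; rewrite -fc; apply: ff; apply/hA.
  by exists n0, n1, n2.
case: C hC => [[[a b] c] d] [h1 h2 h3].
have fcM n0 n1 n2 := fc n0 n1 n2.
split; rewrite -?rmorphM -?rmorphN /= ?expr2 -fM //.
- by rewrite -fc -expr2 h1 !rmorphN !rmorphM.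
- by have := fc (a * d) 0 0; rewrite !mul0r !addr0 => <-; rewrite h2 rmorphM.
- by rewrite -fc -expr2 h3 !rmorphN !rmorphM.
Qed.

Definition cubic_root (C : int * int * int * int) (p q : int) : Prop :=
  let: (a, b, c, d) := C in
  a * p ^+ 3 + b * p ^+ 2 * q + c * p * q ^+ 2 + d * q ^+ 3 = 0.

Lemma exists_order (al be k1 k2 : R) (C : int * int * int * int) :
  al < be -> 0 < k1 -> 0 < k2 -> cubic_coords al be k1 k2 C ->
  (forall p q : int, coprimez p q -> ~ cubic_root C p q) ->
  exists (O : cubic_order R) (w1 w2 : order_field O),
    is_zbasis (@Defs.order_set R O) [:: 1; w1; w2] /\ int_table w1 w2 C.
Proof.
move=> ab k10 k20 hk; case: C hk => [[[a b] c] d] hk irr.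
have a0 : a != 0.
  by apply/eqP => a0; apply: (irr 1 0) => //; rewrite /cubic_root a0; ring.
pose P : {poly rat} := Poly [:: - (d%:~R); c%:~R; - (b%:~R); a%:~R].
have Pe x : P.[x] = a%:~R * x ^+ 3 - b%:~R * x ^+ 2 + c%:~R * x - d%:~R.
  by rewrite horner_Poly /=; ring.
have sP : size P = 4%N by rewrite (@PolyK _ 0) //= intr_eq0.
have iP : irreducible_poly P.
  apply: cubic_irreducible; first by rewrite sP.
  move=> x; apply/negP; rewrite /root Pe => /eqP e.
  apply: (irr (- numq x) (denq x)); first by rewrite /coprimez gcdNz; apply: coprime_num_den.
  rewrite /cubic_root; apply/eqP; rewrite -(eqr_int rat) !(rmorphD, rmorphM, rmorphN, rmorphXn) /=.
  have q0 : (denq x)%:~R != 0 :> rat by rewrite intr_eq0 denq_neq0.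
  rewrite numqE rmorph0; apply/eqP; rewrite -[RHS](mulr0 (- (denq x)%:~R ^+ 3)) -e.
  by ring.
have [K dK [z rz gz]] := irredp_FAdjoin iP.
have d3 : \dim {: K} = 3%N by rewrite dK sP.
have ez : a%:~R * z ^+ 3 = b%:~R * z ^+ 2 - c%:~R * z + d%:~R.
  move: rz; rewrite /root map_Poly ?rmorph0 // horner_Poly /= => /eqP.
  rewrite !mul0r add0r !scaleNr !scaler_int => h.
  apply/eqP; rewrite -subr_eq0 -[X in _ == X]h; apply/eqP; ring.
pose w1 := a%:~R * z; pose w2 := a%:~R * z ^+ 2 - b%:~R * z + c%:~R.
have hC : int_table w1 w2 (a, b, c, d).
  split; rewrite /w1 /w2.
  - by ring.
  - transitivity (a%:~R * (a%:~R * z ^+ 3 - b%:~R * z ^+ 2 + c%:~R * z)); first by ring.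
    by rewrite ez; ring.
  - have zw2 : z * (a%:~R * z ^+ 2 - b%:~R * z + c%:~R) = d%:~R.
      transitivity (a%:~R * z ^+ 3 - b%:~R * z ^+ 2 + c%:~R * z); first by ring.
      by rewrite ez; ring.
    set v := _ + c%:~R in zw2 *; transitivity (a%:~R * z * (z * v) - b%:~R * (z * v) + c%:~R * v).
      by rewrite /v; ring.
    by rewrite zw2; ring.
have hz : z * w2 = d%:~R.
  by rewrite /w2; transitivity (a%:~R * z ^+ 3 - b%:~R * z ^+ 2 + c%:~R * z); [ring|rewrite ez; ring].
have aK : a%:~R != 0 :> K by rewrite -alg_int scaler_eq0 intr_eq0 (negbTE a0) oner_eq0.
set V := span [:: 1; w1; w2].
have V1 : 1 \in V by rewrite memv_span // !inE eqxx.
have Vw1 : w1 \in V by rewrite memv_span // !inE eqxx orbT.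
have Vw2 : w2 \in V by rewrite memv_span // !inE eqxx !orbT.
have Vi (n : int) x : x \in V -> n%:~R * x \in V.
  by move=> hx; rewrite mulrzl -scaler_int rpredZ.
have Vz : z \in V.
  have -> : z = (a%:~R)^-1 *: w1.
    rewrite /w1 -(alg_int K) mulr_algl scalerA mulVf ?scale1r // intr_eq0 //.
  by rewrite rpredZ.
have Vzw1 : z * w1 \in V.
  have -> : z * w1 = w2 + b%:~R * z - c%:~R * 1 by rewrite /w1 /w2; ring.
  exact: rpredB (rpredD Vw2 (Vi b z Vz)) (Vi c 1 V1).
have Vzx x : x \in V -> z * x \in V.
  move=> /(@coord_span _ _ _ [tuple 1; w1; w2]) ->; rewrite mulr_sumr rpred_sum // => i _.
  rewrite -scalerAr rpredZ //; case: i => -[|[|[|//]]] hi /=; rewrite ?mulr1 ?hz //.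
  by rewrite -[d%:~R]mulr1 Vi.
have Vzn n : z ^+ n \in V by elim: n => // n ih; rewrite exprS Vzx.
have hb : basis_of fullv [:: 1; w1; w2].
  rewrite basisEdim d3 leqnn andbT; apply/subvP => x; rewrite -gz => /Fadjoin_polyP[p /polyOverP hp ->].
  rewrite horner_coef rpred_sum // => i _.
  by have /vlineP[k ->] := hp i; rewrite mulr_algl rpredZ.
have cK : complex_cubic R K := table_complex_cubic ab k10 k20 hk hb hC.
pose A : set K := [set x | exists n0 n1 n2 : int, x = n0%:~R + n1%:~R * w1 + n2%:~R * w2].
have hA : is_zbasis A [:: 1; w1; w2] by apply/is_zbasis3P.
have oA : is_order A.
  split; last by exists [:: 1; w1; w2].
  - by exists 1, 0, 0; rewrite !mul0r !addr0.
  - move=> x y [n0 [n1 [n2 ->]]] [m0 [m1 [m2 ->]]]; exists (n0 - m0), (n1 - m1), (n2 - m2).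
    by rewrite !rmorphB; ring.
  - move=> x y [n0 [n1 [n2 ->]]] [m0 [m1 [m2 ->]]].
    case: hC => h1 h2 h3.
    exists (n0 * m0 - a * c * n1 * m1 + a * d * (n1 * m2 + n2 * m1) - b * d * n2 * m2).
    exists (n0 * m1 + n1 * m0 + b * n1 * m1 + d * n2 * m2).
    exists (n0 * m2 + n2 * m0 + a * n1 * m1 + c * n2 * m2).
    transitivity (n0%:~R * m0%:~R + (n0%:~R * m1%:~R + n1%:~R * m0%:~R) * w1 +
      (n0%:~R * m2%:~R + n2%:~R * m0%:~R) * w2 + n1%:~R * m1%:~R * w1 ^+ 2 +
      (n1%:~R * m2%:~R + n2%:~R * m1%:~R) * (w1 * w2) + n2%:~R * m2%:~R * w2 ^+ 2).
      by ring.
    by rewrite h1 h2 h3 !(intrD, intrM, rmorphN) /=; ring.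
by exists (CubicOrder cK oA), w1, w2.
Qed.

End Isomorphisms.

(** * Counting with Jordan measurable conditions *)

Section Cousin.
Variable R : realType.

Lemma interval_induction (P : R -> R -> Prop) :
  (forall x y z, x <= y -> y <= z -> P x y -> P y z -> P x z) ->
  (forall u, exists2 e, 0 < e & forall x y, x <= u <= y -> u - e < x -> y < u + e -> P x y) ->
  forall x y, x <= y -> P x y.
Proof.
move=> Padd Ploc x y xy.
pose S : set R := [set t | x <= t <= y /\ P x t].
have Sx : S x.
  have [e e0 h] := Ploc x; split; first by rewrite lexx xy.
  by apply: h; rewrite ?lexx // ?ltrBlDr ltrDl.
have hS : has_sup S by split; [exists x | exists y => t [/andP[]]].
set s := sup S.
have xs : x <= s by apply: ub_le_sup => //; case: hS.
have sy : s <= y by apply: ge_sup; [exists x | move=> t [/andP[]]].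
have [e e0 h] := Ploc s.
have [t St ts] := sup_adherent e0 hS.
have [/andP[xt ty] Pxt] := St.
have ts' : t <= s by apply: ub_le_sup => //; case: hS.
have step v : s <= v -> v < s + e -> P x v.
  move=> sv ve; apply: (Padd x t v) => //; first exact: le_trans sv.
  by apply: h; rewrite ?ts' ?sv.
have [ys|sy'] := leP y (s + e / 2%:R).
  by apply: step => //; apply: le_lt_trans ys _; rewrite ltrD2l ltr_pdivrMr // ltr_pMr // ltr1n.
have : S (s + e / 2%:R).
  split; first by rewrite (ltW sy') (le_trans xs) // lerDl divr_ge0 // ltW.
  by apply: step; [rewrite lerDl divr_ge0 // ltW | rewrite ltrD2l ltr_pdivrMr // ltr_pMr // ltr1n].
move=> /(ub_le_sup (proj2 hS)); rewrite -/s gerDl leNgt divr_gt0 //.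
Qed.

End Cousin.

Section LebesgueOuter.
Variable R : realType.
Local Notation mu := (@lebesgue_measure R).

Lemma le_lebesgue (A B : set R) : A `<=` B -> (mu A <= mu B)%E.
Proof.
move=> AB; rewrite /lebesgue_measure /lebesgue_stieltjes_measure /measure_extension.
exact: le_mu_ext.
Qed.

Lemma lebesgue_ge0 (A : set R) : (0 <= mu A)%E.
Proof. exact: mu_ext_ge0. Qed.

Lemma lebesgue_subadd (A B : set R) : (mu (A `|` B) <= mu A + mu B)%E.
Proof. exact: outer_measureU2. Qed.

End LebesgueOuter.

Section Counting.
Variables (R : realType) (cnt : R -> set R -> R).
Hypothesis cnt_sub : forall N S T, S `<=` T -> cnt N S <= cnt N T.
Hypothesis cntU_le : forall N S T, cnt N (S `|` T) <= cnt N S + cnt N T.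
Hypothesis cntU_ge : forall N S T, S `&` T `<=` set0 -> cnt N S + cnt N T <= cnt N (S `|` T).

Definition upper_density (S : set R) (v : R) : Prop :=
  forall e, 0 < e -> \forall N \near +oo, cnt N S <= (v + e) * N.
Definition lower_density (S : set R) (v : R) : Prop :=
  forall e, 0 < e -> \forall N \near +oo, (v - e) * N <= cnt N S.

Lemma cnt_set0 N : cnt N set0 = 0.
Proof.
have := cntU_le N set0 set0; have := @cntU_ge N set0 set0; rewrite setI0 setU0 => /(_ (fun _ => id)).
by move=> *; apply/eqP; rewrite eq_le; apply/andP; split; lra.
Qed.

Lemma cnt_ge0 N S : 0 <= cnt N S.
Proof. by rewrite -(cnt_set0 N) cnt_sub. Qed.

Lemma upper_densityW S T v w : S `<=` T -> v <= w -> upper_density T v -> upper_density S w.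
Proof.
move=> ST vw h e e0; near=> N; apply: le_trans (cnt_sub N ST) _.
apply: (@le_trans _ _ ((v + e) * N)); first by near: N; apply: h.
by rewrite ler_wpM2r ?lerD2r //; near: N; apply: nbhs_pinfty_ge; rewrite num_real.
Unshelve. all: by end_near. Qed.

Lemma lower_densityW S T v w : S `<=` T -> w <= v -> lower_density S v -> lower_density T w.
Proof.
move=> ST vw h e e0; near=> N; apply: le_trans _ (cnt_sub N ST).
apply: (@le_trans _ _ ((v - e) * N)); last by near: N; apply: h.
by rewrite ler_wpM2r ?lerD2r //; near: N; apply: nbhs_pinfty_ge; rewrite num_real.
Unshelve. all: by end_near. Qed.

Lemma upper_densityU S T v w : upper_density S v -> upper_density T w ->
  upper_density (S `|` T) (v + w).
Proof.
move=> hS hT e e0; have e2 : 0 < e / 2%:R by rewrite divr_gt0.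
near=> N; apply: le_trans (cntU_le N S T) _.
have -> : (v + w + e) * N = (v + e / 2%:R) * N + (w + e / 2%:R) * N by field.
by apply: lerD; near: N; [apply: hS | apply: hT].
Unshelve. all: by end_near. Qed.

Lemma lower_densityU S T v w : S `&` T `<=` set0 -> lower_density S v -> lower_density T w ->
  lower_density (S `|` T) (v + w).
Proof.
move=> dST hS hT e e0; have e2 : 0 < e / 2%:R by rewrite divr_gt0.
near=> N; apply: le_trans _ (cntU_ge N dST).
have -> : (v + w - e) * N = (v - e / 2%:R) * N + (w - e / 2%:R) * N by field.
by apply: lerD; near: N; [apply: hS | apply: hT].
Unshelve. all: by end_near. Qed.

Lemma lower_density_le0 S v : v <= 0 -> lower_density S v.
Proof.
move=> v0 e e0; near=> N; apply: le_trans (cnt_ge0 N S).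
rewrite nmulr_rle0; first by near: N; apply: nbhs_pinfty_ge; rewrite num_real.
by rewrite subr_lt0 (le_lt_trans v0).
Unshelve. all: by end_near. Qed.

Lemma upper_density_lim S v : (forall e, 0 < e -> upper_density S (v + e)) -> upper_density S v.
Proof.
move=> h e e0; have e2 : 0 < e / 2%:R by rewrite divr_gt0.
near=> N; have -> : (v + e) * N = (v + e / 2%:R + e / 2%:R) * N by field.
by near: N; apply: h.
Unshelve. all: by end_near. Qed.

Lemma lower_density_lim S v : (forall e, 0 < e -> lower_density S (v - e)) -> lower_density S v.
Proof.
move=> h e e0; have e2 : 0 < e / 2%:R by rewrite divr_gt0.
near=> N; have -> : (v - e) * N = (v - e / 2%:R - e / 2%:R) * N by field.
by near: N; apply: h.
Unshelve. all: by end_near. Qed.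

Lemma density_cvg S v : upper_density S v -> lower_density S v ->
  cnt N S / N @[N --> +oo] --> v.
Proof.
move=> hu hl; apply/cvgrPdist_le => e e0; near=> N.
have N0 : 0 < N by near: N; apply: nbhs_pinfty_gt; rewrite num_real.
rewrite ler_distlC ler_pdivlMr // ler_pdivrMr //; apply/andP; split; near: N.
  exact: hl.
exact: hu.
Unshelve. all: by end_near. Qed.

Variables (c K : R).
Hypothesis c0 : 0 <= c.
Hypothesis cnt_itv_le : forall x y, x <= y -> - K <= x -> y <= K -> upper_density `[x, y] (c * (y - x)).
Hypothesis cnt_itv_ge : forall x y, x <= y -> - K <= x -> y <= K -> lower_density `]x, y[ (c * (y - x)).

Local Notation mu := (@lebesgue_measure R).
Let m (A : set R) x y : R := fine (mu (A `&` `]x, y])).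

Let m_itv x y : x <= y -> mu `]x, y] = (y - x)%:E.
Proof.
move=> xy; rewrite lebesgue_measure_itv /= lte_fin; case: ltP => // yx.
by have -> : x = y by [apply/eqP; rewrite eq_le xy]; rewrite subrr.
Qed.

Let m_fin A x y : x <= y -> mu (A `&` `]x, y]) \is a fin_num.
Proof.
move=> xy; rewrite ge0_fin_numE ?lebesgue_ge0 //.
by apply: (@le_lt_trans _ _ (mu `]x, y])); [apply: le_lebesgue => z [] | rewrite m_itv // ltry].
Qed.

Let m_ge0 A x y : 0 <= m A x y.
Proof. by rewrite fine_ge0 // lebesgue_ge0. Qed.

Let m_sub A B x y : x <= y -> A `&` `]x, y] `<=` B -> m A x y <= m B x y.
Proof.
by move=> xy AB; rewrite fine_le ?m_fin //; apply: le_lebesgue => z hz; split; [exact: AB | case: hz].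
Qed.

Let m_full A x y : x <= y -> `]x, y] `<=` A -> m A x y = y - x.
Proof. by move=> xy h; rewrite /m setIidr // m_itv. Qed.

Let m_empty A x y : A `&` `]x, y] `<=` set0 -> m A x y = 0.
Proof. by move=> h; rewrite /m (_ : A `&` _ = set0) ?measure0 //; apply/seteqP; split. Qed.

Let m_add A x y z : measurable A -> x <= y -> y <= z -> m A x z = m A x y + m A y z.
Proof.
move=> mA xy yz; rewrite /m -fineD ?m_fin //; congr fine.
rewrite -measureU; last 3 first.
- by apply: measurableI => //; exact: measurable_itv.
- by apply: measurableI => //; exact: measurable_itv.
- apply/seteqP; split=> // t [[_ /=]] + [_ /=]; rewrite !in_itv /= => /andP[_ h1] /andP[h2 _].
  by move: (lt_le_trans h2 h1); rewrite ltxx.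
congr mu; rewrite -setIUr; congr (_ `&` _).
apply/seteqP; split=> t /=; rewrite !in_itv /=.
  by move=> /andP[h1 h2]; have [h3|h3] := leP t y; [left | right]; rewrite ?h1 ?h2 ?h3.
case=> /andP[h1 h2]; first by rewrite h1 (le_trans h2).
by rewrite h2 (le_lt_trans xy).
Qed.

Section NullBoundary.
Variable U : set R.
Hypothesis UK : U `<=` `]- K, K[.
Hypothesis bU : mu (closure U `\` interior U) = 0%E.

Let near_itv (A : set R) u : open A -> A u ->
  exists2 e, 0 < e & forall x y, x <= u <= y -> u - e < x -> y < u + e -> `[x, y] `<=` A.
Proof.
move=> oA Au; have /nbhs_ballP [e /= e0 he] := open_nbhs_nbhs (conj oA Au).
exists e => // x y /andP[xu uy] hx hy t /=; rewrite in_itv /= => /andP[xt ty]; apply: he.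
rewrite /ball /= ltr_distlC; apply/andP; split; first exact: lt_le_trans xt.
exact: le_lt_trans hy.
Qed.

Let sub_oc x y (A : set R) : `[x, y] `<=` A -> `]x, y] `<=` A.
Proof. by move=> h t; rewrite /= in_itv /= => /andP[h1 h2]; apply: h; rewrite /= in_itv /= (ltW h1). Qed.

Let sub_oo x y (A : set R) : `[x, y] `<=` A -> `]x, y[ `<=` A.
Proof.
by move=> h t; rewrite /= in_itv /= => /andP[h1 h2]; apply: h; rewrite /= in_itv /= (ltW h1) (ltW h2).
Qed.

Let density_approx (V : set R) : open V -> closure U `\` interior U `<=` V ->
  forall x y, x <= y -> - K <= x -> y <= K ->
  upper_density (U `&` `[x, y]) (c * (m (interior U) x y + m V x y)) /\
  lower_density (U `&` `]x, y[) (c * (m (interior U) x y - m V x y)).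
Proof.
move=> oV hV; have oI : open (interior U) by exact: open_interior.
have mV : measurable V by exact: measurable_realfun.open_measurable.
have mI : measurable (interior U) by exact: measurable_realfun.open_measurable.
apply: interval_induction.
- move=> x y z xy yz h1 h2 Kx Kz.
  have [u1 l1] := h1 Kx (le_trans yz Kz); have [u2 l2] := h2 (le_trans Kx xy) Kz.
  rewrite (m_add mI xy yz) (m_add mV xy yz); split.
    apply: upper_densityW (upper_densityU u1 u2); last by rewrite -mulrDr ler_wpM2l //; lra.
    move=> t [Ut] /=; rewrite !in_itv /= => /andP[xt tz].
    by have [ty|ty] := leP t y; [left | right]; split=> //=; rewrite ?in_itv /= ?xt ?tz ?ty ?(ltW ty).
  have d : (U `&` `]x, y[) `&` (U `&` `]y, z[) `<=` set0.
    move=> t [ [_ +] [_ +]]; rewrite /= ?in_itv /= => /andP[_ h] /andP[h' _].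
    by move: (lt_trans h h'); rewrite ltxx.
  apply: lower_densityW (lower_densityU d l1 l2); last by rewrite -mulrDr ler_wpM2l //; lra.
  move=> t [] [Ut]; rewrite /= ?in_itv /= => /andP[h3 h4]; split=> //=; rewrite ?in_itv /=.
    by rewrite h3 (lt_le_trans h4).
  by rewrite h4 (le_lt_trans xy).
move=> u; have [Vu|nVu] := pselect (V u).
  have [e e0 he] := near_itv oV Vu; exists e => // x y xuy hx hy Kx Ky.
  have xy : x <= y by case/andP: xuy => /le_trans h /h.
  have xyV := he _ _ xuy hx hy; rewrite (m_full xy (sub_oc xyV)); split.
    apply: upper_densityW (cnt_itv_le xy Kx Ky); first by move=> t [].
    by rewrite ler_wpM2l // lerDr.
  apply: lower_density_le0; rewrite mulr_ge0_le0 // subr_le0 -(m_full xy (sub_oc xyV)).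
  by apply: m_sub => // t [_] /(sub_oc xyV).
have [Iu|nIu] := pselect (interior U u).
  have [e e0 he] := near_itv oI Iu; exists e => // x y xuy hx hy Kx Ky.
  have xy : x <= y by case/andP: xuy => /le_trans h /h.
  have xyI := he _ _ xuy hx hy; rewrite (m_full xy (sub_oc xyI)); split.
    apply: upper_densityW (cnt_itv_le xy Kx Ky); first by move=> t [].
    by rewrite ler_wpM2l // lerDl.
  apply: lower_densityW (cnt_itv_ge xy Kx Ky); last by rewrite ler_wpM2l // gerBl.
  by move=> t ht; split=> //; apply: interior_subset; exact: (sub_oo xyI).
have oC : open (~` closure U) by exact/closed_openC/closed_closure.
have Cu : (~` closure U) u by move=> cu; apply: nVu; apply: hV.
have [e e0 he] := near_itv oC Cu; exists e => // x y xuy hx hy Kx Ky.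
have xy : x <= y by case/andP: xuy => /le_trans h /h.
have xyC := he _ _ xuy hx hy.
have -> : m (interior U) x y = 0.
  by apply: m_empty => t [/interior_subset/subset_closure ct] /(sub_oc xyC).
split; last by apply: lower_density_le0; rewrite mulr_ge0_le0 // sub0r oppr_le0.
move=> d d0; near=> N.
have -> : U `&` `[x, y] = set0.
  by apply/seteqP; split=> // t [/subset_closure ct] /xyC.
rewrite cnt_set0; apply: mulr_ge0; last by near: N; apply: nbhs_pinfty_ge; rewrite num_real.
apply: addr_ge0; last exact: ltW.
by apply: mulr_ge0 => //; apply: addr_ge0.
Unshelve. all: by end_near. Qed.

Lemma null_boundary_density : 0 <= K ->
  upper_density U (c * fine (mu U)) /\ lower_density U (c * fine (mu U)).
Proof.
move=> K0; have KK : - K <= K by lra.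
have UKc : U `&` `[- K, K] = U.
  by apply/setIidl => t /UK; rewrite /= !in_itv /= => /andP[h1 h2]; rewrite !ltW.
have UKo : U `&` `]- K, K[ = U by apply/setIidl.
have muU : fine (mu U) = m (interior U) (- K) K.
  congr fine; have -> : interior U `&` `]- K, K] = interior U.
    by apply/setIidl => t /interior_subset /UK; rewrite /= !in_itv /= => /andP[h1 h2]; rewrite h1 ltW.
  apply/eqP; rewrite eq_le; apply/andP; split; last by apply: le_lebesgue; exact: interior_subset.
  rewrite -[leRHS]adde0 -bU; apply: le_trans (lebesgue_subadd _ _); apply: le_lebesgue => t Ut.
  have [It|nIt] := pselect (interior U t); [by left | right; split=> //; exact: subset_closure].
rewrite muU.
have key e : 0 < e -> exists V, [/\ open V, closure U `\` interior U `<=` V & m V (- K) K <= e].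
  move=> e0; have [V [oV hV mV]] := outer_measure_open_le (closure U `\` interior U) e0.
  exists V; split=> //; rewrite -lee_fin fineK ?m_fin //.
  apply: le_trans (le_lebesgue (_ : _ `<=` V)) _; first by move=> t [].
  by apply: le_trans mV _; move: bU; rewrite /lebesgue_measure /lebesgue_stieltjes_measure /measure_extension => ->; rewrite add0e.
split; [apply: upper_density_lim => e e0 | apply: lower_density_lim => e e0].
  have [V [oV hV mV]] := key (e / (c + 1)) (divr_gt0 e0 (ltr_wpDl c0 ltr01)).
  have [h _] := density_approx oV hV KK (lexx _) (lexx _); rewrite UKc in h.
  apply: upper_densityW h => //; rewrite mulrDr lerD2l.
  apply: le_trans (ler_wpM2l c0 mV) _; rewrite mulrCA ler_piMr ?(ltW e0) //.
  by rewrite ler_pdivrMr ?mul1r ?lerDl // ltr_wpDl.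
have [V [oV hV mV]] := key (e / (c + 1)) (divr_gt0 e0 (ltr_wpDl c0 ltr01)).
have [_ h] := density_approx oV hV KK (lexx _) (lexx _); rewrite UKo in h.
apply: lower_densityW h => //; rewrite mulrBr lerB //.
apply: le_trans (ler_wpM2l c0 mV) _; rewrite mulrCA ler_piMr ?(ltW e0) //.
by rewrite ler_pdivrMr ?mul1r ?lerDl // ltr_wpDl.
Qed.

End NullBoundary.

End Counting.

(** * Lattice points under a hyperbola *)

Section CountOn.
Variables (R : realType) (T : eqType) (L : R -> seq T) (P : R -> T -> Prop) (f : T -> R).

Definition count_on (N : R) (S : set R) : R :=
  (count (fun v => `[< P N v /\ S (f v) >]) (L N))%:R.

Lemma count_on_sub N S S' : S `<=` S' -> count_on N S <= count_on N S'.
Proof.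
move=> SS; rewrite ler_nat; apply: sub_count => v /asboolP[Pv Sv]; apply/asboolP.
by split=> //; apply: SS.
Qed.

Lemma count_onU_le N S S' : count_on N (S `|` S') <= count_on N S + count_on N S'.
Proof.
rewrite -natrD ler_nat -count_predUI; apply: leq_trans (leq_addr _ _).
apply: sub_count => v /asboolP[Pv [Sv|Sv]]; apply/orP; [left | right]; exact/asboolP.
Qed.

Lemma count_onU_ge N S S' : S `&` S' `<=` set0 ->
  count_on N S + count_on N S' <= count_on N (S `|` S').
Proof.
move=> d; rewrite -natrD ler_nat -count_predUI (@eq_count _ (predI _ _) pred0) ?count_pred0 ?addn0.
  by apply: sub_count => v /orP[] /asboolP[Pv Sv]; apply/asboolP; split=> //; [left | right].
by move=> v /=; apply/negP => /andP[/asboolP[_ h1] /asboolP[_ h2]]; apply: (d (f v)).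
Qed.

End CountOn.

Section IntRows.
Variable R : realType.

Definition int_range (m : int) (k : nat) : seq int := [seq m + i%:Z | i <- iota 0 k].

Lemma mem_int_range m k (j : int) : (j \in int_range m k) = (m <= j < m + k%:Z).
Proof.
apply/mapP/idP => [[k0]|/andP[h1 h2]].
  by rewrite mem_iota /= add0n => ik ->; lia.
by exists `|j - m|%N; [rewrite mem_iota | ]; lia.
Qed.

Lemma int_range_uniq m k : uniq (int_range m k).
Proof. by rewrite map_inj_uniq ?iota_uniq // => i j; lia. Qed.

Lemma size_int_range m k : size (int_range m k) = k.
Proof. by rewrite size_map size_iota. Qed.

Lemma mem_int_range_norm (z : int) (b : R) :
  `|z%:~R| <= b -> z \in int_range (- (Num.truncn b)%:Z) (Num.truncn b).*2.+1.
Proof.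
move=> hz; have b0 : 0 <= b := le_trans (normr_ge0 _) hz.
have : `|z| <= (Num.truncn b)%:Z.
  rewrite -(ler_int R) intr_norm; have : `|z%:~R| = `|z|%N%:R :> R by rewrite natr_absz intr_norm.
  by move=> ez; rewrite ez -pmulrn ler_nat truncn_ge_nat // -ez.
by rewrite mem_int_range; lia.
Qed.

Lemma count_row_le (s : seq int) (x y : R) : uniq s -> x <= y ->
  (count (fun j : int => x <= j%:~R <= y) s)%:R <= y - x + 1.
Proof.
move=> us xy; pose m := Num.ceil x; pose M := Num.floor y.
have h1 := ceil_ge x; have h2 := floor_le y.
have [mM|mM] := leP m (M + 1).
  have : (count (fun j : int => (x <= j%:~R <= y)%R) s <= `|(M + 1 - m)%R|%N)%N.
    rewrite -size_filter -(size_int_range m `|(M + 1 - m)%R|%N); apply: uniq_leq_size.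
      by rewrite filter_uniq.
    move=> j; rewrite mem_filter => /andP[/andP[h3 h4] _]; rewrite mem_int_range.
    by move: h3 h4; rewrite -ceil_le_int -floor_ge_int -/m -/M; lia.
  rewrite -(ler_nat R) => /le_trans; apply.
  have -> : (`|(M + 1 - m)%R|%N%:R : R) = M%:~R + 1 - m%:~R.
    by rewrite natr_absz ger0_norm ?subr_ge0 // !(rmorphD, rmorphN).
  by move: h1 h2; rewrite -/m -/M; lra.
rewrite (eq_in_count (a2 := pred0)) ?count_pred0; first by rewrite addr_ge0 ?(subr_ge0 x).
move=> j _ /=; apply/negP => /andP[]; rewrite -ceil_le_int -floor_ge_int -/m -/M.
by move: mM; lia.
Qed.

Lemma count_row_ge (s : seq int) (x y : R) :
  (forall j : int, x < j%:~R < y -> j \in s) ->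
  y - x - 1 <= (count (fun j : int => x < j%:~R < y) s)%:R.
Proof.
move=> hs; pose m := Num.floor x; pose M := Num.ceil y.
have h1 := floor_le x; have h2 := ceil_ge y.
have [mM|mM] := ltP (m + 1) M; last first.
  apply: (@le_trans _ _ 0) => //; move: mM; rewrite -(ler_int R) rmorphD /=.
  by move: h1 h2; rewrite -/m -/M; lra.
have : (`|(M - m - 1)%R|%N <= count (fun j : int => (x < j%:~R < y)%R) s)%N.
  rewrite -size_filter -(size_int_range (m + 1) `|(M - m - 1)%R|%N); apply: uniq_leq_size.
    exact: int_range_uniq.
  move=> j; rewrite mem_int_range => /andP[h3 h4].
  have hj : x < j%:~R < y by rewrite -floor_lt_int -ceil_gt_int -/m -/M; lia.
  by rewrite mem_filter hj hs.
rewrite -(ler_nat R) => h; apply: le_trans h.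
have -> : (`|(M - m - 1)%R|%N%:R : R) = M%:~R - m%:~R - 1.
  by rewrite natr_absz ger0_norm ?rmorphB //; move: mM; lia.
by move: h1 h2; rewrite -/m -/M; lra.
Qed.

Lemma sum_rows_le (d Y : R) (n : nat) : 0 <= d -> 0 <= Y ->
  \sum_(1 <= i < n.+1) (if i%:R <= Y then i%:R * d + 1 else 0) <= d * Y * (Y + 1) / 2%:R + Y.
Proof.
move=> d0 Y0; set g := fun t : R => d * t * (t + 1) / 2%:R + t.
have gm t : 0 <= t -> t <= Y -> g t <= g Y.
  move=> t0 tY; rewrite -subr_ge0 /g.
  rewrite (_ : _ - _ = (Y - t) * (d * (Y + t + 1) / 2%:R + 1)); last by field.
  by rewrite mulr_ge0 ?subr_ge0 // addr_ge0 // divr_ge0 // mulr_ge0 // !addr_ge0.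
suff [] : (n%:R <= Y -> \sum_(1 <= i < n.+1) (if i%:R <= Y then i%:R * d + 1 else 0) <= g n%:R) /\
   \sum_(1 <= i < n.+1) (if i%:R <= Y then i%:R * d + 1 else 0) <= g Y by [].
elim: n => [|n [ih1 ih2]].
  by rewrite big_nil /g !mulr0 !mul0r addr0; split=> //; rewrite addr_ge0 // divr_ge0 // !mulr_ge0 // addr_ge0.
rewrite big_nat_recr //=; case: ifP => hn; last by split=> //; rewrite ?addr0 // hn.
have nY : n%:R <= Y by apply: le_trans hn; rewrite ler_nat.
have h : \sum_(1 <= i < n.+1) (if i%:R <= Y then i%:R * d + 1 else 0) + (n.+1%:R * d + 1) <= g n.+1%:R.
  by have := ih1 nY; rewrite /g -[n.+1%:R]natr1; move: (\sum_(_ <= _ < _) _) (n%:R : R) => s t; lra.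
by split=> //; apply: le_trans h (gm _ _ hn).
Qed.

Lemma sum_rows_ge (d Y : R) (n : nat) : 0 <= d -> 0 <= Y -> Y <= n.+1%:R ->
  d * (Y - 1) * Y / 2%:R - Y <= \sum_(1 <= i < n.+1) (if i%:R < Y then i%:R * d - 1 else 0).
Proof.
move=> d0 Y0; pose S n := \sum_(1 <= i < n.+1) (if i%:R < Y then i%:R * d - 1 else 0).
suff [] : (n%:R < Y -> d * n%:R * (n%:R + 1) / 2%:R - n%:R <= S n) /\
   (Y <= n.+1%:R -> d * (Y - 1) * Y / 2%:R - Y <= S n) by [].
elim: n => [|n [ih1 ih2]].
  rewrite /S big_nil; split=> [_|h]; [by rewrite mulr0 !mul0r subrr |].
  by have : 0 <= d * (Y * (1 - Y)); [apply: mulr_ge0 => //; apply: mulr_ge0; rewrite ?subr_ge0 | lra].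
have eS : S n.+1 = S n + (if n.+1%:R < Y then n.+1%:R * d - 1 else 0) by rewrite /S big_nat_recr.
have [hn|hn] := ltP n.+1%:R Y.
  have nY : n%:R < Y by apply: le_lt_trans hn; rewrite ler_nat.
  have := ih1 nY; rewrite eS hn; move: hn; rewrite -[n.+2%:R]natr1 -[n.+1%:R]natr1.
  move: (S n) (n%:R : R) (ler0n R n) => s t t0 hn h.
  split=> [_|h']; first by lra.
  have : 0 <= d * ((t + 1 + 1 - Y) * (t + 1 + Y)).
    by apply: mulr_ge0 => //; apply: mulr_ge0; [rewrite subr_ge0 | lra].
  by lra.
rewrite eS ltNge hn /= addr0; split=> // _; exact: ih2.
Qed.

End IntRows.

Section HyperbolicCount.
Variable R : realType.
Variables (p q nu K : R).
Hypotheses (pq : p < q) (nu0 : 0 < nu).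

Definition hyp_norm (v : nat * int) : R := nu * (v.2%:~R - p * v.1%:R) * (q * v.1%:R - v.2%:~R).
Definition hyp_arg (v : nat * int) : R := ln ((q * v.1%:R - v.2%:~R) / (v.2%:~R - p * v.1%:R)) / 3%:R.
Definition hyp_in (N : R) (v : nat * int) : Prop :=
  [/\ (0 < v.1)%N, p * v.1%:R < v.2%:~R < q * v.1%:R & hyp_norm v < N].

Let q0 : R := nu * (q - p) ^+ 2 * expR (- (3%:R * K)) / (1 + expR (3%:R * K)) ^+ 2.
Let rows (N : R) : nat := Num.truncn (Num.sqrt (N / q0)).
Let width (i : nat) : nat := (Num.truncn ((`|p| + `|q|) * i%:R)).+1.
Definition hyp_box (N : R) : seq (nat * int) :=
  [seq (i, j) | i <- iota 1 (rows N), j <- int_range (- (width i)%:Z) (width i).*2.+1].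

Lemma hyp_box_uniq N : uniq (hyp_box N).
Proof.
apply: allpairs_uniq_dep; first exact: iota_uniq.
  by move=> i _; apply: int_range_uniq.
by move=> [i j] [i' j'] _ _ /= [-> ->].
Qed.

Let q0_gt0 : 0 < q0.
Proof.
rewrite divr_gt0 ?mulr_gt0 ?exprn_gt0 ?expR_gt0 ?subr_gt0 ?addr_gt0 ?expR_gt0 //.
Qed.

Let sig (u : R) : R := (q + p * expR (3%:R * u)) / (1 + expR (3%:R * u)).

Let E1 (u : R) : 0 < 1 + expR (3%:R * u). Proof. by rewrite addr_gt0 ?expR_gt0. Qed.

Let argE (v : nat * int) : p * v.1%:R < v.2%:~R < q * v.1%:R ->
  v.2%:~R = sig (hyp_arg v) * v.1%:R.
Proof.
move=> /andP[h1 h2]; rewrite /sig /hyp_arg [3%:R * _]mulrC divfK ?pnatr_eq0 //.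
have a0 : 0 < q * v.1%:R - v.2%:~R by rewrite subr_gt0.
have b0 : 0 < v.2%:~R - p * v.1%:R by rewrite subr_gt0.
rewrite lnK ?posrE ?divr_gt0 //.
have ab : (q - p) * v.1%:R != 0.
  by rewrite gt_eqF // mulrBl subr_gt0; apply: lt_trans h1 h2.
have := lt0r_neq0 b0; set j := v.2%:~R in a0 b0 *; move: (v.1%:R) ab @j a0 b0 => i ab j a0 b0 b1.
field; rewrite b1 /=; apply: contra ab => /eqP e; apply/eqP; rewrite -[RHS]e; ring.
Qed.

Let normE (v : nat * int) : p * v.1%:R < v.2%:~R < q * v.1%:R ->
  hyp_norm v = v.1%:R ^+ 2 * (nu * (q - p) ^+ 2 * expR (3%:R * hyp_arg v) / (1 + expR (3%:R * hyp_arg v)) ^+ 2).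
Proof.
move=> h; rewrite /hyp_norm (argE h) /sig; have := E1 (hyp_arg v).
by move: (expR _) => E e1; field; rewrite gt_eqF.
Qed.

Let quot_le (a b E : R) : 0 < a -> a <= E -> E <= b ->
  nu * (q - p) ^+ 2 * a / (1 + b) ^+ 2 <= nu * (q - p) ^+ 2 * E / (1 + E) ^+ 2.
Proof.
move=> a0 aE Eb; have E0 := lt_le_trans a0 aE; have b0 := lt_le_trans E0 Eb.
have X0 : 0 <= nu * (q - p) ^+ 2 by rewrite mulr_ge0 ?sqr_ge0 // ltW.
move: (nu * _) X0 => X X0.
rewrite ler_pdivrMr ?exprn_gt0 ?addr_gt0 // [_ / _ * _]mulrAC ler_pdivlMr ?exprn_gt0 ?addr_gt0 //.
apply: ler_pM.
- by rewrite mulr_ge0 // ltW.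
- exact: sqr_ge0.
- by rewrite ler_wpM2l.
- by rewrite ler_pXn2r ?nnegrE ?addr_ge0 ?(ltW b0) ?(ltW E0) // lerD2l.
Qed.

Let sig_decr (u v : R) : u < v -> sig v < sig u.
Proof.
move=> uv; rewrite /sig ltr_pdivrMr // mulrAC ltr_pdivlMr //.
have : expR (3%:R * u) < expR (3%:R * v) by rewrite ltr_expR ltr_pM2l.
move: (expR _) (expR _) => x y xy; rewrite -subr_gt0.
by rewrite (_ : _ - _ = (q - p) * (x - y)) ?mulr_gt0 ?subr_gt0 //; ring.
Qed.

Let sig_le (u v : R) : u <= v -> sig v <= sig u.
Proof. by rewrite le_eqVlt => /orP[/eqP->//|/sig_decr/ltW]. Qed.

Lemma mem_hyp_box N v : hyp_in N v -> - K <= hyp_arg v <= K -> v \in hyp_box N.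
Proof.
case: v => i j [/= i0 hij hN] /andP[K1 K2].
have ip : 0 < i%:R :> R by rewrite ltr0n.
have N0 : 0 < N.
  apply: lt_trans hN; rewrite /hyp_norm /= !mulr_gt0 // subr_gt0; by case/andP: hij.
apply/allpairsPdep; exists i, j; split=> //.
  rewrite mem_iota i0 add1n ltnS /rows -(ler_nat R); 
  have hi : i%:R <= Num.sqrt (N / q0).
    have Nq : 0 <= N / q0 by rewrite divr_ge0 // ltW.
    rewrite -(ler_pXn2r (_ : 0 < 2)%N) ?nnegrE ?sqrtr_ge0 ?ler0n // sqr_sqrtr //.
    rewrite ler_pdivlMr // (le_trans _ (ltW hN)) // normE //= ler_wpM2l ?sqr_ge0 //.
    by apply: quot_le; rewrite ?expR_gt0 // ler_expR; lra.
  by rewrite ler_nat truncn_ge_nat ?sqrtr_ge0.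
rewrite mem_int_range.
have : `|j%:~R| < (width i)%:R :> R.
  apply: le_lt_trans (truncnS_gt _); case/andP: hij => h1 h2; rewrite ler_norml.
  have := ler_norm q; have := ler_norm (- p); rewrite normrN.
  have := normr_ge0 p; have := normr_ge0 q; move: (`|p|) (`|q|) => a b b0 a0 hp hq.
  by apply/andP; split; nra.
by rewrite ltr_norml [(width i)%:R]pmulrn -rmorphN !ltr_int; clear; lia.
Qed.

Definition hyp_count : R -> set R -> R := count_on hyp_box hyp_in hyp_arg.

Let rowcount (P : int -> Prop) i : nat :=
  count (fun j => `[< P j >]) (int_range (- (width i)%:Z) (width i).*2.+1).

Let hyp_countE N S : hyp_count N S =
  \sum_(1 <= i < (rows N).+1) (rowcount (fun j => hyp_in N (i, j) /\ S (hyp_arg (i, j))) i)%:R.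
Proof.
rewrite /hyp_count /count_on /hyp_box count_flatten -map_comp sumnE big_map.
rewrite /index_iota subn1 natr_sum; apply: eq_bigr => i _ /=.
by rewrite count_map.
Qed.

Let c : R := 3%:R / (2%:R * nu * (q - p)).

Let lin_small (A e : R) : 0 < e -> \forall N \near +oo, A * Num.sqrt N <= e * N.
Proof.
move=> e0; near=> N.
have N0 : 0 <= N by near: N; apply: nbhs_pinfty_ge; rewrite num_real.
have hN : (A / e) ^+ 2 <= N by near: N; apply: nbhs_pinfty_ge; rewrite num_real.
have hA : A / e <= Num.sqrt N.
  by apply: le_trans (ler_norm _) _; rewrite -sqrtr_sqr ler_wsqrtr.
rewrite -{2}(sqr_sqrtr N0) expr2 mulrA ler_wpM2r ?sqrtr_ge0 //.
by rewrite mulrC -ler_pdivrMr.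
Unshelve. all: by end_near. Qed.

Let ratio (x y : R) : R := expR (3%:R * (y - x)).

Let ratioE x y : expR (3%:R * y) = ratio x y * expR (3%:R * x).
Proof. by rewrite /ratio -expRD; congr expR; ring. Qed.

Let ratio_ge1 x y : x <= y -> 1 <= ratio x y.
Proof. by move=> xy; rewrite /ratio -expR0 ler_expR mulr_ge0 // subr_ge0. Qed.

Let sig_diff x y : sig x - sig y = (q - p) * (expR (3%:R * y) - expR (3%:R * x)) /
   ((1 + expR (3%:R * x)) * (1 + expR (3%:R * y))).
Proof. by rewrite /sig; have := E1 x; have := E1 y => h1 h2; field; rewrite !gt_eqF. Qed.

Lemma hyp_upper_itv (x y : R) : x <= y ->
  upper_density hyp_count `[x, y] (c * (y - x) * ratio x y ^+ 2).
Proof.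
move=> xy; set a := expR (3%:R * x); set b := expR (3%:R * y).
have a0 : 0 < a by apply: expR_gt0.
have b0 : 0 < b by apply: expR_gt0.
pose qm := nu * (q - p) ^+ 2 * a / (1 + b) ^+ 2.
have qm0 : 0 < qm by rewrite divr_gt0 ?mulr_gt0 ?exprn_gt0 ?subr_gt0 // addr_gt0.
pose d := sig x - sig y; have d0 : 0 <= d by rewrite subr_ge0 sig_le.
have hd : d / (2%:R * qm) <= c * (y - x) * ratio x y ^+ 2.
  have r1 := ratio_ge1 xy; have r0 : 0 < ratio x y := expR_gt0 _.
  have eb : b = ratio x y * a := ratioE x y.
  have h1 : b - a <= 3%:R * (y - x) * b.
    have := expR_ge1Dx (- (3%:R * (y - x))); rewrite expRN -/(ratio x y) => h.
    have : (1 + - (3%:R * (y - x))) * b <= (ratio x y)^-1 * b by rewrite ler_wpM2r // ltW.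
    by rewrite {2}eb mulKf ?gt_eqF //; lra.
  have -> : d / (2%:R * qm) = (b - a) * ((1 + b) / ((1 + a) * a * (2%:R * nu * (q - p)))).
    rewrite /d sig_diff -/a -/b /qm; field.
    by rewrite ?(gt_eqF a0) ?(gt_eqF nu0) ?subr_eq0 ?(gt_eqF pq) ?gt_eqF ?addr_gt0.
  have h2 : 0 < (1 + b) / ((1 + a) * a * (2%:R * nu * (q - p))).
    by rewrite divr_gt0 // ?mulr_gt0 // ?subr_gt0 // addr_gt0.
  apply: le_trans (ler_wpM2r (ltW h2) h1) _.
  have -> : 3%:R * (y - x) * b * ((1 + b) / ((1 + a) * a * (2%:R * nu * (q - p)))) =
     (c * (y - x)) * ((b / a) * ((1 + b) / (1 + a))).
    rewrite /c; field.
    by rewrite ?(gt_eqF a0) ?(gt_eqF nu0) ?subr_eq0 ?(gt_eqF pq) ?gt_eqF ?addr_gt0.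
  rewrite ler_wpM2l ?mulr_ge0 ?subr_ge0 //.
    by rewrite invr_ge0 ltW // !mulr_gt0 ?subr_gt0.
  have h3 : (1 + b) / (1 + a) <= ratio x y.
    by rewrite ler_pdivrMr ?addr_gt0 // mulrDr mulr1 -eb lerD2r.
  have -> : b / a = ratio x y by rewrite eb mulfK // gt_eqF.
  by rewrite expr2 ler_wpM2l // ltW.
move=> e e0; near=> N.
have N0 : 0 < N by near: N; apply: nbhs_pinfty_gt; rewrite num_real.
pose Y := Num.sqrt (N / qm); have Y0 : 0 <= Y := sqrtr_ge0 _.
rewrite hyp_countE; apply: le_trans (_ : _ <= \sum_(1 <= i < (rows N).+1) (if i%:R <= Y then i%:R * d + 1 else 0)) _.
  apply: ler_sum_nat => i /andP[i0 _]; case: ifP => hi.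
    apply: (@le_trans _ _ (i%:R * sig x - i%:R * sig y + 1)); last by rewrite /d; lra.
    apply: le_trans (count_row_le (int_range_uniq _ _) (_ : i%:R * sig y <= i%:R * sig x)); last first.
      by rewrite ler_wpM2l // sig_le.
    rewrite ler_nat; apply: sub_count => j /asboolP[[_ hij _]] /=.
    rewrite in_itv /= => /andP[h1 h2]; rewrite (argE hij) /= ![i%:R * _]mulrC.
    by rewrite !ler_wpM2r ?sig_le.
  rewrite /rowcount (eq_count (a2 := pred0)) ?count_pred0 // => j.
  apply/asboolP => -[[_ hij hN]] /=; rewrite in_itv /= => /andP[h1 h2].
  move/negP: hi; apply; rewrite -(ler_pXn2r (_ : 0 < 2)%N) ?nnegrE //.
  have Nq : 0 <= N / qm by rewrite divr_ge0 // ltW.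
  rewrite sqr_sqrtr // ler_pdivlMr // (le_trans _ (ltW hN)) //.
  rewrite normE //= ler_wpM2l ?sqr_ge0 //; apply: quot_le => //; rewrite ler_expR; lra.
apply: le_trans (sum_rows_le _ d0 Y0) _.
have -> : d * Y * (Y + 1) / 2%:R + Y = d / (2%:R * qm) * N + (d / 2%:R + 1) / Num.sqrt qm * Num.sqrt N.
  have Y2 : Y ^+ 2 = N / qm by rewrite sqr_sqrtr // divr_ge0 // ltW.
  have -> : d * Y * (Y + 1) / 2%:R + Y = d / 2%:R * Y ^+ 2 + (d / 2%:R + 1) * Y by field.
  rewrite Y2 {1}/Y sqrtrM ?(ltW N0) // sqrtrV ?(ltW qm0) //; congr (_ + _); first by field; rewrite gt_eqF.
  by rewrite -!mulrA [Num.sqrt N * _]mulrC.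
rewrite [leRHS]mulrDl lerD ?ler_wpM2r ?(ltW N0) //.
by near: N; apply: lin_small.
Unshelve. all: by end_near. Qed.

Lemma hyp_lower_itv (x y : R) : x <= y -> - K <= x -> y <= K ->
  lower_density hyp_count `]x, y[ (c * (y - x) / ratio x y ^+ 2).
Proof.
move=> xy Kx Ky; set a := expR (3%:R * x); set b := expR (3%:R * y).
have a0 : 0 < a by apply: expR_gt0.
have b0 : 0 < b by apply: expR_gt0.
pose qM := nu * (q - p) ^+ 2 * b / (1 + a) ^+ 2.
have qM0 : 0 < qM by rewrite divr_gt0 ?mulr_gt0 ?exprn_gt0 ?subr_gt0 // addr_gt0.
have ab : a <= b by rewrite ler_expR ler_pM2l.
have q0M : q0 <= qM.
  apply: le_trans (_ : _ <= nu * (q - p) ^+ 2 * b / (1 + b) ^+ 2) _.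
    by apply: quot_le; rewrite ?expR_gt0 // ler_expR; lra.
  rewrite /qM ler_pM2l ?mulr_gt0 ?exprn_gt0 ?subr_gt0 // lef_pV2 ?posrE ?exprn_gt0 ?addr_gt0 //.
  by rewrite ler_pXn2r ?nnegrE ?addr_ge0 ?(ltW a0) ?(ltW b0) // lerD2l.
pose d := sig x - sig y; have d0 : 0 <= d by rewrite subr_ge0 sig_le.
have hd : c * (y - x) / ratio x y ^+ 2 <= d / (2%:R * qM).
  have r1 := ratio_ge1 xy; have r0 : 0 < ratio x y := expR_gt0 _.
  have eb : b = ratio x y * a := ratioE x y.
  have h1 : 3%:R * (y - x) * a <= b - a.
    have := expR_ge1Dx (3%:R * (y - x)); rewrite -/(ratio x y) => h.
    have : (1 + 3%:R * (y - x)) * a <= ratio x y * a by rewrite ler_wpM2r // ltW.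
    by rewrite -eb; lra.
  have -> : d / (2%:R * qM) = (b - a) * ((1 + a) / ((1 + b) * b * (2%:R * nu * (q - p)))).
    rewrite /d sig_diff -/a -/b /qM; field.
    by rewrite ?(gt_eqF b0) ?(gt_eqF nu0) ?subr_eq0 ?(gt_eqF pq) ?gt_eqF ?addr_gt0.
  have h2 : 0 < (1 + a) / ((1 + b) * b * (2%:R * nu * (q - p))).
    by rewrite divr_gt0 // ?mulr_gt0 // ?subr_gt0 // addr_gt0.
  apply: le_trans _ (ler_wpM2r (ltW h2) h1).
  have -> : 3%:R * (y - x) * a * ((1 + a) / ((1 + b) * b * (2%:R * nu * (q - p)))) =
     (c * (y - x)) * ((a / b) * ((1 + a) / (1 + b))).
    rewrite /c; field.
    by rewrite ?(gt_eqF b0) ?(gt_eqF nu0) ?subr_eq0 ?(gt_eqF pq) ?gt_eqF ?addr_gt0.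
  rewrite ler_wpM2l ?mulr_ge0 ?subr_ge0 //.
    by rewrite invr_ge0 ltW // !mulr_gt0 ?subr_gt0.
  have -> : a / b = (ratio x y)^-1 by rewrite eb invfM mulrCA divff ?mulr1 // gt_eqF.
  have h3 : (ratio x y)^-1 <= (1 + a) / (1 + b).
    by rewrite ler_pdivlMr ?addr_gt0 // mulrC ler_pdivrMr // mulrDl mul1r [a * _]mulrC -eb lerD2r.
  by rewrite expr2 invfM ler_wpM2l // invr_ge0 ltW.
move=> e e0; near=> N.
have N0 : 0 < N by near: N; apply: nbhs_pinfty_gt; rewrite num_real.
pose Y := Num.sqrt (N / qM); have Y0 : 0 <= Y := sqrtr_ge0 _.
have NqM : 0 <= N / qM by rewrite divr_ge0 // ltW.
have Yr : Y <= (rows N).+1%:R.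
  apply: le_trans (ltW (truncnS_gt _)); rewrite ler_wsqrtr // ler_pM2l // lef_pV2 //.
rewrite hyp_countE; apply: le_trans _ (_ : \sum_(1 <= i < (rows N).+1) (if i%:R < Y then i%:R * d - 1 else 0) <= _); last first.
  apply: ler_sum_nat => i /andP[i0 _]; case: ifP => hi //.
  apply: (@le_trans _ _ (i%:R * sig x - i%:R * sig y - 1)); first by rewrite /d; lra.
  have ip : 0 < i%:R :> R by rewrite ltr0n.
  have sp : p < sig y.
    rewrite /sig ltr_pdivlMr // -/b -subr_gt0 (_ : _ - _ = q - p) ?subr_gt0 //; ring.
  have sq : sig x < q.
    rewrite /sig ltr_pdivrMr // -/a -subr_gt0 (_ : _ - _ = (q - p) * a) ?mulr_gt0 ?subr_gt0 //; ring.
  have key (j : int) : i%:R * sig y < j%:~R < i%:R * sig x ->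
      hyp_in N (i, j) /\ x < hyp_arg (i, j) < y.
    move=> /andP[h1 h2].
    have hij : p * i%:R < j%:~R < q * i%:R.
      apply/andP; split; first by apply: lt_trans h1; rewrite mulrC ltr_pM2l.
      by apply: lt_trans h2 _; rewrite mulrC ltr_pM2r.
    have := argE (v := (i, j)) hij; rewrite /= mulrC => eij.
    have hu : x < hyp_arg (i, j) < y.
      have h3 : sig y < sig (hyp_arg (i, j)) by rewrite -(ltr_pM2l ip) -eij.
      have h4 : sig (hyp_arg (i, j)) < sig x by rewrite -(ltr_pM2l ip) -eij.
      by rewrite !ltNge; apply/andP; split; apply/negP => /sig_le; rewrite leNgt ?h3 ?h4.
    split=> //; split=> //; rewrite normE //=.
    have : i%:R ^+ 2 < N / qM.
      by rewrite -[ltRHS]sqr_sqrtr // ltr_pXn2r ?nnegrE.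
    rewrite ltr_pdivlMr //; apply: le_lt_trans; rewrite ler_wpM2l ?sqr_ge0 //.
    case/andP: hu => /ltW hu1 /ltW hu2; rewrite /qM -!(mulrA (nu * _)) ler_wpM2l //.
    - by rewrite mulr_ge0 ?sqr_ge0 ?(ltW nu0).
    - rewrite ler_pM ?expR_ge0 ?invr_ge0 ?exprn_ge0 ?addr_ge0 ?expR_ge0 //.
        by rewrite ler_expR ler_pM2l.
      rewrite lef_pV2 ?posrE ?exprn_gt0 ?addr_gt0 ?expR_gt0 // ler_pXn2r ?nnegrE ?addr_ge0 ?expR_ge0 ?(ltW a0) //.
      by rewrite lerD2l ler_expR ler_pM2l.
  apply: le_trans (count_row_ge (s := int_range (- (width i)%:Z) (width i).*2.+1) _) _.
    move=> j hj; have [hin /andP[hu1 hu2]] := key _ hj.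
    have : (i, j) \in hyp_box N.
      by apply: mem_hyp_box => //; rewrite (le_trans Kx (ltW hu1)) (le_trans (ltW hu2)).
    by case/allpairsPdep => i' [j' [_ hj' [-> ->]]].
  rewrite ler_nat; apply: sub_count => j /key [hin hu]; apply/asboolP; split=> //=.
apply: le_trans _ (sum_rows_ge d0 Y0 Yr).
have -> : d * (Y - 1) * Y / 2%:R - Y = d / (2%:R * qM) * N - (d / 2%:R + 1) / Num.sqrt qM * Num.sqrt N.
  have Y2 : Y ^+ 2 = N / qM by rewrite sqr_sqrtr.
  have -> : d * (Y - 1) * Y / 2%:R - Y = d / 2%:R * Y ^+ 2 - (d / 2%:R + 1) * Y by field.
  rewrite Y2 {1}/Y sqrtrM ?(ltW N0) // sqrtrV ?(ltW qM0) //; congr (_ - _); first by field; rewrite gt_eqF.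
  by rewrite -!mulrA [Num.sqrt N * _]mulrC.
rewrite [leLHS]mulrBl lerB ?ler_wpM2r ?(ltW N0) //.
by near: N; apply: lin_small.
Unshelve. all: by end_near. Qed.

Let c_ge0 : 0 <= c.
Proof. by rewrite /c divr_ge0 // ltW // !mulr_gt0 ?subr_gt0. Qed.

Let ratio_small (e : R) : 0 < e ->
  exists2 r, 0 < r & forall u x y, x <= u <= y -> u - r < x -> y < u + r -> ratio x y ^+ 2 <= 1 + e.
Proof.
move=> e0; have l0 : 0 < ln (1 + e) by rewrite ln_gt0 // ltrDl.
exists (ln (1 + e) / 12%:R); first by rewrite divr_gt0.
move=> u x y _ h1 h2; rewrite /ratio -expRM_natl -[leRHS]lnK ?posrE ?addr_gt0 // ler_expR.
by move: h1 h2; rewrite -mulr_natl; lra.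
Qed.

Lemma hyp_upper (x y : R) : x <= y -> upper_density hyp_count `[x, y] (c * (y - x)).
Proof.
have h (e : R) : 0 < e -> forall x y, x <= y -> upper_density hyp_count `[x, y] (c * (1 + e) * (y - x)).
  move=> e0; have [r r0 hr] := ratio_small e0; apply: interval_induction.
    move=> t u v tu uv h1 h2; apply: (upper_densityW (@count_on_sub _ _ _ _ _)) (upper_densityU (@count_onU_le _ _ _ _ _) h1 h2); last by lra.
    move=> z; rewrite /= !in_itv /= => /andP[z1 z2].
    by have [zu|zu] := leP z u; [left | right]; rewrite ?z1 ?z2 ?zu ?(ltW zu).
  move=> u; exists r => // t v tuv h1 h2; have tv : t <= v by case/andP: tuv => /le_trans h /h.
  apply: (upper_densityW (@count_on_sub _ _ _ _ _)) (hyp_upper_itv tv) => //.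
  by rewrite -(mulrA c (v - t)) -(mulrA c (1 + e)) ler_wpM2l // [leRHS]mulrC ler_wpM2l ?subr_ge0 //; apply: (hr u).
move=> xy; apply: upper_density_lim => e e0.
have k0 : 0 < c * (y - x) + 1 by rewrite ltr_wpDl // mulr_ge0 ?subr_ge0.
apply: (upper_densityW (@count_on_sub _ _ _ _ _)) (h (e / (c * (y - x) + 1)) (divr_gt0 e0 k0) _ _ xy) => //.
rewrite mulrAC mulrDr mulr1 lerD2l mulrCA ler_piMr ?(ltW e0) // ler_pdivrMr // mul1r.
by rewrite lerDl.
Qed.

Lemma hyp_lower (x y : R) : x <= y -> - K <= x -> y <= K ->
  lower_density hyp_count `]x, y[ (c * (y - x)).
Proof.
have h (e : R) : 0 < e -> forall x y, x <= y -> - K <= x -> y <= K ->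
    lower_density hyp_count `]x, y[ (c / (1 + e) * (y - x)).
  move=> e0; have [r r0 hr] := ratio_small e0; apply: interval_induction.
    move=> t u v tu uv h1 h2 Kt Kv.
    have d : `]t, u[ `&` `]u, v[ `<=` (set0 : set R).
      by move=> z [] /=; rewrite !in_itv /= => /andP[_ h3] /andP[h4 _]; move: (lt_trans h3 h4); rewrite ltxx.
    have l1 := h1 Kt (le_trans uv Kv); have l2 := h2 (le_trans Kt tu) Kv.
    apply: (lower_densityW (@count_on_sub _ _ _ _ _)) (lower_densityU (@count_onU_ge _ _ _ _ _) d l1 l2); last by lra.
    move=> z [] /=; rewrite !in_itv /= => /andP[z1 z2]; rewrite ?z1 ?z2 ?andbT /=.
      exact: lt_le_trans uv.
    exact: le_lt_trans z1.
  move=> u; exists r => // t v tuv h1 h2 Kt Kv; have tv : t <= v by case/andP: tuv => /le_trans h /h.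
  apply: (lower_densityW (@count_on_sub _ _ _ _ _)) (hyp_lower_itv tv Kt Kv) => //.
  rewrite -(mulrA c (v - t)) -(mulrA c (1 + e)^-1) ler_wpM2l // [leLHS]mulrC ler_wpM2l ?subr_ge0 // lef_pV2 ?posrE ?exprn_gt0 ?expR_gt0 ?addr_gt0 //.
  exact: (hr u).
move=> xy Kx Ky; apply: lower_density_lim => e e0.
have k0 : 0 < c * (y - x) + 1 by rewrite ltr_wpDl // mulr_ge0 ?subr_ge0.
have e'0 := divr_gt0 e0 k0; set e' := e / _ in e'0.
apply: (lower_densityW (@count_on_sub _ _ _ _ _)) (h _ e'0 _ _ xy Kx Ky) => //.
have -> : c / (1 + e') * (y - x) = (c * (y - x)) / (1 + e') by rewrite mulrAC.
have ee : e = e' * (c * (y - x) + 1) by rewrite divfK // gt_eqF.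
rewrite ler_pdivlMr ?addr_gt0 // ee.
have := mulr_ge0 c_ge0 (_ : 0 <= y - x); rewrite subr_ge0 => /(_ xy); move: (c * _) => k k1.
by nra.
Qed.

(* Points whose remaining coordinate is determined by v.1 and by two integers z, w with
   z^2 and |w|^3 of order v.1, hence of order sqrt N, are too few to matter. *)
Lemma sparse_count (P : nat * int -> Prop) (rel : nat * int -> int * int -> Prop) (kap : R) :
  0 < kap ->
  (forall v, (0 < v.1)%N -> P v -> exists2 zw : int * int, rel v zw &
     `|zw.2%:~R| ^+ 3 <= kap * v.1%:R /\ zw.1%:~R ^+ 2 <= kap * v.1%:R) ->
  (forall i j j' zw, (0 < i)%N -> rel (i, j) zw -> rel (i, j') zw -> j = j') ->
  forall e, 0 < e -> \forall N \near +oo, (count (fun v => `[< P v >]) (hyp_box N))%:R <= e * N.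
Proof.
move=> kap0 hP hrel e e0.
have F v : {zw : int * int | (0 < v.1)%N -> P v -> rel v zw /\
   (`|zw.2%:~R| ^+ 3 <= kap * v.1%:R /\ zw.1%:~R ^+ 2 <= kap * v.1%:R)}.
  apply: cid; have [[h1 h2]|h] := pselect ((0 < v.1)%N /\ P v); last by exists (0, 0) => h1 h2; case: h.
  by have [zw h3 h4] := hP v h1 h2; exists zw.
have [g hg] : {g : nat * int -> int * int | forall v, (0 < v.1)%N -> P v -> rel v (g v) /\
   (`|(g v).2%:~R| ^+ 3 <= kap * v.1%:R /\ (g v).1%:~R ^+ 2 <= kap * v.1%:R)}.
  by exists (fun v => sval (F v)) => v; exact: (svalP (F v)).
pose H := Num.sqrt q0^-1; have H0 : 0 < H by rewrite sqrtr_gt0 invr_gt0.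
pose d := Num.min 1 (e / (9%:R * kap * H ^+ 2)).
have d0 : 0 < d by rewrite lt_min ltr01 divr_gt0 // !mulr_gt0.
have d1 : d <= 1 by rewrite ge_min lexx.
have de : d * (9%:R * kap * H ^+ 2) <= e.
  by rewrite -ler_pdivlMr ?mulr_gt0 ?exprn_gt0 // ge_min lexx orbT.
near=> N.
have N0 : 0 < N by near: N; apply: nbhs_pinfty_gt; rewrite num_real.
pose X := H * Num.sqrt N; have X0 : 0 < X by apply: mulr_gt0 => //; rewrite sqrtr_gt0.
have rX : (rows N)%:R <= X.
  rewrite /X /H mulrC -sqrtrM ?(ltW N0) //.
  by rewrite truncn_le sqrtr_ge0.
pose G := Num.sqrt (kap * X); have G0 : 0 < G by rewrite sqrtr_gt0 mulr_gt0.
have GX : G ^+ 2 = kap * X by rewrite sqr_sqrtr // ltW // mulr_gt0.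
have Gd : 1 <= d ^+ 3 * G.
  have hN : (((d ^+ 3)^-1) ^+ 2 / (kap * H)) ^+ 2 <= N by near: N; apply: nbhs_pinfty_ge; rewrite num_real.
  have hs : ((d ^+ 3)^-1) ^+ 2 / (kap * H) <= Num.sqrt N.
    by apply: le_trans (ler_norm _) _; rewrite -sqrtr_sqr ler_wsqrtr.
  rewrite -ler_pdivrMl ?exprn_gt0 // mulr1 -(ler_pXn2r (_ : 0 < 2)%N) ?nnegrE ?invr_ge0 ?exprn_ge0 ?(ltW d0) ?(ltW G0) //.
  by rewrite GX /X mulrA -ler_pdivrMl ?mulr_gt0 // mulrC.
have dG : 1 <= d * G.
  apply: le_trans Gd _; rewrite ler_pM2r // -[leRHS]expr1.
  by apply: ler_wiXn2l => //; exact: ltW.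
have G1 : 1 <= G by apply: le_trans dG _; rewrite ler_piMl // ltW.
pose zb := Num.truncn G; pose wb := Num.truncn (d * G).
pose T := [seq (i, zw) | i <- iota 1 (rows N), zw <- [seq (z, w) |
   z <- int_range (- zb%:Z) zb.*2.+1, w <- int_range (- wb%:Z) wb.*2.+1]].
have hT : (count (fun v => `[< P v >]) (hyp_box N) <= size T)%N.
  rewrite -size_filter -(size_map (fun v => (v.1, g v))); apply: uniq_leq_size.
    rewrite map_inj_in_uniq; first exact: filter_uniq (hyp_box_uniq N).
    move=> [i j] [i' j']; rewrite !mem_filter => /andP[/asboolP Pv /allpairsPdep[i1 [j1 [hi _ [e1 _]]]]].
    move=> /andP[/asboolP Pv' _] /= [ei eg]; subst i1 i'.
    have i0 : (0 < i)%N by move: hi; rewrite mem_iota => /andP[].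
    have [r1 _] := hg (i, j) i0 Pv; have [r2 _] := hg (i, j') i0 Pv'.
    by rewrite -eg in r2; rewrite (hrel _ _ _ _ i0 r1 r2).
  move=> w /mapP[[i j]]; rewrite mem_filter => /andP[/asboolP Pv /allpairsPdep[i1 [j1 [hi hj [e1 e2]]]]] ->.
  subst i1 j1; have i0 : (0 < i)%N by move: hi; rewrite mem_iota => /andP[].
  have [_ [h1 h2]] := hg (i, j) i0 Pv; rewrite /= in h1 h2 *.
  have iX : i%:R <= X.
    by apply: le_trans rX; rewrite ler_nat; move: hi; rewrite mem_iota add1n ltnS => /andP[].
  have kX : kap * i%:R <= G ^+ 2 by rewrite GX ler_pM2l.
  suff h3 : g (i, j) \in [seq (z, w) | z <- int_range (- zb%:Z) zb.*2.+1, w <- int_range (- wb%:Z) wb.*2.+1].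
    by apply/allpairsP; exists (i, g (i, j)).
  apply/allpairsP; exists (g (i, j)); split; last by case: (g (i, j)).
    apply: mem_int_range_norm; rewrite -(ler_pXn2r (_ : 0 < 2)%N) ?nnegrE ?(ltW G0) // real_normK ?num_real //.
    exact: le_trans h2 kX.
  apply: mem_int_range_norm; rewrite -(ler_pXn2r (_ : 0 < 3)%N) ?nnegrE ?(ltW (mulr_gt0 d0 G0)) //.
  apply: le_trans h1 (le_trans kX _); rewrite exprMn [G ^+ 3]exprS mulrA.
  by rewrite ler_peMl ?sqr_ge0.
apply: le_trans (_ : (size T)%:R <= _); first by rewrite ler_nat.
rewrite !size_allpairs size_iota !size_int_range !natrM.
have hz : (zb.*2.+1)%:R <= 3%:R * G.
  have := ltW G0; rewrite -truncn_le -/zb -natr1 -muln2 natrM; lra.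
have hw : (wb.*2.+1)%:R <= 3%:R * (d * G).
  have := ltW (mulr_gt0 d0 G0); rewrite -truncn_le -/wb -natr1 -muln2 natrM; lra.
apply: (@le_trans _ _ (X * (3%:R * G * (3%:R * (d * G))))).
  by rewrite ler_pM ?mulr_ge0 // ler_pM.
have -> : X * (3%:R * G * (3%:R * (d * G))) = d * 9%:R * X * G ^+ 2 by ring.
have XN : X ^+ 2 = H ^+ 2 * N by rewrite exprMn (sqr_sqrtr (ltW N0)).
rewrite GX (_ : _ * (kap * X) = d * 9%:R * kap * X ^+ 2); last by ring.
rewrite XN mulrA ler_pM2r //; apply: le_trans de; rewrite le_eqVlt; apply/orP; left; apply/eqP; ring.
Unshelve. all: by end_near. Qed.

End HyperbolicCount.

(** * Cubic forms with a given Hessian *)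

Section Hermite.

Lemma subgroup_basis (P : int -> int -> Prop) (m : int) : 0 < m ->
  (forall a b a' b', P a b -> P a' b' -> P (a - a') (b - b')) -> P m 0 -> P 0 m ->
  exists e f h : int, [/\ 0 < e, 0 < h &
    forall a b, P a b <-> exists i j, a = e * i /\ b = f * i + h * j].
Proof.
move=> m0 PB Pm0 P0m.
have P0 : P 0 0 by have := PB _ _ _ _ Pm0 Pm0; rewrite !subrr.
have PN a b : P a b -> P (- a) (- b) by move=> h; have := PB _ _ _ _ P0 h; rewrite !sub0r.
have PD a b a' b' : P a b -> P a' b' -> P (a + a') (b + b').
  by move=> h h'; have := PB _ _ _ _ h (PN _ _ h'); rewrite !opprK.
have Pn (n : nat) a b : P a b -> P (a * n%:Z) (b * n%:Z).
  move=> h; elim: n => [|n ih]; first by rewrite !mulr0.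
  by rewrite -addn1 PoszD !mulrDr !mulr1; apply: PD.
have Pz (k : int) a b : P a b -> P (a * k) (b * k).
  by case: k => n h; [exact: Pn | rewrite NegzE !mulrN; apply: PN; apply: Pn].
have least (S : int -> Prop) : S m -> exists e : int, [/\ 0 < e, S e & forall k, 0 < k -> k < e -> ~ S k].
  move=> Sm; have ex : exists n : nat, (0 < n)%N && `[< S n%:Z >].
    exists `|m|%N; rewrite absz_gt0 gt_eqF //=; apply/asboolP.
    by rewrite gez0_abs // ltW.
  exists (ex_minn ex)%:Z; case: ex_minnP => n /andP[n0 /asboolP Sn] hn; split=> // k k0 kn Sk.
  have := hn `|k|%N; rewrite absz_gt0 gt_eqF //=.
  by rewrite gez0_abs ?ltW // => /(_ (asboolT Sk)); lia.
have [e [e0 [f Pef] emin]] := least (fun k => exists b, P k b) (ex_intro _ _ Pm0).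
have [h [h0 Ph hmin]] := least (P 0) P0m.
exists e, f, h; split=> // a b; split; last first.
  move=> [i [j [-> ->]]]; have := PD _ _ _ _ (Pz i _ _ Pef) (Pz j _ _ Ph).
  by rewrite mul0r addr0.
move=> Pab; exists (a %/ e)%Z.
have ae : a = e * (a %/ e)%Z.
  have := divz_eq a e; have := modz_ge0 a (lt0r_neq0 e0); have := ltz_pmod a e0.
  set r := (a %% e)%Z; set k := (a %/ e)%Z => r1 r2 h3.
  have Pr : P r (b - f * k).
    by have := PB _ _ _ _ Pab (Pz k _ _ Pef); rewrite {1}h3 mulrC addrAC subrr add0r.
  have [r0|r0] := eqVneq r 0; first by rewrite h3 r0 addr0 mulrC.
  by case: (emin r _ r1); [rewrite lt_neqAle eq_sym r0 | exists (b - f * k)].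
set k := (a %/ e)%Z in ae *; exists ((b - f * k) %/ h)%Z; split=> //.
have Pb : P 0 (b - f * k) by have := PB _ _ _ _ Pab (Pz k _ _ Pef); rewrite ae mulrC subrr.
have := divz_eq (b - f * k) h; have := modz_ge0 (b - f * k) (lt0r_neq0 h0); have := ltz_pmod (b - f * k) h0.
set r := (_ %% h)%Z; set l := (_ %/ h)%Z => r1 r2 h3.
have Pr : P 0 r.
  by have := PB _ _ _ _ Pb (Pz l _ _ Ph); rewrite mul0r subr0 {1}h3 mulrC addrAC subrr add0r.
have [r0|r0] := eqVneq r 0; first by move: h3; rewrite r0 addr0 mulrC; lia.
by case: (hmin r _ r1); rewrite // lt_neqAle eq_sym r0.
Qed.

End Hermite.

Section ReducibleForms.
Variables (r s t : int).
Let D := s ^+ 2 - 4 * r * t.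

(* The integral cubic forms apolar to r x^2 + s x y + t y^2, i.e. those whose Hessian is a
   multiple of it. *)
Definition apolar (C : int * int * int * int) : Prop :=
  let: (a, b, c, d) := C in
  3 * t * a - s * b + r * c = 0 /\ t * b - s * c + 3 * r * d = 0.

Lemma apolar_root (a b c d p q : int) : r != 0 -> apolar (a, b, c, d) -> cubic_root (a, b, c, d) p q ->
  a * (3 * r ^+ 2 * p ^+ 3 - 9 * r * t * p * q ^+ 2 - 3 * s * t * q ^+ 3) =
  - b * (q * (3 * r ^+ 2 * p ^+ 2 + 3 * r * s * p * q + (s ^+ 2 - r * t) * q ^+ 2)).
Proof.
move=> r0 [h1 h2] hC.
have e1 : r * c = s * b - 3 * t * a by move: h1; lia.
have e2 : r * (3 * r * d) = s * (r * c) - t * r * b.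
  have -> : 3 * r * d = s * c - t * b by move: h2; lia.
  by ring.
have : 3 * r ^+ 2 * (a * p ^+ 3 + b * p ^+ 2 * q + c * p * q ^+ 2 + d * q ^+ 3) = 0.
  by rewrite hC mulr0.
have -> : 3 * r ^+ 2 * (a * p ^+ 3 + b * p ^+ 2 * q + c * p * q ^+ 2 + d * q ^+ 3) =
  3 * r ^+ 2 * a * p ^+ 3 + 3 * r ^+ 2 * b * p ^+ 2 * q + 3 * r * p * q ^+ 2 * (r * c) +
  q ^+ 3 * (r * (3 * r * d)) by ring.
rewrite e2 e1 => h; apply/eqP; rewrite -subr_eq0 -[X in _ == X]h; apply/eqP; ring.
Qed.

Lemma apolar_root_dvd (a b c d p q : int) : r != 0 -> coprimez p q -> apolar (a, b, c, d) ->
  cubic_root (a, b, c, d) p q ->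
  ((q * (3 * r ^+ 2 * p ^+ 2 + 3 * r * s * p * q + (s ^+ 2 - r * t) * q ^+ 2))
    %| a * (D ^+ 2 * (3 * r ^+ 2) ^+ 5))%Z.
Proof.
move=> r0 cpq hap hC; have hAB := apolar_root r0 hap hC.
set A := 3 * r ^+ 2 * p ^+ 3 - _ - _ in hAB; set B := q * _ in hAB *.
have dA : (B %| a * A)%Z by rewrite hAB dvdz_mull.
have dq : (B %| a * D ^+ 2 * q ^+ 5)%Z.
  have -> : a * D ^+ 2 * q ^+ 5 = a * A * (- 3 * (2 * r * p + s * q) * r * q) +
     B * (a * (4 * D * q ^+ 2 + 3 * (2 * r * p + s * q) * (r * p - s * q))).
    by rewrite /A /B /D; ring.
  by rewrite rpredD // dvdz_mulr.
have dp : (B %| a * D ^+ 2 * (3 * r ^+ 2) ^+ 5 * p ^+ 15)%Z.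
  have pw (x y : int) : exists k, (x + y) ^+ 5 = x * k + y ^+ 5.
    by exists (x ^+ 4 + 5 * x ^+ 3 * y + 10 * x ^+ 2 * y ^+ 2 + 10 * x * y ^+ 3 + 5 * y ^+ 4); ring.
  pose Z := 9 * r * t * p * q + 3 * s * t * q ^+ 2.
  have [k hk] := pw A (q * Z).
  have -> : a * D ^+ 2 * (3 * r ^+ 2) ^+ 5 * p ^+ 15 = a * D ^+ 2 * (A + q * Z) ^+ 5.
    rewrite (_ : A + q * Z = 3 * r ^+ 2 * p ^+ 3); last by rewrite /A /Z; ring.
    by ring.
  have -> : a * D ^+ 2 * (A + q * Z) ^+ 5 = a * A * (D ^+ 2 * k) + a * D ^+ 2 * q ^+ 5 * Z ^+ 5.
    by rewrite hk exprMn; ring.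
  by rewrite rpredD // dvdz_mulr.
have cc : coprimez (p ^+ 15) (q ^+ 5) by rewrite coprimezXl // coprimezXr.
have [[u v] huv] := coprimezP _ _ cc.
set k := (3 * r ^+ 2) ^+ 5 in dp *; rewrite mulrA -[a * _ * k]mulr1 -huv /= mulrDr rpredD //.
  by rewrite [u * _]mulrC mulrA dvdz_mulr.
rewrite (_ : _ * _ = a * D ^+ 2 * q ^+ 5 * (k * v)); last by ring.
by rewrite dvdz_mulr.
Qed.

Let bound_aux (q E A B k : int) : 0 < E -> q != 0 -> 0 < k -> 4 * B = 3 * A ^+ 2 + E * q ^+ 2 ->
  (q * B %| k)%Z -> `|q| ^+ 3 <= 4 * k /\ A ^+ 2 <= 4 * k.
Proof.
move=> E0 q0 k0 hB.
have q1 : 0 < `|q| by rewrite normr_gt0.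
have qq : q ^+ 2 = `|q| ^+ 2 by rewrite real_normK ?num_real.
have hA := sqr_ge0 A.
have B0 : 0 < B.
  have : 0 < E * q ^+ 2 by rewrite mulr_gt0 // qq exprn_gt0.
  by move: hB hA; move: (A ^+ 2) (E * _) => *; lia.
rewrite dvdzE => /dvdn_leq; rewrite absz_gt0 gt_eqF // => /(_ isT).
rewrite -lez_nat !abszE normrM (gtr0_norm B0) (gtr0_norm k0) => hle.
have hq : 4 * (`|q| * B) = 3 * (`|q| * A ^+ 2) + E * `|q| ^+ 3 by rewrite mulrCA hB qq; ring.
have hx : 0 <= `|q| * A ^+ 2 by rewrite mulr_ge0.
have hv : 0 < `|q| ^+ 3 by rewrite exprn_gt0.
have hy : 0 <= (E - 1) * `|q| ^+ 3 by rewrite mulr_ge0 ?(ltW hv) //; lia.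
have hz : 0 <= (`|q| - 1) * A ^+ 2 by rewrite mulr_ge0 //; lia.
move: hle hq hx hv hy hz hA; rewrite !mulrBl !mul1r.
by move=> *; split; lra.
Qed.

Lemma apolar_root_bound (a b c d p q : int) : r != 0 -> 0 < D -> 0 < a -> coprimez p q ->
  apolar (a, b, c, d) -> cubic_root (a, b, c, d) p q ->
  [/\ q != 0, `|q| ^+ 3 <= 4 * (D ^+ 2 * (3 * r ^+ 2) ^+ 5) * a &
     (2 * r * p + s * q) ^+ 2 <= 4 * (D ^+ 2 * (3 * r ^+ 2) ^+ 5) * a].
Proof.
move=> r0 D0 a0 cpq hap hC; have := apolar_root_dvd r0 cpq hap hC.
have q0 : q != 0.
  apply/eqP => q0; move: hC cpq; rewrite /cubic_root q0 /coprimez gcdz0 => hC p1.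
  have p0 : p != 0 by move: p1; lia.
  have : a * p ^+ 3 = 0 by rewrite -[RHS]hC; ring.
  by move/eqP; rewrite mulf_eq0 expf_eq0 /= (negbTE p0) (gt_eqF a0).
set k := D ^+ 2 * _; set B' := 3 * _ * _ + _ + _.
have hB : 4 * B' = 3 * (2 * r * p + s * q) ^+ 2 + D * q ^+ 2 by rewrite /B' /D; ring.
have k0 : 0 < k.
  by rewrite /k mulr_gt0 ?exprn_gt0 // mulr_gt0 // exprn_even_gt0.
rewrite -mulrA [k * a]mulrC => hd; split=> //;
  by have [] := bound_aux D0 q0 (mulr_gt0 a0 k0) hB hd.
Qed.

End ReducibleForms.

Section IndefiniteForms.
Variable R : realType.
Implicit Types (E Q : bqf int) (g : 'M[int]_2).

Definition nonsquare (D : int) : Prop := ~ exists n : int, D = n ^+ 2.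

Lemma bqf_anisotropic Q (x y : int) : nonsquare (bqf_disc Q) -> bqf_eval Q x y = 0 ->
  x = 0 /\ y = 0.
Proof.
case: Q => r s t nD; rewrite /bqf_disc /bqf_eval /= in nD * => h.
have r0 : r != 0 by apply/eqP => r0; apply: nD; exists s; rewrite r0; ring.
have hz : (2 * r * x + s * y) ^+ 2 = (s ^+ 2 - 4%:R * r * t) * y ^+ 2.
  have -> : (2 * r * x + s * y) ^+ 2 = 4 * r * (r * x ^+ 2 + s * x * y + t * y ^+ 2) +
     (s ^+ 2 - 4%:R * r * t) * y ^+ 2 by ring.
  by rewrite h mulr0 add0r.
have [y0|y0] := eqVneq y 0.
  split=> //; apply/eqP; move: h; rewrite y0 => /eqP.
  by rewrite expr0n /= !mulr0 !addr0 mulf_eq0 (negbTE r0) /= sqrf_eq0.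
have : (y %| 2 * r * x + s * y)%Z.
  have : (y ^+ 2 %| (2 * r * x + s * y) ^+ 2)%Z by rewrite hz dvdz_mull.
  by rewrite !dvdzE !abszX dvdn_pexp2r.
move=> /dvdzP[k hk]; case: nD; exists k; apply: (mulIf (_ : y ^+ 2 != 0)).
  by rewrite sqrf_eq0.
by rewrite -hz hk exprMn.
Qed.

Lemma nonsquare_bqf_r Q : nonsquare (bqf_disc Q) -> bqf_r Q != 0.
Proof.
move=> h; apply/eqP => r0; have [] := @bqf_anisotropic Q 1 0 h; last by [].
by rewrite /bqf_eval r0; ring.
Qed.

Lemma bqf_indefinite_disc Q : bqf_indefinite Q -> nonsquare (bqf_disc Q) -> 0 < bqf_disc Q.
Proof.
move=> [[x [y h1]] [x' [y' h2]]] /nonsquare_bqf_r; rewrite ltNge => r0; apply/negP => D0.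
have key u v : 0 <= bqf_r Q * bqf_eval Q u v.
  rewrite -(pmulr_rge0 _ (_ : 0 < 4 :> int)) //.
  have -> : 4 * (bqf_r Q * bqf_eval Q u v) =
      (2 * bqf_r Q * u + bqf_s Q * v) ^+ 2 - bqf_disc Q * v ^+ 2.
    by rewrite /bqf_eval /bqf_disc; ring.
  by rewrite subr_ge0 (le_trans _ (sqr_ge0 _)) // mulr_le0_ge0 ?sqr_ge0.
have := key x y; have := key x' y'; rewrite (nmulr_lge0 _ h2) (pmulr_lge0 _ h1) => a b.
by move: r0; rewrite eq_le a b.
Qed.

Lemma reduced_form Q : 0 < bqf_disc Q -> nonsquare (bqf_disc Q) ->
  exists E, [/\ bqf_equiv E Q, `|bqf_s E| <= `|bqf_r E|, `|bqf_r E| <= `|bqf_t E| &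
    bqf_r E * bqf_t E < 0].
Proof.
move=> D0 nD.
have ex : exists n : nat, `[< exists2 E, bqf_equiv E Q & `|bqf_r E|%N = n >].
  by exists `|bqf_r Q|%N; apply/asboolP; exists Q => //; exact: bqf_equiv_refl.
case: (ex_minnP ex) => n /asboolP[E0 hE0 hn] hmin.
have minE E : bqf_equiv E Q -> (n <= `|bqf_r E|)%N by move=> hE; apply: hmin; apply/asboolP; exists E.
have discE E : bqf_equiv E Q -> bqf_disc E = bqf_disc Q by move=> [g hg ->]; rewrite bqf_disc_act.
have r0 : bqf_r E0 != 0 by apply: nonsquare_bqf_r; rewrite discE.
pose sh (k : int) : 'M[int]_2 := \matrix_(i, j) (if i == j then 1 else if i == 0 then 0 else k).
have shE k : [/\ sh k 0 0 = 1, sh k 0 1 = 0, sh k 1 0 = k & sh k 1 1 = 1] by rewrite !mxE.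
have shu k : sh k \in unitmx by apply/unimodP; left; rewrite det_mx22; have [-> -> -> ->] := shE k; ring.
pose sw : 'M[int]_2 := \matrix_(i, j) (if i == j then 0 else 1).
have swE : [/\ sw 0 0 = 0, sw 0 1 = 1, sw 1 0 = 1 & sw 1 1 = 0] by rewrite !mxE.
have swu : sw \in unitmx by apply/unimodP; right; rewrite det_mx22; have [-> -> -> ->] := swE; ring.
have [k hk] : exists k : int, `|bqf_s E0 + 2 * bqf_r E0 * k| <= `|bqf_r E0|.
  move: (bqf_r E0) (bqf_s E0) r0 => r s r0.
  exists (- ((s + `|r|) %/ (2 * r))%Z).
  have := divz_eq (s + `|r|) (2 * r); have := modz_ge0 (s + `|r|) (_ : 2 * r != 0).
  rewrite mulf_neq0 // => /(_ isT); have := ltz_mod (s + `|r|) (_ : 2 * r != 0).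
  rewrite mulf_neq0 // => /(_ isT); move: (_ %% _)%Z (_ %/ _)%Z => m q h1 h2 h3.
  have e1 : s + 2 * r * - q = m - `|r| by move: h3; rewrite [q * _]mulrC; lia.
  by rewrite e1; lia.
pose E := bqf_act (sh k) E0.
have hE : bqf_equiv E Q by apply: bqf_equiv_trans hE0; exact: bqf_equiv_act.
have rE : bqf_r E = bqf_r E0.
  by rewrite /E /bqf_act /bqf_of /bqf_eval /=; have [-> -> -> ->] := shE k; ring.
have sE : bqf_s E = bqf_s E0 + 2 * bqf_r E0 * k.
  by rewrite /E /bqf_act /bqf_of /bqf_eval /=; have [-> -> -> ->] := shE k; ring.
have tn : (n <= `|bqf_t E|)%N.
  have := minE (bqf_act sw E) (bqf_equiv_trans (bqf_equiv_act E swu) hE).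
  by rewrite /bqf_act /bqf_of /bqf_eval /=; have [-> -> -> ->] := swE; rewrite !(mul0r, mul1r, mulr0, mulr1, add0r, addr0, expr0n, expr1n) /=.
have rt : `|bqf_r E| <= `|bqf_t E| by rewrite rE; move: hn tn; lia.
have sr : `|bqf_s E| <= `|bqf_r E| by rewrite sE rE.
exists E; split=> //; rewrite ltNge; apply/negP => h.
have : bqf_disc E <= 0; last by rewrite discE // leNgt D0.
rewrite /bqf_disc -mulrA subr_le0 -(ger0_norm h) normrM -real_normK ?num_real //.
have a0 := normr_ge0 (bqf_s E); have b0 := normr_ge0 (bqf_r E).
apply: (@le_trans _ _ (`|bqf_r E| * `|bqf_r E|)); first by rewrite expr2 ler_pM.
apply: (@le_trans _ _ (`|bqf_r E| * `|bqf_t E|)); first by rewrite ler_wpM2l.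
by rewrite ler_peMl // mulr_ge0.
Qed.

Lemma negative_form Q : 0 < bqf_disc Q -> nonsquare (bqf_disc Q) ->
  exists2 E, bqf_equiv E Q & bqf_r E < 0.
Proof.
move=> D0 nD; have [E [hE _ _ rt]] := reduced_form D0 nD.
have [r0|r0] := ltP (bqf_r E) 0; first by exists E.
pose sw : 'M[int]_2 := \matrix_(i, j) (if i == j then 0 else 1).
have swE : [/\ sw 0 0 = 0, sw 0 1 = 1, sw 1 0 = 1 & sw 1 1 = 0] by rewrite !mxE.
have swu : sw \in unitmx by apply/unimodP; right; rewrite det_mx22; have [-> -> -> ->] := swE; ring.
exists (bqf_act sw E); first exact: bqf_equiv_trans (bqf_equiv_act E swu) hE.
rewrite /bqf_act /bqf_of /bqf_eval /=; have [-> -> -> ->] := swE.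
rewrite !(mul0r, mul1r, mulr0, mulr1, add0r, addr0, expr0n, expr1n) /=.
rewrite ltNge; apply/negP => t0.
by move: rt; rewrite ltNge mulr_ge0.
Qed.

Definition lo Q : R := - (bqf_s Q)%:~R / (2%:R * (bqf_r Q)%:~R) -
  Num.sqrt (bqf_disc Q)%:~R / (2%:R * `|(bqf_r Q)%:~R|).
Definition hi Q : R := - (bqf_s Q)%:~R / (2%:R * (bqf_r Q)%:~R) +
  Num.sqrt (bqf_disc Q)%:~R / (2%:R * `|(bqf_r Q)%:~R|).

Lemma hi_sub_lo Q : hi Q - lo Q = Num.sqrt (bqf_disc Q)%:~R / `|(bqf_r Q)%:~R|.
Proof.
rewrite /hi /lo [2%:R * `|_|]mulrC [(`|_| * _)^-1]invfM; lra.
Qed.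

Section NonSquare.
Variable Q : bqf int.
Hypotheses (D0 : 0 < bqf_disc Q) (nD : nonsquare (bqf_disc Q)).

Let r0 : (bqf_r Q)%:~R != 0 :> R.
Proof. by rewrite intr_eq0 nonsquare_bqf_r. Qed.

Lemma lo_lt_hi : lo Q < hi Q.
Proof. by rewrite -subr_gt0 hi_sub_lo divr_gt0 ?normr_gt0 // sqrtr_gt0 ltr0z. Qed.

Lemma bqf_s_lohi : (bqf_s Q)%:~R = - (bqf_r Q)%:~R * (lo Q + hi Q).
Proof. by rewrite /lo /hi addrCA subrK; field. Qed.

Lemma bqf_t_lohi : (bqf_t Q)%:~R = (bqf_r Q)%:~R * (lo Q * hi Q).
Proof.
have h : Num.sqrt (bqf_disc Q)%:~R ^+ 2 = (bqf_s Q)%:~R ^+ 2 - 4%:R * (bqf_r Q)%:~R * (bqf_t Q)%:~R :> R.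
  by rewrite sqr_sqrtr ?ler0z ?(ltW D0) // /bqf_disc rmorphB rmorphXn !rmorphM.
have h2 : `|(bqf_r Q)%:~R| ^+ 2 = (bqf_r Q)%:~R ^+ 2 :> R by rewrite real_normK ?num_real.
have -> : lo Q * hi Q = ((bqf_s Q)%:~R / (2%:R * (bqf_r Q)%:~R)) ^+ 2 -
    (Num.sqrt (bqf_disc Q)%:~R / (2%:R * `|(bqf_r Q)%:~R|)) ^+ 2 by rewrite /lo /hi; ring.
by rewrite [X in _ - X]exprMn exprVn [(2%:R * `|_|) ^+ 2]exprMn h2 h; field.
Qed.

Lemma bqf_eval_lohi (x y : R) : bqf_eval (bqf_map intr Q) x y =
  (bqf_r Q)%:~R * (x - lo Q * y) * (x - hi Q * y).
Proof. by rewrite /bqf_eval /= bqf_s_lohi bqf_t_lohi; ring. Qed.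

Lemma root_lohi (x : R) : bqf_eval (bqf_map intr Q) x 1 = 0 <-> x = lo Q \/ x = hi Q.
Proof.
rewrite bqf_eval_lohi !mulr1; split=> [/eqP|[->|->]]; rewrite ?subrr ?mulr0 ?mul0r //.
by rewrite !mulf_eq0 (negbTE r0) /= !subr_eq0 => /orP[] /eqP ->; [left | right].
Qed.

Lemma zerosE : zeros Q = [set (lo Q, hi Q)].
Proof.
have lh := lo_lt_hi; apply/seteqP; split=> [[x y] [/= xy /root_lohi hx /root_lohi hy]|_ ->].
  by case: hx hy xy => -> [->|->] //; rewrite ?ltxx // => /(lt_trans lh); rewrite ltxx.
by split=> //=; apply/root_lohi; [left | right].
Qed.

Lemma lohi_irrational (x y : int) (al : R) : al = lo Q \/ al = hi Q ->
  x%:~R + al * y%:~R = 0 -> x = 0 /\ y = 0.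
Proof.
move=> hal h; have [] := @bqf_anisotropic Q (- x) y nD; last first.
  by move/eqP; rewrite oppr_eq0 => /eqP.
apply/eqP; rewrite -(intr_eq0 R); apply/eqP; transitivity (bqf_eval (bqf_map intr Q) (- x%:~R) y%:~R : R).
  by rewrite /bqf_eval /= !(rmorphD, rmorphXn, rmorphM, rmorphN) /=; ring.
have -> : - x%:~R = al * y%:~R :> R by apply/eqP; rewrite eq_sym -addr_eq0 addrC h.
by rewrite bqf_eval_lohi; case: hal => ->; rewrite subrr ?mulr0 ?mul0r.
Qed.

End NonSquare.

Definition geo Q (u : R) : R[i] := geodesic (lo Q) (hi Q) u.

Lemma unimod_irrational Q g (al : R) : 0 < bqf_disc Q -> nonsquare (bqf_disc Q) -> g \in unitmx ->
  al = lo Q \/ al = hi Q -> (g 0 0)%:~R + al * (g 0 1)%:~R != 0.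
Proof.
move=> D0 nD /unimodP hg hal; apply/eqP => h.
have [h1 h2] := lohi_irrational D0 nD hal h.
by case: hg; rewrite det_mx22 h1 h2 !mul0r subrr.
Qed.

Lemma geo_transport Q E g : 0 < bqf_disc Q -> nonsquare (bqf_disc Q) -> g \in unitmx ->
  bqf_flip E = bqf_act g (bqf_flip Q) ->
  exists eps tau : R, (eps = 1 \/ eps = -1) /\
    forall u, moebius (anti_mx g) (geo Q u) = geo E (eps * u + tau).
Proof.
move=> D0 nD hg hE.
have dE : bqf_disc E = bqf_disc Q by rewrite -bqf_disc_flip hE bqf_disc_act // bqf_disc_flip.
have D0' : 0 < bqf_disc E by rewrite dE.
have nD' : nonsquare (bqf_disc E) by rewrite dE.
have lh := lo_lt_hi D0 nD; have lh' := lo_lt_hi D0' nD'.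
have p0 := unimod_irrational D0 nD hg (or_introl erefl).
have q0 := unimod_irrational D0 nD hg (or_intror erefl).
set p := _ + _ in p0; set q := _ + _ in q0.
set p' := (g 1 0)%:~R + lo Q * (g 1 1)%:~R; set q' := (g 1 0)%:~R + hi Q * (g 1 1)%:~R.
have re : (bqf_r E)%:~R = (bqf_r Q)%:~R * p * q.
  have -> : bqf_r E = bqf_r (bqf_flip E) by [].
  rewrite hE /= /bqf_eval /= !(rmorphD, rmorphM, rmorphXn, rmorphN) /=.
  by rewrite (bqf_s_lohi nD) (bqf_t_lohi D0 nD) /p /q; ring.
have se : (bqf_s E)%:~R = - ((bqf_r Q)%:~R * (p * q' + p' * q)).
  have -> : bqf_s E = - bqf_s (bqf_flip E) by rewrite opprK.
  rewrite hE; transitivity (- (2%:R * (bqf_r Q)%:~R * (g 0 0)%:~R * (g 1 0)%:~R -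
      (bqf_s Q)%:~R * ((g 0 0)%:~R * (g 1 1)%:~R + (g 0 1)%:~R * (g 1 0)%:~R) +
      2%:R * (bqf_t Q)%:~R * (g 0 1)%:~R * (g 1 1)%:~R) : R).
    by rewrite /= /bqf_eval /=; ring.
  by rewrite (bqf_s_lohi nD) (bqf_t_lohi D0 nD) /p /q /p' /q'; ring.
have te : (bqf_t E)%:~R = (bqf_r Q)%:~R * p' * q'.
  have -> : bqf_t E = bqf_t (bqf_flip E) by [].
  rewrite hE /= /bqf_eval /= !(rmorphD, rmorphM, rmorphXn, rmorphN) /=.
  by rewrite (bqf_s_lohi nD) (bqf_t_lohi D0 nD) /p' /q'; ring.
have r1 : p' / p = lo E \/ p' / p = hi E.
  by apply/(root_lohi D0' nD'); rewrite /bqf_eval /= re se te; field.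
have r2 : q' / q = lo E \/ q' / q = hi E.
  by apply/(root_lohi D0' nD'); rewrite /bqf_eval /= re se te; field.
have ne : p' / p != q' / q.
  apply/eqP => /(congr1 (fun x => x * p * q)); rewrite divfK // mulrAC divfK // => h.
  have : (\det g)%:~R * (hi Q - lo Q) = 0.
    rewrite det_mx22 rmorphB !rmorphM /= -[RHS](subrr (p' * q)) {1}h /p /p' /q /q'; ring.
  move/eqP; rewrite mulf_eq0 intr_eq0 subr_eq0 [_ == lo Q]gt_eqF // orbF.
  by move/unimodP: hg => [] ->.
have hpq : (p' / p = lo E /\ q' / q = hi E) \/ (p' / p = hi E /\ q' / q = lo E).
  by case: r1 r2 ne => -> [->|->]; rewrite ?eqxx //; [left | right].
have [tau [h|h]] := @geodesic_transport R (lo Q) (hi Q) g (lo E) (hi E) hg lh lh' p0 q0 hpq.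
- by exists 1, tau; split; [left | move=> u; rewrite mul1r; apply: h].
- by exists (-1), tau; split; [right | move=> u; rewrite mulN1r addrC; apply: h].
Qed.

End IndefiniteForms.

Section ApolarForms.
Variable Q0 : bqf int.
Hypotheses (r0 : bqf_r Q0 != 0) (prim : bqf_primitive Q0).

Definition apolar_to (C : int * int * int * int) : Prop :=
  apolar (bqf_r Q0) (bqf_s Q0) (bqf_t Q0) C.

Lemma apolar_hess C : apolar_to C -> exists n : int, hess C = bqf_scale n Q0.
Proof.
case: C => [] [] [] a b c d [h1 h2].
set r := bqf_r Q0 in h1 h2; set s := bqf_s Q0 in h1 h2; set t := bqf_t Q0 in h1 h2.
set P := b ^+ 2 - 3 * a * c.
have e1 : r * (b * c - 9 * a * d) = s * P.
  apply/eqP; rewrite -subr_eq0; apply/eqP; rewrite /P.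
  transitivity (b * (3 * t * a - s * b + r * c) - 3 * a * (t * b - s * c + 3 * r * d)); first by ring.
  by rewrite h1 h2; ring.
have e2 : r * (c ^+ 2 - 3 * b * d) = t * P.
  apply/eqP; rewrite -subr_eq0; apply/eqP; rewrite /P.
  transitivity (c * (3 * t * a - s * b + r * c) - b * (t * b - s * c + 3 * r * d)); first by ring.
  by rewrite h1 h2; ring.
have [u [v uv]] := Bezoutz r s; have [u' [v' uv']] := Bezoutz (gcdz r s) t.
have {uv'} uv1 : u' * (u * r + v * s) + v' * t = 1 by rewrite uv uv'; exact: prim.
pose n := u' * u * P + u' * v * (b * c - 9 * a * d) + v' * (c ^+ 2 - 3 * b * d).
have hn : P = n * r.
  transitivity ((u' * (u * r + v * s) + v' * t) * P); first by rewrite uv1 mul1r.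
  transitivity (u' * u * P * r + u' * v * (s * P) + v' * (t * P)); first by ring.
  by rewrite -e1 -e2 /n; ring.
exists n; apply: bqf_eq => /=; first by [].
  by apply: (mulfI r0); rewrite e1 hn; ring.
by apply: (mulfI r0); rewrite e2 hn; ring.
Qed.

Lemma hess_apolar C n : n != 0 -> hess C = bqf_scale n Q0 -> apolar_to C.
Proof.
case: C => [] [] [] a b c d n0; rewrite /apolar_to; case: Q0 => r s t /= [h1 h2 h3].
by split; apply: (mulfI n0); rewrite mulr0; [
  transitivity (3 * (n * t) * a - (n * s) * b + (n * r) * c); [ring | rewrite -h1 -h2 -h3; ring] |
  transitivity ((n * t) * b - (n * s) * c + 3 * (n * r) * d); [ring | rewrite -h1 -h2 -h3; ring]].
Qed.

Lemma apolar_inj a b c d c' d' : apolar_to (a, b, c, d) -> apolar_to (a, b, c', d') ->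
  (c, d) = (c', d').
Proof.
rewrite /apolar_to /apolar; move=> [h1 h2] [h3 h4].
have ec : c = c' by apply: (mulfI r0); move: h1 h3; lia.
by rewrite -ec in h4 *; congr pair; apply: (mulfI r0); move: h2 h4; lia.
Qed.

Lemma apolar_param : exists e f h : int, exists cub : nat * int -> int * int * int * int,
  [/\ 0 < e, 0 < h,
    (forall v, apolar_to (cub v) /\ ((cub v).1.1.1 = e * v.1%:Z /\ (cub v).1.1.2 = f * v.1%:Z + h * v.2)) &
    (forall C, apolar_to C -> 0 < C.1.1.1 -> exists2 v, (0 < v.1)%N & C = cub v)].
Proof.
pose P a b := exists c d, apolar_to (a, b, c, d).
have [e [f [h [e0 h0 hP]]]] : exists e f h : int, [/\ 0 < e, 0 < h &
    forall a b, P a b <-> exists i j, a = e * i /\ b = f * i + h * j].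
  apply: (@subgroup_basis P (3 * bqf_r Q0 ^+ 2)).
  - by rewrite mulr_gt0 // exprn_even_gt0.
  - move=> a b a' b' [c [d [h1 h2]]] [c' [d' [h3 h4]]]; exists (c - c'), (d - d').
    by split; [rewrite -[RHS](subrr 0) -{1}h1 -h3 | rewrite -[RHS](subrr 0) -{1}h2 -h4]; ring.
  - exists (- 9 * bqf_t Q0 * bqf_r Q0), (- 3 * bqf_s Q0 * bqf_t Q0).
    by split; ring.
  - by exists (3 * bqf_r Q0 * bqf_s Q0), (bqf_s Q0 ^+ 2 - bqf_r Q0 * bqf_t Q0); split; ring.
have F (v : nat * int) : {cd : int * int | apolar_to (e * v.1%:Z, f * v.1%:Z + h * v.2, cd.1, cd.2)}.
  apply: cid; have [c [d hcd]] : P (e * v.1%:Z) (f * v.1%:Z + h * v.2) by apply/hP; exists v.1%:Z, v.2.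
  by exists (c, d).
exists e, f, h, (fun v => (e * v.1%:Z, f * v.1%:Z + h * v.2, (sval (F v)).1, (sval (F v)).2)).
split=> //; first by move=> v; split=> //; exact: (svalP (F v)).
case=> [] [] [] a b c d hC /= a0.
have [i [j [ea eb]]] : exists i j, a = e * i /\ b = f * i + h * j by apply/hP; exists c, d.
have i0 : 0 < i by move: a0; rewrite ea pmulr_rgt0.
have ei : i = (`|i|%N)%:Z by rewrite gez0_abs // ltW.
exists (`|i|%N, j); first by rewrite /= absz_gt0 gt_eqF.
case: (F (`|i|%N, j)) => [[c' d'] hF]; rewrite /= -ei -ea -eb in hF *.
by have [-> ->] := apolar_inj hC hF.
Qed.

End ApolarForms.

Lemma cub_inj (e f h : int) (cub : nat * int -> int * int * int * int) : 0 < e -> 0 < h ->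
  (forall v, (cub v).1.1.1 = e * v.1%:Z /\ (cub v).1.1.2 = f * v.1%:Z + h * v.2) -> injective cub.
Proof.
move=> e0 h0 cubP [i j] [i' j'] eC.
have [/= h1 h2] := cubP (i, j); have [/= h3 h4] := cubP (i', j').
have e1 : i = i'.
  by apply/eqP; rewrite -eqz_nat; apply/eqP/(mulfI (lt0r_neq0 e0)); rewrite -h1 -h3 eC.
congr pair => //; apply: (mulfI (lt0r_neq0 h0)); apply: (@addrI _ (f * i%:Z)).
by rewrite -h2 eC h4 e1.
Qed.

Section CubicParameters.
Variables (R : realType) (Q0 : bqf int).
Hypotheses (r_lt0 : bqf_r Q0 < 0) (D0 : 0 < bqf_disc Q0) (nD : nonsquare (bqf_disc Q0)).
Hypothesis prim : bqf_primitive Q0.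
Variables (e f h : int) (cub : nat * int -> int * int * int * int).
Hypotheses (e0 : 0 < e) (h0 : 0 < h).
Hypothesis cubP : forall v, apolar_to Q0 (cub v) /\
  ((cub v).1.1.1 = e * v.1%:Z /\ (cub v).1.1.2 = f * v.1%:Z + h * v.2).

(* The Hessian of (a, b, c, d) is n Q0 with n = (b + 3 lo a) (b + 3 hi a) / r; for the form
   of index v = (i, j) the factors are h (j - slope_hi i) and h (j - slope_lo i). *)
Definition slope_lo : R := - (f%:~R + 3%:R * hi R Q0 * e%:~R) / h%:~R.
Definition slope_hi : R := - (f%:~R + 3%:R * lo R Q0 * e%:~R) / h%:~R.
Definition norm_coef : R := h%:~R ^+ 2 / - (bqf_r Q0)%:~R.

Let h0' : 0 < h%:~R :> R. Proof. by rewrite ltr0z. Qed.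
Let r0' : (bqf_r Q0)%:~R < 0 :> R. Proof. by rewrite ltrz0. Qed.
Let lh := @lo_lt_hi R Q0 D0 nD.

Lemma slope_lt : slope_lo < slope_hi.
Proof.
rewrite /slope_lo /slope_hi ltr_pM2r ?invr_gt0 // ltrN2 ltrD2l ltr_pM2r ?ltr0z // ltr_pM2l //.
Qed.

Lemma norm_coef_gt0 : 0 < norm_coef.
Proof. by rewrite divr_gt0 ?exprn_gt0 // oppr_gt0. Qed.

Let cub_lo (v : nat * int) : (cub v).1.1.2%:~R + 3%:R * hi R Q0 * (cub v).1.1.1%:~R =
  h%:~R * (v.2%:~R - slope_lo * v.1%:R).
Proof.
have [_ [-> ->]] := cubP v; rewrite rmorphD !rmorphM /= /slope_lo; field.
by rewrite gt_eqF.
Qed.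

Let cub_hi (v : nat * int) : (cub v).1.1.2%:~R + 3%:R * lo R Q0 * (cub v).1.1.1%:~R =
  h%:~R * (v.2%:~R - slope_hi * v.1%:R).
Proof.
have [_ [-> ->]] := cubP v; rewrite rmorphD !rmorphM /= /slope_hi; field.
by rewrite gt_eqF.
Qed.

Lemma cub_norm v n : hess (cub v) = bqf_scale n Q0 ->
  hyp_norm slope_lo slope_hi norm_coef v = n%:~R.
Proof.
move=> hn; have [hC _] := cubP v; have := cub_lo v; have := cub_hi v.
move: hC hn; case: (cub v) => [] [] [] a b c d [h1 _] hh /= e1 e2.
have hP : n * bqf_r Q0 = b ^+ 2 - 3 * a * c by case: hh.
apply: (mulIf (ltr0_neq0 r0')); transitivity ((b ^+ 2 - 3 * a * c)%:~R : R); last first.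
  by rewrite -hP rmorphM.
have e3 : (bqf_r Q0)%:~R * (b ^+ 2 - 3 * a * c)%:~R = (bqf_r Q0)%:~R * ((b%:~R + 3%:R * lo R Q0 * a%:~R) * (b%:~R + 3%:R * hi R Q0 * a%:~R)) :> R.
  transitivity ((bqf_r Q0)%:~R * b%:~R ^+ 2 - 3%:R * a%:~R * ((bqf_s Q0)%:~R * b%:~R - 3%:R * (bqf_t Q0)%:~R * a%:~R) : R).
    have hc : bqf_s Q0 * b - 3 * bqf_t Q0 * a = bqf_r Q0 * c by move: h1; lia.
    have -> : (bqf_s Q0)%:~R * b%:~R - 3%:R * (bqf_t Q0)%:~R * a%:~R = (bqf_r Q0 * c)%:~R :> R.
      by rewrite -hc rmorphB !rmorphM.
    by rewrite !(rmorphB, rmorphXn, rmorphM) /=; ring.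
  by rewrite (bqf_s_lohi R nD) (bqf_t_lohi R D0 nD); ring.
rewrite (mulfI (ltr0_neq0 r0') e3) e1 e2 /hyp_norm /norm_coef; field.
by rewrite lt_eqF // oppr_cp0 .
Qed.

Lemma cub_hyp_in v n N : hess (cub v) = bqf_scale n Q0 -> (0 < v.1)%N -> 0 < n -> n%:~R < N ->
  hyp_in slope_lo slope_hi norm_coef N v.
Proof.
move=> hn v0 n0 nN; have e1 := cub_norm hn.
have n1 : 0 < hyp_norm slope_lo slope_hi norm_coef v by rewrite e1 ltr0z.
split=> //; last by rewrite e1.
have v1 : 0 < v.1%:R :> R by rewrite ltr0n.
have pq : slope_lo * v.1%:R < slope_hi * v.1%:R by rewrite ltr_pM2r ?slope_lt.
move: n1; rewrite /hyp_norm -mulrA pmulr_rgt0 ?norm_coef_gt0 //.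
have [h1|h1] := ltP (slope_lo * v.1%:R) v.2%:~R.
  by rewrite pmulr_rgt0 ?subr_gt0.
by rewrite ltNge mulr_le0_ge0 // ?subr_le0 ?subr_ge0 // (le_trans h1) // ltW.
Qed.

Lemma cub_hess v N : hyp_in slope_lo slope_hi norm_coef N v -> exists n : int,
  [/\ 0 < n, n%:~R < N & hess (cub v) = bqf_scale n Q0].
Proof.
move=> [v0 /andP[h1 h2] hN]; have [hC _] := cubP v.
have [n hn] := apolar_hess (ltr0_neq0 r_lt0) prim hC; exists n; rewrite -(cub_norm hn); split=> //.
by rewrite -(ltr0z R) -(cub_norm hn); apply: mulr_gt0; [apply: mulr_gt0; [exact: norm_coef_gt0 | ] | ]; rewrite subr_gt0.
Qed.

Lemma cub_coords v N : hyp_in slope_lo slope_hi norm_coef N v -> exists k1 k2 : R,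
  [/\ 0 < k1, 0 < k2, cubic_coords (lo R Q0) (hi R Q0) k1 k2 (cub v) &
      ln (k2 / k1) = hyp_arg slope_lo slope_hi v].
Proof.
move=> [v0 /andP[h1 h2] _].
pose xi1 := h%:~R * (v.2%:~R - slope_lo * v.1%:R) / (3%:R * (hi R Q0 - lo R Q0)).
pose xi2 := h%:~R * (slope_hi * v.1%:R - v.2%:~R) / (3%:R * (hi R Q0 - lo R Q0)).
have lh0 : 0 < hi R Q0 - lo R Q0 by rewrite subr_gt0.
have x1 : 0 < xi1 by rewrite divr_gt0 ?mulr_gt0 ?subr_gt0.
have x2 : 0 < xi2 by rewrite divr_gt0 ?mulr_gt0 ?subr_gt0.
have cube (x : R) : 0 < x -> expR (ln x / 3%:R) ^+ 3 = x.
  by move=> x0; rewrite -expRM_natl mulrC divfK ?pnatr_eq0 // lnK.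
exists (expR (ln xi1 / 3%:R)), (expR (ln xi2 / 3%:R)); split; rewrite ?expR_gt0 //.
  rewrite /cubic_coords; have [hC _] := cubP v; have := cub_lo v; have := cub_hi v.
  move: hC; case: (cub v) => [] [] [] a b c d [h3 h4] /= e1 e2; rewrite !cube //.
  have d0 : hi R Q0 - lo R Q0 != 0 by rewrite gt_eqF.
  have e3 : xi1 = (b%:~R + 3%:R * hi R Q0 * a%:~R) / (3%:R * (hi R Q0 - lo R Q0)).
    by rewrite e2.
  have e4 : xi2 = - (b%:~R + 3%:R * lo R Q0 * a%:~R) / (3%:R * (hi R Q0 - lo R Q0)).
    by rewrite e1 /xi2; ring.
  have r1 : (bqf_r Q0)%:~R != 0 :> R by rewrite lt_eqF.
  have ec : c%:~R = - (lo R Q0 + hi R Q0) * b%:~R - 3%:R * lo R Q0 * hi R Q0 * a%:~R.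
    have hc : bqf_r Q0 * c = bqf_s Q0 * b - 3 * bqf_t Q0 * a by clear -h3; lia.
    apply: (mulfI r1); transitivity ((bqf_r Q0 * c)%:~R : R); first by rewrite rmorphM.
    by rewrite hc rmorphB !rmorphM /= (bqf_s_lohi R nD) (bqf_t_lohi R D0 nD); ring.
  have ed : 3%:R * d%:~R = - (lo R Q0 + hi R Q0) * c%:~R - lo R Q0 * hi R Q0 * b%:~R.
    have hd : bqf_r Q0 * (3 * d) = bqf_s Q0 * c - bqf_t Q0 * b by clear -h4; lia.
    apply: (mulfI r1); transitivity ((bqf_r Q0 * (3 * d))%:~R : R); first by rewrite !rmorphM.
    by rewrite hd rmorphB !rmorphM /= (bqf_s_lohi R nD) (bqf_t_lohi R D0 nD); ring.
  have ed' : d%:~R = (- (lo R Q0 + hi R Q0) * c%:~R - lo R Q0 * hi R Q0 * b%:~R) / 3%:R.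
    by rewrite -ed; field.
  by split; rewrite ?ed' ?ec e3 e4; field.
rewrite -expRB -mulrBl expRK /hyp_arg; congr (_ / _).
rewrite -ln_div ?posrE //; congr ln; rewrite /xi1 /xi2; field.
by rewrite ?gt_eqF // ?subr_gt0.
Qed.

Lemma reducible_sparse (K eps : R) : 0 < eps -> \forall N \near +oo,
  (count (fun v => `[< exists p q : int, coprimez p q /\ cubic_root (cub v) p q >])
     (hyp_box slope_lo slope_hi norm_coef K N))%:R <= eps * N.
Proof.
pose D := bqf_s Q0 ^+ 2 - 4 * bqf_r Q0 * bqf_t Q0.
pose k : int := 4 * (D ^+ 2 * (3 * bqf_r Q0 ^+ 2) ^+ 5).
have r0 := ltr0_neq0 r_lt0.
have DE : 0 < D by rewrite /D; exact: D0.
have k0 : 0 < k.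
  by rewrite /k mulr_gt0 // mulr_gt0 ?exprn_gt0 // mulr_gt0 // exprn_even_gt0.
have cE v : exists a b c d, cub v = (a, b, c, d) by case: (cub v) => [] [] [] a b c d; exists a, b, c, d.
apply: (@sparse_count R slope_lo slope_hi norm_coef K slope_lt norm_coef_gt0 _
  (fun v zw => exists p, [/\ zw.1 = 2 * bqf_r Q0 * p + bqf_s Q0 * zw.2, coprimez p zw.2, zw.2 != 0 & cubic_root (cub v) p zw.2])
  (k * e)%:~R).
- by rewrite ltr0z mulr_gt0.
- move=> v v0 [p [q [cpq hr]]]; have [hC [ha _]] := cubP v; have [a [b [c [d hcub]]]] := cE v.
  have a0 : 0 < a.
    by move: ha; rewrite hcub /= => ->; rewrite mulr_gt0 //; case: (v.1) v0.
  rewrite hcub in hr hC ha; have [q0 b1 b2] := apolar_root_bound r0 DE a0 cpq hC hr.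
  rewrite /= in ha; rewrite -/D -/k ha mulrA in b1 b2.
  exists (2 * bqf_r Q0 * p + bqf_s Q0 * q, q); first by exists p; rewrite hcub.
  have -> : v.1%:R = (v.1%:Z)%:~R :> R by rewrite -pmulrn.
  by rewrite /= -rmorphM -intr_norm -!rmorphXn !ler_int.
- move=> i j j' [z w] i0 [p [/= ez cpw w0 hr]] [p' [/= ez' cpw' _ hr']].
  have ep : p' = p.
    apply: (mulfI r0); apply: (mulfI (_ : 2 != 0 :> int)) => //.
    by move: ez ez'; lia.
  rewrite {}ep in cpw' hr'; have [hC [ha hb]] := cubP (i, j); have [hC' [ha' hb']] := cubP (i, j').
  have [a [b [c [d hcub]]]] := cE (i, j); have [a' [b' [c' [d' hcub']]]] := cE (i, j').
  rewrite hcub /= in hC ha hb hr; rewrite hcub' /= in hC' ha' hb' hr'.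
  have h1 := apolar_root r0 hC hr; have h2 := apolar_root r0 hC' hr'.
  have B0 : w * (3 * bqf_r Q0 ^+ 2 * p ^+ 2 + 3 * bqf_r Q0 * bqf_s Q0 * p * w + (bqf_s Q0 ^+ 2 - bqf_r Q0 * bqf_t Q0) * w ^+ 2) != 0.
    rewrite mulf_neq0 //; apply/eqP => hB.
    have : 3 * (2 * bqf_r Q0 * p + bqf_s Q0 * w) ^+ 2 + D * w ^+ 2 = 0.
      by rewrite -[RHS](mulr0 4) -hB /D; ring.
    have h3 : 0 < D * w ^+ 2 by rewrite mulr_gt0 // exprn_even_gt0.
    have h4 := sqr_ge0 (2 * bqf_r Q0 * p + bqf_s Q0 * w).
    have h5 : 0 < 3 * (2 * bqf_r Q0 * p + bqf_s Q0 * w) ^+ 2 + D * w ^+ 2.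
      by apply: ltr_wpDl => //; rewrite mulr_ge0.
    by move=> h6; rewrite h6 in h5.
  have eb : b = b'.
    by apply: oppr_inj; apply: (mulIf B0); rewrite -h1 -h2 ha ha'.
  by apply: (mulfI (lt0r_neq0 h0)); move: hb; rewrite eb hb' => /addrI.
Qed.

End CubicParameters.

(** * Counting isomorphism classes *)

Section MeetsClasses.
Variables (T : Type) (E : T -> T -> Prop) (P : T -> Prop).
Hypotheses (Esym : forall x y, E x y -> E y x) (Etrans : forall x y z, E x y -> E y z -> E x z).
Variable J : eqType.
Variable c : J -> T -> Prop.

Lemma meets_classes_exists (codes : seq J) :
  (forall i x y, c i x -> c i y -> E x y) ->
  (forall x, P x -> exists2 i, i \in codes & c i x) -> exists n, meets_classes E P n.
Proof.
move=> cE; elim: codes P => [|i codes ih] P' hP.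
  exists 0%N, (fun i : 'I_0 => match i with Ordinal _ H => False_rect T (notF H) end).
  by split=> [[]|[]|x /hP[]].
have [n [f [fP fE fS]]] := ih (fun x => P' x /\ exists2 i, i \in codes & c i x) (fun x h => proj2 h).
have [[x0 [Px0 cx0 nx0]]|h] := pselect (exists x0, [/\ P' x0, c i x0 & forall j, ~ E (f j) x0]).
  exists n.+1, (fun j => if unlift ord_max j is Some k then f k else x0); split.
  - by move=> j; case: unliftP => [k _|_] //; have [] := fP k.
  - move=> j k; case: unliftP => [j' ->|->]; case: unliftP => [k' ->|->] // h.
    + by rewrite (fE _ _ h).
    + by case: (nx0 j').
    + by case: (nx0 k'); apply: Esym.
  - move=> x Px; have [i' + ci] := hP x Px; rewrite inE => /orP[/eqP ei|hi].
      by exists ord_max; rewrite unlift_none; rewrite ei in ci; exact: cE ci.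
    have [j hj] : exists j, E (f j) x by apply: fS; split=> //; exists i'.
    by exists (lift ord_max j); rewrite liftK.
exists n, f; split=> // [j|x Px]; first by have [] := fP j.
have [i' + ci] := hP x Px; rewrite inE => /orP[/eqP ei|hi]; last by apply: fS; split=> //; exists i'.
have [//|nex] := pselect (exists j, E (f j) x); case: h; exists x.
by split=> // [|j hj]; [rewrite -ei | apply: nex; exists j].
Qed.

Lemma meets_classes_le (codes : seq J) (n : nat) :
  (forall i x y, c i x -> c i y -> E x y) ->
  (forall x, P x -> exists2 i, i \in codes & c i x) -> meets_classes E P n -> (n <= size codes)%N.
Proof.
move=> cE hP [f [fP fE _]].
have F i : {j : J | j \in codes /\ c j (f i)} by apply: cid; have [j] := hP _ (fP i); exists j.
rewrite -(card_ord n) cardE -(size_map (fun i => sval (F i))); apply: uniq_leq_size.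
  rewrite map_inj_uniq ?enum_uniq // => i j eij; apply: fE.
  have [_ h1] := svalP (F i); have [_ h2] := svalP (F j).
  by rewrite eij in h1; exact: cE h1 h2.
by move=> _ /mapP[i _ ->]; have [] := svalP (F i).
Qed.

Lemma meets_classes_ge (D : seq J) (n : nat) : uniq D ->
  (forall j, j \in D -> exists2 x, P x & c j x) ->
  (forall j k x y, j \in D -> k \in D -> c j x -> c k y -> E x y -> j = k) ->
  meets_classes E P n -> (size D <= n)%N.
Proof.
move=> uD hD cD [f [_ _ fS]].
have F j : {i : 'I_n | j \in D -> exists x, c j x /\ E (f i) x} + (j \notin D).
  have [jD|jD] := boolP (j \in D); last by right.
  left; apply: cid; have [x Px cx] := hD j jD; have [i hi] := fS x Px.
  by exists i => _; exists x.
have [n0|n0] := posnP n.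
  case: D uD hD {cD F} => [|j D'] // _ /(_ j (mem_head _ _)) [x Px _].
  by have [[i hi] _] := fS x Px; rewrite n0 in hi.
pose g j := if F j is inl i then sval i else Ordinal n0.
rewrite -(size_map g) -[leqRHS](card_ord n) cardE; apply: uniq_leq_size; last first.
  by move=> i _; rewrite mem_enum.
rewrite map_inj_in_uniq // => j k jD kD; rewrite /g.
case: (F j) => [[i hi]|]; last by rewrite jD.
case: (F k) => [[i' hi']|]; last by rewrite kD.
move=> /= eii; have [x [cx Ex]] := hi jD; have [y [cy Ey]] := hi' kD; subst i'.
by apply: (cD j k x y) => //; apply: Etrans Ey; exact: Esym.
Qed.

End MeetsClasses.

Lemma bqf_flip_scale k Q : bqf_flip (bqf_scale k Q) = bqf_scale k (bqf_flip Q).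
Proof. by apply: bqf_eq => //=; rewrite mulrN. Qed.

Lemma bqf_scale_dvd (m k : int) (G F : bqf int) : bqf_primitive F ->
  bqf_scale m G = bqf_scale k F -> (m %| k)%Z.
Proof.
move=> pF [hr hs ht]; have [u [v uv]] := Bezoutz (bqf_r F) (bqf_s F).
have [u' [v' uv']] := Bezoutz (gcdz (bqf_r F) (bqf_s F)) (bqf_t F).
have h : u' * (u * bqf_r F + v * bqf_s F) + v' * bqf_t F = 1 by rewrite uv uv'; exact: pF.
apply/dvdzP; exists (u' * u * bqf_r G + u' * v * bqf_s G + v' * bqf_t G).
transitivity (k * (u' * (u * bqf_r F + v * bqf_s F) + v' * bqf_t F)); first by rewrite h mulr1.
transitivity (u' * u * (k * bqf_r F) + u' * v * (k * bqf_s F) + v' * (k * bqf_t F)); first by ring.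
by rewrite -hr -hs -ht; ring.
Qed.

Lemma bqf_reduceE (Q : bqf int) : bqf_disc (bqf_reduce Q) != 0 ->
  0 < bqf_content Q /\ Q = bqf_scale (bqf_content Q) (bqf_reduce Q).
Proof.
move=> dQ; have [d0|] := eqVneq (bqf_disc Q) 0; last exact: bqf_scale_reduce.
have c0 : 0 < bqf_content Q.
  rewrite lt_neqAle eq_sym; apply/andP; split; last by [].
  by apply: contra dQ => /eqP c0; rewrite /bqf_disc /= c0 !divz0 mulr0 expr0n.
have dr : (bqf_content Q %| bqf_r Q)%Z by apply: dvdz_trans (dvdz_gcdl _ _) (dvdz_gcdl _ _).
have ds : (bqf_content Q %| bqf_s Q)%Z by apply: dvdz_trans (dvdz_gcdl _ _) (dvdz_gcdr _ _).
have dt : (bqf_content Q %| bqf_t Q)%Z by apply: dvdz_gcdr.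
by split=> //; apply: bqf_eq => /=; rewrite mulrC divzK.
Qed.

Lemma moebiusN (R : realType) (g : 'M[int]_2) (z : R[i]) : moebius (- g) z = moebius g z.
Proof.
rewrite /moebius !det_mx22 !mxE !mulrNN !rmorphN !mulNr -!opprD invrN mulrN mulNr opprK.
by [].
Qed.

Lemma unimodN (g : 'M[int]_2) : (- g \in unitmx) = (g \in unitmx).
Proof. by rewrite !unitmxE !det_mx22 !mxE !mulrNN. Qed.

Lemma base_change_uniq (K : fieldExtType rat) (w1 w2 a1 a2 : K) g h m1 m2 n1 n2 :
  basis_of fullv [:: 1; w1; w2] ->
  base_change g m1 m2 w1 w2 a1 a2 -> base_change h n1 n2 w1 w2 a1 a2 -> g = h.
Proof.
move=> hb [h1 h2] [h3 h4].
have [_ e1 e2] := free3_int hb (etrans (esym h1) h3).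
have [_ e3 e4] := free3_int hb (etrans (esym h2) h4).
exact: mx2P.
Qed.

Lemma rebase (K : fieldExtType rat) (A : set K) (w1 w2 : K) C (F F' : bqf int) g n :
  is_order A -> is_zbasis A [:: 1; w1; w2] -> int_table w1 w2 C ->
  bqf_flip (hess C) = bqf_scale n F -> g \in unitmx -> F' = bqf_act g F ->
  exists (v1 v2 : K) (C' : int * int * int * int) (e : 'M[int]_2) (n1 n2 : int),
    [/\ is_zbasis A [:: 1; v1; v2], int_table v1 v2 C',
        bqf_flip (hess C') = bqf_scale n F', 0 < C'.1.1.1 &
        base_change e n1 n2 w1 w2 v1 v2 /\ (e = g \/ e = - g)].
Proof.
move=> ordA bw tw hF gu eF'.
have bu := zbasis_change gu bw; set u1 := _ + _ in bu; set u2 := _ + _ in bu.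
have [n1 [n2 [C' tu]]] := normalize ordA bu; have bv := zbasis_shift n1 n2 bu.
have hb := proj1 (proj1 (is_zbasis3P A w1 w2) bw).
have hv := proj1 (proj1 (is_zbasis3P A _ _) bv).
have bc : base_change g n1 n2 w1 w2 (u1 + n1%:~R) (u2 + n2%:~R).
  by split; rewrite /u1 /u2; ring.
have hC' : bqf_flip (hess C') = bqf_scale n F'.
  by rewrite (hess_change hb tw hv tu bc) hF bqf_act_scale eF'.
case: C' tu hC' => [] [] [] a b c d tu hC'.
have a0 := table_a_neq0 hv tu.
have [a_gt0|a_le0] := ltP 0 a.
  by exists (u1 + n1%:~R), (u2 + n2%:~R), (a, b, c, d), g, n1, n2; split=> //; split=> //; left.
have mu : (- 1%:M : 'M[int]_2) \in unitmx.
  by apply/unimodP; left; rewrite det_mx22 !mxE /=; ring.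
have bm := zbasis_change mu bv; rewrite !mxE /= in bm.
have e1 x y : (- 1)%:~R * x + (- 0)%:~R * y = - x :> K by ring.
have e2 x y : (- 0)%:~R * x + (- 1)%:~R * y = - y :> K by ring.
rewrite ?e1 ?e2 in bm.
exists (- (u1 + n1%:~R)), (- (u2 + n2%:~R)), (- a, - b, - c, - d), (- g), (- n1), (- n2).
split=> //.
- exact: (table_neg tu).
- by rewrite -hC'; apply: bqf_eq => /=; ring.
- by rewrite /= oppr_gt0 lt_neqAle a0.
- by split; [have [h1 h2] := bc; split; rewrite ?h1 ?h2 !mxE; ring | right].
Qed.

Section OrderCodes.
Variables (R : realType) (Q Q0 : bqf int).
Hypotheses (r_lt0 : bqf_r Q0 < 0) (D0 : 0 < bqf_disc Q0) (nD : nonsquare (bqf_disc Q0)).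
Hypotheses (prim : bqf_primitive Q0) (hQ : bqf_equiv Q0 Q).
Variables (e f h : int) (cub : nat * int -> int * int * int * int).
Hypotheses (e0 : 0 < e) (h0 : 0 < h).
Hypothesis cubP : forall v, apolar_to Q0 (cub v) /\
  ((cub v).1.1.1 = e * v.1%:Z /\ (cub v).1.1.2 = f * v.1%:Z + h * v.2).
Hypothesis cub_surj : forall C, apolar_to Q0 C -> 0 < C.1.1.1 -> exists2 v, (0 < v.1)%N & C = cub v.

Definition bqf_mk (x : int * int * int) : bqf int := BQF x.1.1 x.1.2 x.2.

Variables (Es : seq (int * int * int)) (mx : int * int * int -> 'M[int]_2)
  (eps tau : int * int * int -> R).
Hypothesis EsP : forall x, x \in Es ->
  [/\ bqf_equiv (bqf_mk x) Q, mx x \in unitmx, bqf_flip (bqf_mk x) = bqf_act (mx x) (bqf_flip Q0) &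
    forall u, moebius (anti_mx (mx x)) (geo Q0 u) = geo (bqf_mk x) (eps x * u + tau x)].
Hypothesis Es_all : forall x, bqf_equiv (bqf_mk x) Q ->
  (exists u : R, gauss_domain (geo (bqf_mk x) u)) -> x \in Es.

Local Notation hin := (hyp_in (slope_lo R Q0 e f h) (slope_hi R Q0 e f h) (norm_coef R Q0 h)).
Local Notation harg := (hyp_arg (slope_lo R Q0 e f h) (slope_hi R Q0 e f h)).

Lemma geo_Im_gt0 E (u : R) : 0 < bqf_disc E -> nonsquare (bqf_disc E) -> 0 < complex.Im (geo E u).
Proof.
move=> DE nE; rewrite /geo geodesicE /= divr_gt0 ?mulr_gt0 ?expR_gt0 ?subr_gt0 ?lo_lt_hi //.
Qed.

Let geo_im (u : R) : 0 < complex.Im (geo Q0 u) := geo_Im_gt0 u D0 nD.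

Definition coded_by (j : (int * int * int) * (nat * int)) (O : cubic_order R) : Prop :=
  exists w1 w2 : order_field O,
    is_zbasis (@Defs.order_set R O) [:: 1; w1; w2] /\ int_table w1 w2 (cub j.2).

Definition code_point (j : (int * int * int) * (nat * int)) : R[i] :=
  geo (bqf_mk j.1) (eps j.1 * harg j.2 + tau j.1).

Definition bound_of (X : R) : R := Num.sqrt (3%:R * X / (bqf_disc Q0)%:~R).

Lemma cubic_disc_bound C n (X : R) : 0 < X -> 0 < n -> hess C = bqf_scale n Q0 ->
  (`|(cubic_disc C)%:~R| < X) = (n%:~R < bound_of X).
Proof.
move=> X0 n0 hC; have D0' : 0 < (bqf_disc Q0)%:~R :> R by rewrite ltr0z.
have hd := hess_disc C; rewrite hC bqf_disc_scale in hd.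
have hd' : n%:~R ^+ 2 * (bqf_disc Q0)%:~R = - 3%:R * (cubic_disc C)%:~R :> R.
  by rewrite -rmorphXn -rmorphM hd rmorphM.
have -> : (cubic_disc C)%:~R = - (n%:~R ^+ 2 * (bqf_disc Q0)%:~R / 3%:R) :> R.
  by rewrite hd'; field.
have n1 : 0 < n%:~R :> R by rewrite ltr0z.
rewrite normrN gtr0_norm ?divr_gt0 ?mulr_gt0 ?exprn_gt0 // ltr_pdivrMr // -ltr_pdivlMr //.
rewrite -[X in (_ = (X < _))](ger0_norm (ltW n1)) -sqrtr_sqr /bound_of ltr_sqrt; last first.
  by rewrite divr_gt0 ?mulr_gt0.
by rewrite [3%:R * X]mulrC.
Qed.

Lemma code_iso j O1 O2 : coded_by j O1 -> coded_by j O2 -> order_iso O1 O2.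
Proof. by move=> [w1 [w2 [b1 t1]]] [v1 [v2 [b2 t2]]]; exact: same_table_iso b1 t1 b2 t2. Qed.

Lemma order_point (K : fieldExtType rat) (w1 w2 a1 a2 : K) v N g n1 n2 :
  hin N v -> basis_of fullv [:: 1; w1; w2] -> int_table w1 w2 (cub v) -> g \in unitmx ->
  base_change g n1 n2 w1 w2 a1 a2 ->
  bqf_point (minkowski_form R a1 a2) = moebius (anti_mx g) (geo Q0 (harg v)).
Proof.
move=> hv hb tw gu bc.
have [k1 [k2 [k10 k20 hk hl]]] := cub_coords r_lt0 D0 nD h0 cubP hv.
by rewrite (minkowski_point (lo_lt_hi R D0 nD) k10 k20 hk hb tw gu bc) hl.
Qed.

Lemma counted_order (X : R) W (O : cubic_order R) : 0 < X -> counted Q X W O ->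
  exists (a1 a2 w1 w2 : order_field O) v, [/\ is_zbasis (@Defs.order_set R O) [:: 1; a1; a2],
    is_zbasis (@Defs.order_set R O) [:: 1; w1; w2] /\ int_table w1 w2 (cub v),
    hin (bound_of X) v &
    exists2 w, W w & is_image (bqf_point (minkowski_form R a1 a2)) w].
Proof.
move=> X0 [a1 [a2 [ba hred hdisc hw]]].
have ordA := order_setP O.
have [n1 [n2 [C tC]]] := normalize ordA ba.
have bw := zbasis_shift n1 n2 ba; set u1 := a1 + _ in tC bw; set u2 := a2 + _ in tC bw.
have hb := proj1 (proj1 (is_zbasis3P _ u1 u2) bw).
have ea1 : a1 = u1 + (- n1)%:~R by rewrite /u1 rmorphN addrK.
have ea2 : a2 = u2 + (- n2)%:~R by rewrite /u2 rmorphN addrK.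
have hT : trace_form a1 a2 = bqf_scale 6 (bqf_flip (hess C)).
  by rewrite {1}ea1 {1}ea2 (trace_form_change hb tC).
have hD : basis_disc a1 a2 = (cubic_disc C)%:~R.
  by rewrite ea1 ea2; case: (C) tC => [] [] [] a b c d tC; rewrite (table_basis_disc hb tC).
set F := bqf_reduce _ in hred.
have F_Q0 : bqf_equiv Q0 F by apply: bqf_equiv_trans hQ (bqf_equiv_sym hred).
have pF : bqf_primitive F by apply: bqf_primitive_equiv (bqf_equiv_sym F_Q0) prim.
have dF : bqf_disc F = bqf_disc Q0.
  by have [g gu ->] := F_Q0; rewrite bqf_disc_act.
have [k0 hk] : 0 < bqf_content (trace_form a1 a2) /\ trace_form a1 a2 = bqf_scale (bqf_content (trace_form a1 a2)) F.
  by apply: bqf_reduceE; rewrite -/F dF gt_eqF.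
set k := bqf_content _ in k0 hk; rewrite hT in hk.
have /dvdzP[k' ek] := bqf_scale_dvd pF hk.
have k'0 : 0 < k' by move: k0; rewrite ek pmulr_lgt0.
have hF : bqf_flip (hess C) = bqf_scale k' F.
  apply: (@bqf_scale_inj 6) => //; rewrite hk ek; apply: bqf_eq => /=; ring.
have [g gu eg] : exists2 g, g \in unitmx & bqf_flip Q0 = bqf_act g F.
  exact: bqf_equiv_trans (bqf_equiv_flip Q0) F_Q0.
have [v1 [v2 [C' [g' [m1 [m2 [bv tv hC' a0 [bc _]]]]]]]] := rebase ordA bw tC hF gu eg.
have hC'' : hess C' = bqf_scale k' Q0.
  by rewrite -[hess C']bqf_flipK hC' bqf_flip_scale bqf_flipK.
have [v v0 ev] := cub_surj (hess_apolar (lt0r_neq0 k'0) hC'') a0.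
exists a1, a2, v1, v2, v; split=> //; first by rewrite -ev.
have dCC : cubic_disc C' = cubic_disc C.
  apply: (mulfI (_ : - 3 != 0 :> int)) => //; rewrite -!hess_disc -[RHS]bqf_disc_flip hF hC''.
  by rewrite !bqf_disc_scale dF.
rewrite ev in hC''; apply: (cub_hyp_in r_lt0 D0 nD e0 h0 cubP hC'' v0 k'0).
by rewrite -(cubic_disc_bound X0 k'0 hC'') -ev dCC; move: hdisc; rewrite hD ratr_int.
Qed.

Lemma counted_code (X : R) W (O : cubic_order R) : 0 < X -> counted Q X W O ->
  exists j, [/\ j.1 \in Es, hin (bound_of X) j.2, W (code_point j) & coded_by j O].
Proof.
move=> X0 hO; have ordA := order_setP O.
have [a1 [a2 [v1 [v2 [v [ba [bv tv] hv [w Ww [gw [g gu ew]]]]]]]]] := counted_order X0 hO.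
have hb := proj1 (proj1 (is_zbasis3P _ v1 v2) bv).
have [g2 [n1 [n2 [g2u bc2]]]] := zbasis_related bv ba.
pose m := anti_mx g *m g2.
have mu : m \in unitmx by rewrite unitmx_mul anti_mx_unit gu.
have point (u : R) g3 : g3 \in unitmx -> moebius g (moebius (anti_mx g3) (geo Q0 u)) = moebius (anti_mx (anti_mx g *m g3)) (geo Q0 u).
  by move=> g3u; rewrite moebius_mul ?anti_mx_unit // anti_mxM anti_mxK.
have ew2 : w = moebius (anti_mx m) (geo Q0 (harg v)).
  by rewrite ew (order_point hv hb tv g2u bc2) point.
pose E := bqf_flip (bqf_act m (bqf_flip Q0)); pose x := (bqf_r E, bqf_s E, bqf_t E).
have eE : bqf_mk x = E by rewrite /x /E; case: (bqf_flip _).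
have flE : bqf_flip (bqf_mk x) = bqf_act m (bqf_flip Q0) by rewrite eE bqf_flipK.
have xQ : bqf_equiv (bqf_mk x) Q.
  rewrite eE; apply: bqf_equiv_trans (bqf_equiv_flip _) _.
  by apply: bqf_equiv_trans (bqf_equiv_act _ mu) (bqf_equiv_trans (bqf_equiv_flip _) hQ).
have [ep [ta [_ hg]]] := geo_transport R D0 nD mu flE.
have xEs : x \in Es.
  by apply: Es_all => //; exists (ep * harg v + ta); rewrite -hg -ew2.
have [_ mxu mxE hmx] := EsP xEs.
pose s := invmx (mx x) *m m.
have su : s \in unitmx by rewrite unitmx_mul unitmx_inv mxu.
have hs : bqf_flip Q0 = bqf_act s (bqf_flip Q0).
  by rewrite /s -bqf_actM -flE mxE bqf_actM mulVmx // bqf_act1.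
have [k [k0 kN hk]] := cub_hess r_lt0 D0 nD prim e0 h0 cubP hv.
have hk' : bqf_flip (hess (cub v)) = bqf_scale k (bqf_flip Q0) by rewrite hk bqf_flip_scale.
have [y1 [y2 [C' [s' [m1 [m2 [by_ ty hC' a0 [bc3 hs']]]]]]]] := rebase ordA bv tv hk' su hs.
have hC'' : hess C' = bqf_scale k Q0.
  by rewrite -[hess C']bqf_flipK hC' bqf_flip_scale bqf_flipK.
have [v' v'0 ev'] := cub_surj (hess_apolar (lt0r_neq0 k0) hC'') a0.
rewrite ev' in hC'' ty; have hv' := cub_hyp_in r_lt0 D0 nD e0 h0 cubP hC'' v'0 k0 kN.
have hby := proj1 (proj1 (is_zbasis3P _ y1 y2) by_).
have [g3 [l1 [l2 [g3u bc4]]]] := zbasis_related by_ ba.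
have e2 := base_change_uniq hb bc2 (base_change_mul bc3 bc4).
have e3 : anti_mx g *m g3 = mx x \/ anti_mx g *m g3 = - mx x.
  have h1 : anti_mx g *m g3 *m s' = mx x *m s by rewrite -mulmxA -e2 /s mulKVmx.
  case: hs' => es; rewrite es in h1; [left | right].
    by apply: (can_inj (mulmxK su)); rewrite h1.
  by apply: (can_inj (mulmxK su)); rewrite mulNmx -h1 mulmxN opprK.
exists (x, v'); split=> //; last by exists y1, y2.
rewrite /code_point /= -hmx; suff -> : moebius (anti_mx (mx x)) (geo Q0 (harg v')) = w by [].
rewrite ew (order_point hv' hby ty g3u bc4) point //.
by case: e3 => ->; rewrite ?anti_mxN ?moebiusN.
Qed.

Lemma code_counted (X : R) W j : 0 < X -> j.1 \in Es -> hin (bound_of X) j.2 ->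
  W (code_point j) -> gauss_domain (code_point j) ->
  (forall p q : int, coprimez p q -> ~ cubic_root (cub j.2) p q) ->
  exists2 O : cubic_order R, counted Q X W O & coded_by j O.
Proof.
case: j => x v X0 /= xEs hv Wj gj irr.
have [xQ mxu mxE hmx] := EsP xEs.
have [k1 [k2 [k10 k20 hk hl]]] := cub_coords r_lt0 D0 nD h0 cubP hv.
have [ord [w1 [w2 [bw tw]]]] := exists_order (lo_lt_hi R D0 nD) k10 k20 hk irr.
exists ord; last by exists w1, w2.
have ordA := order_setP ord.
have [k [k0 kN hkC]] := cub_hess r_lt0 D0 nD prim e0 h0 cubP hv.
have hk' : bqf_flip (hess (cub v)) = bqf_scale k (bqf_flip Q0) by rewrite hkC bqf_flip_scale.
have [y1 [y2 [C' [g [m1 [m2 [by_ ty hC' _ [bc hg]]]]]]]] := rebase ordA bw tw hk' mxu mxE.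
have hb := proj1 (proj1 (is_zbasis3P _ w1 w2) bw).
have hby := proj1 (proj1 (is_zbasis3P _ y1 y2) by_).
have gu : g \in unitmx by case: hg => ->; rewrite ?unimodN.
exists y1, y2; split=> //.
- have := trace_form_change hby ty 0 0; rewrite !addr0 => ->.
  have -> : bqf_scale 6 (bqf_flip (hess C')) = bqf_scale (6 * k) (bqf_flip (bqf_mk x)).
    by rewrite hC'; apply: bqf_eq => /=; ring.
  rewrite bqf_reduce_scale ?mulr_gt0 //; first exact: bqf_equiv_trans (bqf_equiv_flip _) xQ.
  apply: bqf_primitive_equiv (bqf_equiv_trans (bqf_equiv_flip _) _) prim.
  exact: bqf_equiv_trans xQ (bqf_equiv_sym hQ).
- have -> : basis_disc y1 y2 = (cubic_disc C')%:~R.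
    by case: (C') ty => [] [] [] a b c d ty; have := table_basis_disc hby ty 0 0; rewrite !addr0.
  rewrite ratr_int; have -> : cubic_disc C' = cubic_disc (cub v).
    apply: (mulfI (_ : - 3 != 0 :> int)) => //; rewrite -!hess_disc -[LHS]bqf_disc_flip hC' -[RHS]bqf_disc_flip hk'.
    by rewrite mxE !bqf_disc_scale bqf_disc_act.
  by rewrite (cubic_disc_bound X0 k0 hkC).
have -> : bqf_point (minkowski_form R y1 y2) = code_point (x, v).
  rewrite (order_point hv hb tw gu bc) /code_point /= -hmx.
  by case: hg => ->; rewrite ?anti_mxN ?moebiusN.
exists (code_point (x, v)) => //; split=> //; exists 1%:M; first exact: unitmx1.
by rewrite moebius1.
Qed.

Lemma code_inj N N' j j' (O O' : cubic_order R) : j.1 \in Es -> j'.1 \in Es ->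
  hin N j.2 -> hin N' j'.2 -> gauss_interior (code_point j) -> gauss_domain (code_point j') ->
  coded_by j O -> coded_by j' O' -> order_iso O O' -> j = j'.
Proof.
case: j j' => x v [x' v'] /= xEs xEs' hv hv' gi gd [w1 [w2 [bw tw]]] [y1 [y2 [by_ ty]]] iso.
have [u1 [u2 [bu tu]]] := order_iso_zbasis iso bw tw.
have hbu := proj1 (proj1 (is_zbasis3P _ u1 u2) bu).
have hby := proj1 (proj1 (is_zbasis3P _ y1 y2) by_).
have [g [n1 [n2 [gu bc]]]] := zbasis_related bu by_.
have [_ mxu mxE hmx] := EsP xEs; have [_ mxu' mxE' hmx'] := EsP xEs'.
rewrite /= in tu ty.
pose b1 := (mx x' 0 0)%:~R * y1 + (mx x' 0 1)%:~R * y2.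
pose b2 := (mx x' 1 0)%:~R * y1 + (mx x' 1 1)%:~R * y2.
have bcb : base_change (mx x') 0 0 y1 y2 b1 b2 by split; rewrite /b1 /b2 ?add0r.
have p1 := order_point hv' hby ty mxu' bcb.
have bcu := base_change_mul bc bcb.
have mgu : mx x' *m g \in unitmx by rewrite unitmx_mul mxu'.
have p2 := order_point hv hbu tu mgu bcu.
pose t := anti_mx (mx x' *m g *m invmx (mx x)).
have tu' : t \in unitmx by rewrite anti_mx_unit unitmx_mul mgu unitmx_inv.
have ht : moebius t (code_point (x, v)) = code_point (x', v').
  have axu : anti_mx (mx x) \in unitmx by rewrite anti_mx_unit.
  rewrite /code_point /= -hmx -hmx' -p1 p2 (moebius_mul tu' axu (geo_im _)).
  by rewrite /t -anti_mxM mulmxKV.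
have e1 : mx x' *m g = mx x \/ mx x' *m g = - mx x.
  have gt : gauss_domain (moebius t (code_point (x, v))) by rewrite ht.
  have [h1|h1] := gauss_unique tu' gi gt.
  - left; have := congr1 anti_mx h1; rewrite anti_mxK anti_mx1 => h2.
    by rewrite -[LHS](mulmxKV mxu) h2 mul1mx.
  - right; have := congr1 anti_mx h1; rewrite anti_mxK anti_mxN anti_mx1 => h2.
    by rewrite -[LHS](mulmxKV mxu) h2 mulNmx mul1mx.
have [k [k0 _ hk]] := cub_hess r_lt0 D0 nD prim e0 h0 cubP hv.
have [k' [k'0 _ hk']] := cub_hess r_lt0 D0 nD prim e0 h0 cubP hv'.
have hch := hess_change hbu tu hby ty bc.
rewrite hk hk' !bqf_flip_scale bqf_act_scale in hch.
have kk : k = k'.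
  have := congr1 (@bqf_disc _) hch; rewrite !bqf_disc_scale bqf_disc_act // bqf_disc_flip.
  move/(mulIf (lt0r_neq0 D0)) => /eqP; rewrite eqf_sqr => /orP[/eqP ->//|/eqP h1].
  by move: k'0 k0; rewrite h1 oppr_gt0 => h2 h3; move: (lt_trans h2 h3); rewrite ltxx.
rewrite -kk in hch; have hg := bqf_scale_inj (lt0r_neq0 k0) hch.
have ex : bqf_flip (bqf_mk x) = bqf_flip (bqf_mk x').
  rewrite mxE mxE' [in RHS]hg bqf_actM; case: e1 => ->; last by rewrite bqf_actN.
  by [].
have exx : x = x'.
  have := congr1 bqf_flip ex; rewrite !bqf_flipK.
  by case: (x) (x') => [[? ?] ?] [[? ?] ?] [-> -> ->].
congr pair; first exact: exx.
rewrite exx in e1 mxu; have gpm : g = 1%:M \/ g = - 1%:M.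
  case: e1 => h1; [left | right]; apply: (can_inj (mulKmx mxu)); rewrite h1 ?mulmx1 //.
  by rewrite mulmxN mulmx1.
have pos u N1 : hin N1 u -> 0 < (cub u).1.1.1.
  by move=> [u0 _ _]; have [_ [-> _]] := cubP u; rewrite mulr_gt0 //; case: (u.1) u0.
apply: (cub_inj e0 h0 (fun u => proj2 (cubP u))); have [//|h1] := table_rigid hbu tu ty bc gpm.
have := pos _ _ hv'; rewrite h1 /= oppr_gt0 => h2.
by move: (lt_trans h2 (pos _ _ hv)); rewrite ltxx.
Qed.

End OrderCodes.

(** * Geodesics in the Gauss domain *)

Section ComplexNbhs.
Variable R : realType.

Lemma nbhs_complex (z : (R[i] : numFieldType)) (B : set (R[i] : numFieldType)) : nbhs z B ->
  exists2 e : R, 0 < e & forall w, `|complex.Re w - complex.Re z| < e ->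
    `|complex.Im w - complex.Im z| < e -> B w.
Proof.
move=> /nbhs_ballP[e /= e0 he].
have [r r0 er] : exists2 r : R, 0 < r & e = r%:C%C.
  case: e e0 he => a b; rewrite ltcE /= => /andP[/eqP b0 a0] _; exists a => //.
  by rewrite b0.
exists (r / 2%:R); first by rewrite divr_gt0.
move=> w h1 h2; apply: he; rewrite /ball /= er -normrN opprB normc_def ltcR.
have -> : complex.Re (w - z) = complex.Re w - complex.Re z by case: (w) (z) => [? ?] [? ?].
have -> : complex.Im (w - z) = complex.Im w - complex.Im z by case: (w) (z) => [? ?] [? ?].
set x := _ - _ in h1 *; set y := _ - _ in h2 *.
rewrite -[ltRHS](gtr0_norm r0) -sqrtr_sqr ltr_sqrt ?exprn_gt0 //.
rewrite -[x ^+ 2]real_normK ?num_real // -[y ^+ 2]real_normK ?num_real //.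
by have := normr_ge0 x; have := normr_ge0 y; move: h1 h2; nra.
Qed.

End ComplexNbhs.

Lemma third_coef_bound (E : bqf int) : 0 < bqf_disc E -> 1 <= `|bqf_r E| ->
  `|bqf_s E| <= 2 * bqf_disc E -> `|bqf_t E| <= 5 * bqf_disc E ^+ 2.
Proof.
move=> D0 r1 hs; set D := bqf_disc E in D0 hs *.
have h4 : `|4 * bqf_r E * bqf_t E| <= bqf_s E ^+ 2 + D.
  have -> : 4 * bqf_r E * bqf_t E = bqf_s E ^+ 2 - D by rewrite /D /bqf_disc; ring.
  by apply: le_trans (ler_normB _ _) _; rewrite ger0_norm ?sqr_ge0 // gtr0_norm.
have h5 : bqf_s E ^+ 2 <= 4 * D ^+ 2.
  rewrite -real_normK ?num_real // (_ : 4 * _ = (2 * D) ^+ 2); last by ring.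
  by rewrite ler_pXn2r ?nnegrE // mulr_ge0 // ltW.
have h6 : D <= D ^+ 2 by rewrite expr2 ler_peMl ?(ltW D0) // -gtz0_ge1.
apply: (@le_trans _ _ `|4 * bqf_r E * bqf_t E|).
  by rewrite normrM ler_peMl // normrM; apply: le_trans r1 _; rewrite ler_peMl.
apply: le_trans h4 (le_trans (lerD h5 h6) _).
by rewrite -[X in _ + X]mul1r -mulrDl.
Qed.

Section GeodesicInDomain.
Variables (R : realType) (E : bqf int).
Hypotheses (D0 : 0 < bqf_disc E) (nD : nonsquare (bqf_disc E)).

Local Notation al := (lo R E).
Local Notation be := (hi R E).
Local Notation gE := (@geo R E).
Let lh : al < be := lo_lt_hi R D0 nD.
Let e1 (u : R) : 0 < 1 + expR u ^+ 2. Proof. by rewrite addr_gt0 ?exprn_gt0 ?expR_gt0. Qed.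

Let re u : complex.Re (gE u) = (al + be * expR u ^+ 2) / (1 + expR u ^+ 2).
Proof. by rewrite /geo geodesicE. Qed.
Let im u : complex.Im (gE u) = (be - al) * expR u / (1 + expR u ^+ 2).
Proof. by rewrite /geo geodesicE. Qed.

Let nrm u : complex.Re (gE u) ^+ 2 + complex.Im (gE u) ^+ 2 =
  (al ^+ 2 + be ^+ 2 * expR u ^+ 2) / (1 + expR u ^+ 2).
Proof. by rewrite re im; field; rewrite gt_eqF. Qed.

Let im0 (u : R) : 0 < complex.Im (gE u) := geo_Im_gt0 u D0 nD.

(* For x = exp (2 u) these have the signs of Re z, 1/2 - Re z and |z|^2 - 1 at the
   point z of parameter u. *)
Definition wall1 (x : R) : R := al + be * x.
Definition wall2 (x : R) : R := 1 - 2%:R * al + (1 - 2%:R * be) * x.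
Definition wall3 (x : R) : R := al ^+ 2 - 1 + (be ^+ 2 - 1) * x.

Lemma geo_gauss_domain u : gauss_domain (gE u) <->
  [/\ 0 <= wall1 (expR u ^+ 2), 0 <= wall2 (expR u ^+ 2) & 0 <= wall3 (expR u ^+ 2)].
Proof.
rewrite /wall1 /wall2 /wall3; split=> [[/andP[h1 h2] _ h3]|[h1 h2 h3]].
  rewrite re ler_pdivlMr // in h1; rewrite re ler_pdivrMr // in h2; rewrite nrm ler_pdivlMr // in h3.
  by split; lra.
split; rewrite ?nrm ?re; [apply/andP; split | exact: im0 | ];
  rewrite ?ler_pdivlMr ?ler_pdivrMr //; lra.
Qed.

Lemma geo_gauss_interior u : gauss_interior (gE u) <->
  [/\ 0 < wall1 (expR u ^+ 2), 0 < wall2 (expR u ^+ 2) & 0 < wall3 (expR u ^+ 2)].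
Proof.
rewrite /wall1 /wall2 /wall3; split=> [[/andP[h1 h2] _ h3]|[h1 h2 h3]].
  rewrite re ltr_pdivlMr // in h1; rewrite re ltr_pdivrMr // in h2; rewrite nrm ltr_pdivlMr // in h3.
  by split; lra.
split; rewrite ?nrm ?re; [apply/andP; split | exact: im0 | ];
  rewrite ?ltr_pdivlMr ?ltr_pdivrMr //; lra.
Qed.

Local Notation mu := (@lebesgue_measure R).

Let linear_null (c0 c1 : R) : (c0 != 0) || (c1 != 0) ->
  mu [set u | c0 + c1 * expR u ^+ 2 = 0] = 0%E.
Proof.
move=> c; apply/eqP; rewrite eq_le lebesgue_ge0 andbT.
have [[u0 h0]|h] := pselect (exists u, c0 + c1 * expR u ^+ 2 = 0); last first.
  rewrite (_ : [set _ | _] = set0) ?measure0 //.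
  by apply/seteqP; split=> // u hu; apply: h; exists u.
rewrite -[leRHS](lebesgue_measure_set1 u0); apply: le_lebesgue => u /= hu.
have c1' : c1 != 0.
  apply/eqP => c10; move: c h0; rewrite c10 mul0r addr0 eqxx orbF => + c00.
  by rewrite c00 eqxx.
have /(mulfI c1')/eqP : c1 * expR u ^+ 2 = c1 * expR u0 ^+ 2 by apply: (@addrI _ c0); rewrite hu h0.
by rewrite eqrXn2 ?expR_ge0 // => /eqP /expR_inj.
Qed.

Lemma walls_null : mu [set u | gauss_domain (gE u) /\ ~ gauss_interior (gE u)] = 0%E.
Proof.
apply/eqP; rewrite eq_le lebesgue_ge0 andbT.
have irr1 : ~ (al ^+ 2 = 1 /\ be ^+ 2 = 1).
  move=> [h1 h2]; have : (al == -1) || (al == 1) by move/eqP: h1; rewrite sqrf_eq1 orbC.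
  case/orP => /eqP ha.
    have [] := lohi_irrational D0 nD (or_introl erefl) (_ : 1%:~R + al * 1%:~R = 0); last by [].
    by rewrite ha mulN1r subrr.
  have [] := lohi_irrational D0 nD (or_introl erefl) (_ : (-1)%:~R + al * 1%:~R = 0); last by [].
  by rewrite ha mul1r rmorphN addNr.
have n1 : mu [set u | al + be * expR u ^+ 2 = 0] = 0%E.
  by apply: linear_null; rewrite -negb_and; apply/negP => /andP[/eqP h1 /eqP h2]; have := lh; rewrite h1 h2 ltxx.
have n2 : mu [set u | 1 - 2%:R * al + (1 - 2%:R * be) * expR u ^+ 2 = 0] = 0%E.
  by apply: linear_null; rewrite -negb_and; apply/negP => /andP[/eqP h1 /eqP h2]; have := lh; lra.
have n3 : mu [set u | al ^+ 2 - 1 + (be ^+ 2 - 1) * expR u ^+ 2 = 0] = 0%E.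
  by apply: linear_null; rewrite -negb_and !subr_eq0; apply/negP => /andP[/eqP h1 /eqP h2]; apply: irr1.
have h := lebesgue_subadd ([set u | al + be * expR u ^+ 2 = 0] `|`
  [set u | 1 - 2%:R * al + (1 - 2%:R * be) * expR u ^+ 2 = 0]) [set u | al ^+ 2 - 1 + (be ^+ 2 - 1) * expR u ^+ 2 = 0].
rewrite n3 adde0 in h; apply: (le_trans _ (le_trans h _)); last first.
  by apply: le_trans (lebesgue_subadd _ _) _; rewrite n1 n2 adde0.
apply: le_lebesgue => u [/geo_gauss_domain[h1 h2 h3] /geo_gauss_interior h4]; rewrite /= -/(wall1 _) -/(wall2 _) -/(wall3 _).
move: h1 h2 h3; rewrite !le_eqVlt => /orP[/eqP <-|h1]; first by left; left.
move=> /orP[/eqP <-|h2]; first by left; right.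
by move=> /orP[/eqP <-|h3]; [right | case: h4].
Qed.

Lemma geo_domain_bounds u : gauss_domain (gE u) ->
  [/\ `|bqf_r E| <= bqf_disc E, `|bqf_s E| <= 2 * bqf_disc E,
     `|bqf_t E| <= 5 * bqf_disc E ^+ 2 & `|u| <= ln (2%:R * (bqf_disc E)%:~R)].
Proof.
move=> [/andP[x0 x1] _ xy].
pose S : R := Num.sqrt (bqf_disc E)%:~R; pose D : R := (bqf_disc E)%:~R.
have D1 : 1 <= D by rewrite /D ler1z -gtz0_ge1.
have SD : S ^+ 2 = D by rewrite /S sqr_sqrtr // ler0z ltW.
have S1 : 1 <= S by rewrite /S -[leLHS]sqrtr1 ler_wsqrtr.
have SleD : S <= D by rewrite -SD expr2 ler_peMl //; lra.
have r0 : 0 < `|(bqf_r E)%:~R| :> R by rewrite normr_gt0 intr_eq0 nonsquare_bqf_r.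
have r1 : 1 <= `|(bqf_r E)%:~R| :> R by rewrite -intr_norm ler1z -gtz0_ge1 normr_gt0 nonsquare_bqf_r.
have hl : be - al = S / `|(bqf_r E)%:~R| by rewrite hi_sub_lo.
have hlS : (be - al) * `|(bqf_r E)%:~R| = S by rewrite hl divfK // gt_eqF.
have hl0 : 0 < be - al by rewrite subr_gt0.
have y1 : 2%:R^-1 <= complex.Im (gE u).
  have := im0 u; move: (complex.Im _) xy => y xy' y0; rewrite leNgt; apply/negP => hy; nra.
have ex := expR_gt0 u.
rewrite im ler_pdivlMr // in y1.
have w1 : 1 <= be - al.
  have := sqr_ge0 (1 - expR u); move: (expR u) ex y1 => x x00 h1 h2; nra.
have rS : `|(bqf_r E)%:~R| <= S by rewrite -hlS ler_peMl // ltW.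
have hb : be - al <= S by rewrite -hlS ler_peMr // ltW.
have a1 : al <= 2%:R^-1.
  apply: le_trans x1; rewrite re ler_pdivlMr //; have := exprn_gt0 2 ex; move: (expR u ^+ 2) => x ?; nra.
have b0 : 0 <= be.
  apply: le_trans x0 _; rewrite re ler_pdivrMr //; move: lh; nra.
have sb : `|(bqf_s E)%:~R| <= 2%:R * D.
  rewrite (bqf_s_lohi R nD) normrM normrN.
  apply: (@le_trans _ _ (`|(bqf_r E)%:~R| * (1 + (be - al)))).
    by rewrite ler_wpM2l ?(ltW r0) // ler_norml; apply/andP; split; lra.
  by rewrite mulrDr mulr1 [_ * (be - al)]mulrC hlS; lra.
have rb : `|bqf_r E| <= bqf_disc E by rewrite -(ler_int R) intr_norm (le_trans rS).
have sb' : `|bqf_s E| <= 2 * bqf_disc E by rewrite -(ler_int R) intr_norm rmorphM.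
split=> //.
  have r1' : 1 <= `|bqf_r E| by rewrite -gtz0_ge1 normr_gt0 nonsquare_bqf_r.
  exact: third_coef_bound D0 r1' sb'.
have hx : expR u ^+ 2 + 1 <= 2%:R * S * expR u by nra.
have u1 : u <= ln (2%:R * D).
  rewrite -[leLHS]expRK ler_ln ?posrE ?expR_gt0 //; last by lra.
  have : expR u * expR u <= 2%:R * S * expR u by move: hx; rewrite expr2; lra.
  by rewrite ler_pM2r //; lra.
rewrite ler_norml u1 andbT lerNl -[leLHS]expRK ler_ln ?posrE ?expR_gt0 //; last by lra.
have : 1 <= 2%:R * S * expR u by move: hx; have := sqr_ge0 (expR u); lra.
rewrite expRN -[_^-1]mul1r ler_pdivrMr //; nra.
Qed.

Let re_cont u : complex.Re (gE v) @[v --> u] --> complex.Re (gE u).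
Proof.
rewrite re; under eq_fun do rewrite re.
have h : (expR v ^+ 2 : R) @[v --> u] --> expR u ^+ 2.
  by rewrite expr2; under eq_fun do rewrite expr2; apply: cvgM; exact: continuous_expR.
apply: cvgM; first by apply: cvgD; [exact: cvg_cst | apply: cvgM => //; exact: cvg_cst].
by apply: cvgV; [rewrite gt_eqF | apply: cvgD => //; exact: cvg_cst].
Qed.

Let im_cont u : complex.Im (gE v) @[v --> u] --> complex.Im (gE u).
Proof.
rewrite im; under eq_fun do rewrite im.
have h : (expR v ^+ 2 : R) @[v --> u] --> expR u ^+ 2.
  by rewrite expr2; under eq_fun do rewrite expr2; apply: cvgM; exact: continuous_expR.
apply: cvgM; first by apply: cvgM; [exact: cvg_cst | exact: continuous_expR].
by apply: cvgV; [rewrite gt_eqF | apply: cvgD => //; exact: cvg_cst].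
Qed.

Let nrm_cont u : complex.Re (gE v) ^+ 2 + complex.Im (gE v) ^+ 2 @[v --> u] -->
  complex.Re (gE u) ^+ 2 + complex.Im (gE u) ^+ 2.
Proof.
have h1 := re_cont (u := u); have h2 := im_cont (u := u).
by under eq_fun do rewrite !expr2; rewrite !expr2; exact: cvgD (cvgM h1 h1) (cvgM h2 h2).
Qed.

Let geo_nbhs (u : R) (B : set (R[i] : numFieldType)) :
  nbhs (gE u : (R[i] : numFieldType)) B -> \forall v \near u, B (gE v).
Proof.
move=> /nbhs_complex[e e0 he]; near=> v; apply: he; near: v.
  by have /cvgrPdistC_lt := re_cont (u := u); apply.
by have /cvgrPdistC_lt := im_cont (u := u); apply.
Unshelve. all: by end_near. Qed.

Let interior_near u : gauss_interior (gE u) -> \forall v \near u, gauss_interior (gE v).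
Proof.
move=> [/andP[h1 h2] h3 h4].
near=> v; split; first (apply/andP; split).
- by near: v; apply: (cvgr_gt _ (re_cont (u := u))).
- by near: v; apply: (cvgr_lt _ (re_cont (u := u))).
- exact: im0.
- by near: v; apply: (cvgr_gt _ (nrm_cont (u := u))).
Unshelve. all: by end_near. Qed.

Let domain_near u : ~ gauss_domain (gE u) -> \forall v \near u, ~ gauss_domain (gE v).
Proof.
move=> h; have [h1|h1] := ltP (complex.Re (gE u)) 0.
  near=> v => -[/andP[+ _] _ _]; rewrite leNgt => /negP; apply.
  by near: v; apply: (cvgr_lt _ (re_cont (u := u))).
have [h2|h2] := ltP 2%:R^-1 (complex.Re (gE u)).
  near=> v => -[/andP[_ +] _ _]; rewrite leNgt => /negP; apply.
  by near: v; apply: (cvgr_gt _ (re_cont (u := u))).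
have [h3|h3] := ltP (complex.Re (gE u) ^+ 2 + complex.Im (gE u) ^+ 2) 1.
  near=> v => -[_ _]; rewrite leNgt => /negP; apply.
  by near: v; apply: (cvgr_lt _ (nrm_cont (u := u))).
by case: h; split=> //; rewrite h1 h2.
Unshelve. all: by end_near. Qed.

Lemma preimage_boundary (S W : set (R[i] : numFieldType)) (V : set R) :
  W `<=` @gauss_domain R -> (forall u, gauss_domain (gE u) -> S (gE u)) ->
  (forall u, W (gE u) -> gauss_interior (gE u) -> V u) -> (forall u, V u -> W (gE u)) ->
  closure V `\` interior V `<=` [set u | boundary_in S W (gE u)] `|`
    [set u | gauss_domain (gE u) /\ ~ gauss_interior (gE u)].
Proof.
move=> WG GS hV VW u [cV nV].
have [g|/domain_near ng] := pselect (gauss_domain (gE u)); last first.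
  by have [v [/VW/WG + nv]] := cV _ ng.
have [gi|ngi] := pselect (gauss_interior (gE u)); [left | by right].
split; first split; first exact: GS.
  by move=> B /geo_nbhs hB; have [v [/VW Wv Bv]] := cV _ hB; exists (gE v).
move=> B /geo_nbhs hB; have hI := interior_near gi.
have [//|hn] := pselect (exists z, (S `\` W) z /\ B z); case: nV; rewrite /interior.
near=> v; have Iv : gauss_interior (gE v) by near: v.
have Bv : B (gE v) by near: v.
apply: hV => //; have [//|nW] := pselect (W (gE v)); case: hn; exists (gE v); split=> //.
split=> //; apply: GS; case: Iv => /andP[a1 a2] a3 a4; split=> //; last exact: ltW.
by rewrite !ltW.
Unshelve. all: by end_near. Qed.

End GeodesicInDomain.

Section ArcInDomain.
Variable R : realType.

Let wall_near (c0 c1 : R) : 0 < c0 + c1 -> \forall u \near (0 : R), 0 < c0 + c1 * expR u ^+ 2.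
Proof.
move=> h; have h1 : c0 + c1 * expR v ^+ 2 @[v --> (0 : R)] --> c0 + c1 * expR 0 ^+ 2.
  apply: cvgD; first exact: cvg_cst.
  apply: cvgM; first exact: cvg_cst.
  by rewrite expr2; under eq_fun do rewrite expr2; apply: cvgM; exact: continuous_expR.
by apply: (cvgr_gt _ h1); rewrite expR0 expr1n mulr1.
Qed.

Lemma geodesic_meets_domain (Q : bqf int) : 0 < bqf_disc Q -> nonsquare (bqf_disc Q) ->
  exists E, bqf_equiv E Q /\ exists x y : R, x < y /\
    forall u, x <= u <= y -> gauss_domain (geo E u).
Proof.
move=> D0 nD.
have [E [hE sr rt rt0 s0]] : exists E, [/\ bqf_equiv E Q, `|bqf_s E| <= `|bqf_r E|,
    `|bqf_r E| <= `|bqf_t E|, bqf_r E * bqf_t E < 0 & bqf_s E * bqf_r E <= 0].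
  have [E [hE h1 h2 h3]] := reduced_form D0 nD.
  have [s0|s0] := leP (bqf_s E * bqf_r E) 0; first by exists E.
  exists (bqf_flip E); split=> //=; first exact: bqf_equiv_trans (bqf_equiv_flip E) hE.
    by rewrite normrN.
  by rewrite mulNr oppr_le0 ltW.
have dE : bqf_disc E = bqf_disc Q by have [g gu ->] := hE; rewrite bqf_disc_act.
rewrite -dE in D0 nD; have lh := lo_lt_hi R D0 nD.
exists E; split=> //.
have r0 : (bqf_r E)%:~R != 0 :> R by rewrite intr_eq0 nonsquare_bqf_r.
have rn : 0 < `|(bqf_r E)%:~R| :> R by rewrite normr_gt0.
have r2 : 0 < (bqf_r E)%:~R ^+ 2 :> R by rewrite exprn_even_gt0.
have hs := bqf_s_lohi R nD; have ht := bqf_t_lohi R D0 nD.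
have irr (x : int) : hi R E != x%:~R.
  apply/eqP => h; have [] := lohi_irrational D0 nD (or_intror erefl) (_ : (- x)%:~R + hi R E * 1%:~R = 0); last by [].
  by rewrite h mulr1 rmorphN addNr.
have sg0 : 0 <= lo R E + hi R E.
  have : (bqf_s E * bqf_r E)%:~R <= 0 :> R by rewrite lerz0.
  by rewrite rmorphM /= hs mulrC mulNr mulrN oppr_le0 mulrA -expr2 pmulr_rge0.
have sg1 : lo R E + hi R E <= 1.
  have : `|(bqf_s E)%:~R| <= `|(bqf_r E)%:~R| :> R by rewrite -!intr_norm ler_int.
  by rewrite hs normrM normrN (ger0_norm sg0) ger_pMr.
have pi1 : lo R E * hi R E <= -1.
  have : (bqf_r E * bqf_t E)%:~R < 0 :> R by rewrite ltrz0.
  rewrite rmorphM /= ht mulrA -expr2 pmulr_rlt0 // => h1.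
  have : `|(bqf_r E)%:~R| <= `|(bqf_t E)%:~R| :> R by rewrite -!intr_norm ler_int.
  by rewrite ht normrM (ltr0_norm h1) ler_pMr // lerNr.
have w3 : 0 < (lo R E ^+ 2 - 1) + (hi R E ^+ 2 - 1).
  rewrite lt_neqAle; apply/andP; split; last by have := sqr_ge0 (lo R E + hi R E); lra.
  apply/eqP => h; have := sqr_ge0 (lo R E + hi R E).
  have e0 : (lo R E + hi R E) ^+ 2 = 0 by have := sqr_ge0 (lo R E + hi R E); lra.
  have /eqP := e0; rewrite sqrf_eq0 addr_eq0 => /eqP e1 _.
  have h2 : hi R E ^+ 2 = 1 by move: h; rewrite e1; lra.
  have : (hi R E == 1) || (hi R E == -1) by rewrite -sqrf_eq1 h2.
  by move: (irr 1) (irr (-1)); rewrite rmorphN => /negbTE -> /negbTE ->.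
have hb : 1 <= hi R E by nra.
have geE := @geo_gauss_domain R E D0 nD; rewrite /wall1 /wall2 /wall3 in geE.
have ball0 (e u : R) : 0 < e -> - (e / 2%:R) <= u <= e / 2%:R -> ball (0 : R) e u.
  by move=> e0 /andP[h1 h2]; rewrite /ball /= sub0r normrN ltr_norml; apply/andP; split; lra.
have [sg|sg] := ltP (lo R E + hi R E) 1.
  have w2 : 0 < (1 - 2%:R * lo R E) + (1 - 2%:R * hi R E) by lra.
  have [e /= e0 he] : exists2 e : R, 0 < e & forall u, ball 0 e u ->
      0 < (1 - 2%:R * lo R E) + (1 - 2%:R * hi R E) * expR u ^+ 2 /\
      0 < (lo R E ^+ 2 - 1) + (hi R E ^+ 2 - 1) * expR u ^+ 2.
    have : \forall u \near (0 : R), 0 < (1 - 2%:R * lo R E) + (1 - 2%:R * hi R E) * expR u ^+ 2 /\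
      0 < (lo R E ^+ 2 - 1) + (hi R E ^+ 2 - 1) * expR u ^+ 2.
      by near=> u; split; near: u; apply: wall_near.
    by move=> /nbhs_ballP[e e0 he]; exists e => // u /he.
  exists 0, (e / 2%:R); split; first by rewrite divr_gt0.
  move=> u /andP[u0 ue]; have hu : - (e / 2%:R) <= u <= e / 2%:R by apply/andP; split; lra.
  have [h2 h3] := he u (ball0 _ _ e0 hu).
  apply/geE; split; rewrite ?(ltW h2) ?(ltW h3) //.
  have : 1 <= expR u ^+ 2 by rewrite exprn_ege1 // -expR0 ler_expR.
  move: (expR u ^+ 2) => x; nra.
have w1 : 0 < lo R E + hi R E by lra.
have [e /= e0 he] : exists2 e : R, 0 < e & forall u, ball 0 e u ->
    0 < lo R E + hi R E * expR u ^+ 2 /\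
    0 < (lo R E ^+ 2 - 1) + (hi R E ^+ 2 - 1) * expR u ^+ 2.
  have : \forall u \near (0 : R), 0 < lo R E + hi R E * expR u ^+ 2 /\
    0 < (lo R E ^+ 2 - 1) + (hi R E ^+ 2 - 1) * expR u ^+ 2.
    by near=> u; split; near: u; apply: wall_near.
  by move=> /nbhs_ballP[e e0 he]; exists e => // u /he.
exists (- (e / 2%:R)), 0; split; first by rewrite oppr_lt0 divr_gt0.
move=> u /andP[ue u0]; have hu : - (e / 2%:R) <= u <= e / 2%:R by apply/andP; split; lra.
have [h2 h3] := he u (ball0 _ _ e0 hu).
apply/geE; split; rewrite ?(ltW h2) ?(ltW h3) //.
have : expR u ^+ 2 <= 1 by rewrite exprn_ile1 ?expR_ge0 // -expR0 ler_expR.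
move: (expR u ^+ 2) => x; nra.
Unshelve. all: by end_near. Qed.

End ArcInDomain.

Section EsumSeq.
Local Open Scope ereal_scope.

Lemma esum_seq (R : realType) (I : choiceType) (A : set I) (r : seq I) (a : I -> \bar R) :
  uniq r -> (forall i, 0 <= a i) -> (forall i, i \in r -> A i) ->
  (forall i, A i -> i \notin r -> a i = 0) -> \esum_(i in A) a i = \sum_(i <- r) a i.
Proof.
move=> ur a0 rA Ar; rewrite (esumID [set` r]) // [X in _ + X]esum1 ?adde0; last first.
  by move=> i [Ai /= nri]; apply: Ar => //; apply/negP.
rewrite (_ : A `&` [set` r] = [set` r]); last by apply/setIidr => i /rA.
by rewrite esum_fset // -fsbig_seq.
Qed.

End EsumSeq.

Section GammaMeasure.
Variables (R : realType) (Q : bqf int).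
Hypotheses (D0 : 0 < bqf_disc Q) (nD : nonsquare (bqf_disc Q)).
Local Notation mu := (@lebesgue_measure R).

Lemma equiv_disc E : bqf_equiv E Q -> 0 < bqf_disc E /\ nonsquare (bqf_disc E).
Proof. by move=> [g gu ->]; rewrite bqf_disc_act. Qed.

Lemma zeros_equiv (ab : R * R) : (exists2 Q', bqf_equiv Q' Q & zeros Q' ab) <->
  exists2 E, bqf_equiv E Q & ab = (lo R E, hi R E).
Proof.
by split=> -[E hE h]; exists E => //; have [D1 nD1] := equiv_disc hE; move: h; rewrite (zerosE R D1 nD1).
Qed.

Lemma geo_gamma_image E (u : R) : bqf_equiv E Q -> gauss_domain (geo E u) ->
  gamma_image Q (geo E u).
Proof.
move=> hE gd.
have [g gu eg] : bqf_equiv (bqf_flip E) (bqf_flip Q).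
  apply: bqf_equiv_trans (bqf_equiv_flip E) (bqf_equiv_trans hE _).
  exact: bqf_equiv_sym (bqf_equiv_flip Q).
have [eps [tau [he ht]]] := geo_transport R D0 nD gu eg.
exists (geo Q (eps * (u - tau))).
  exists (lo R Q, hi R Q); first by rewrite (zerosE R D0 nD).
  by exists (eps * (u - tau)).
split=> //; exists (anti_mx g); first by rewrite anti_mx_unit.
by rewrite ht mulrA -expr2 (_ : eps ^+ 2 = 1) ?mul1r ?subrK //; case: he => ->; rewrite ?sqrrN expr1n.
Qed.

Lemma gamma_image_domain : gamma_image Q `<=` @gauss_domain R.
Proof. by move=> w [z _ []]. Qed.

Lemma boundary_gamma_image : boundary_in (gamma_image Q) (gamma_image Q) = set0 :> set R[i].
Proof. by apply/seteqP; split=> // z [_]; rewrite setDv closure0. Qed.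

Lemma gamma_measure0 : gamma_measure Q (set0 : set R[i]) = 0%E.
Proof. by rewrite /gamma_measure esum1 // => ab _; rewrite [X in mu X](_ : _ = set0) ?measure0. Qed.

Lemma bqf_mkE E : bqf_mk (bqf_r E, bqf_s E, bqf_t E) = E.
Proof. by case: E. Qed.

Lemma classes_in_domain : exists Es : seq (int * int * int), uniq Es /\
  forall x, x \in Es <-> bqf_equiv (bqf_mk x) Q /\ exists u : R, gauss_domain (geo (bqf_mk x) u).
Proof.
pose B : nat := `|(5 * bqf_disc Q ^+ 2)%R|%N; pose I := int_range (- B%:Z) B.*2.+1.
pose P x := `[< bqf_equiv (bqf_mk x) Q /\ exists u : R, gauss_domain (geo (bqf_mk x) u) >].
exists [seq x <- [seq (rs, t) | rs <- [seq (r, s) | r <- I, s <- I], t <- I] | P x]; split.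
  apply: filter_uniq; apply: allpairs_uniq => [||[? ?] [? ?] _ _ //]; last exact: int_range_uniq.
  by apply: allpairs_uniq => [||[? ?] [? ?] _ _ //]; exact: int_range_uniq.
move=> x; rewrite mem_filter; split=> [/andP[/asboolP //]|hx].
apply/andP; split; first exact/asboolP.
have [hE [u gu]] := hx; have [D1 nD1] := equiv_disc hE.
have dE : bqf_disc (bqf_mk x) = bqf_disc Q by have [g gg ->] := hE; rewrite bqf_disc_act.
have [] := geo_domain_bounds D1 nD1 gu; rewrite dE => hr hs ht _.
have DD : bqf_disc Q <= bqf_disc Q ^+ 2 by rewrite expr2 ler_peMl ?(ltW D0) // -gtz0_ge1.
have BE : B%:Z = 5 * bqf_disc Q ^+ 2 by rewrite gez0_abs // mulr_ge0 // sqr_ge0.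
have inI (z : int) : `|z| <= 5 * bqf_disc Q ^+ 2 -> z \in I.
  by rewrite -BE mem_int_range; clear; lia.
apply/allpairsP; exists (x.1, x.2); split; last by case: (x).
  apply/allpairsP; exists (x.1.1, x.1.2); split; last by case: (x) => [[]].
    by apply: inI; move: hr DD D0; rewrite /=; clear; move: (bqf_disc Q) (bqf_disc Q ^+ 2) => a b; lia.
  by apply: inI; move: hs DD D0; rewrite /=; clear; move: (bqf_disc Q) (bqf_disc Q ^+ 2) => a b; lia.
exact: inI.
Qed.

Variable Es : seq (int * int * int).
Hypothesis uEs : uniq Es.
Hypothesis EsP : forall x, x \in Es <->
  bqf_equiv (bqf_mk x) Q /\ exists u : R, gauss_domain (geo (bqf_mk x) u).

Definition arc_preimage (W : set R[i]) (x : int * int * int) : set R :=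
  [set u | W (geo (bqf_mk x) u)].

Definition arc_bound : R := ln (2%:R * (bqf_disc Q)%:~R) + 1.

Lemma arc_preimage_bound W x : W `<=` @gauss_domain R -> bqf_equiv (bqf_mk x) Q ->
  arc_preimage W x `<=` `]- arc_bound, arc_bound[.
Proof.
move=> WG hE u /WG gu; have [D1 nD1] := equiv_disc hE.
have [_ _ _] := geo_domain_bounds D1 nD1 gu.
have -> : bqf_disc (bqf_mk x) = bqf_disc Q by have [g gg ->] := hE; rewrite bqf_disc_act.
rewrite /arc_bound /= in_itv /= ler_norml => /andP[h1 h2]; apply/andP; split; lra.
Qed.

Let ends (x : int * int * int) : R * R := (lo R (bqf_mk x), hi R (bqf_mk x)).
Let neg (x : int * int * int) : int * int * int := (- x.1.1, - x.1.2, - x.2).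

Let bqf_mk_neg x : bqf_mk (neg x) = bqf_scale (-1) (bqf_mk x).
Proof. by apply: bqf_eq => /=; rewrite mulN1r. Qed.

Let lo_neg x : lo R (bqf_mk (neg x)) = lo R (bqf_mk x).
Proof.
rewrite bqf_mk_neg /lo bqf_disc_scale (_ : (-1) ^+ 2 = 1) ?sqrrN ?expr1n // mul1r.
by rewrite /= !mulN1r !rmorphN normrN mulrN invrN mulrNN.
Qed.

Let hi_neg x : hi R (bqf_mk (neg x)) = hi R (bqf_mk x).
Proof.
rewrite bqf_mk_neg /hi bqf_disc_scale (_ : (-1) ^+ 2 = 1) ?sqrrN ?expr1n // mul1r.
by rewrite /= !mulN1r !rmorphN normrN mulrN invrN mulrNN.
Qed.

Let same_ends x y : bqf_equiv (bqf_mk x) Q -> bqf_equiv (bqf_mk y) Q -> ends y = ends x ->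
  y = x \/ y = neg x.
Proof.
move=> hx hy [h1 h2]; have [Dx nx] := equiv_disc hx; have [Dy ny] := equiv_disc hy.
have dd : bqf_disc (bqf_mk x) = bqf_disc (bqf_mk y).
  by have [g gg ->] := hx; have [g' gg' ->] := hy; rewrite !bqf_disc_act.
have rr : `|x.1.1| = `|y.1.1|.
  apply/eqP; rewrite -(eqr_int R) !intr_norm; apply/eqP.
  have e1 := hi_sub_lo R (bqf_mk x); have e2 := hi_sub_lo R (bqf_mk y).
  rewrite -h1 -h2 dd e2 in e1; have S0 : Num.sqrt (bqf_disc (bqf_mk y))%:~R != 0 :> R.
    by rewrite gt_eqF // sqrtr_gt0 ltr0z.
  by move/(mulfI S0)/invr_inj: e1.
have e1 := bqf_s_lohi R nx; have e2 := bqf_t_lohi R Dx nx.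
have e3 := bqf_s_lohi R ny; have e4 := bqf_t_lohi R Dy ny; rewrite h1 h2 in e3 e4.
have : (y.1.1 == x.1.1) || (y.1.1 == - x.1.1).
  by rewrite -eqr_norm2 rr.
case/orP => /eqP er; [left | right]; rewrite /= er in e3 e4.
  rewrite -e1 in e3; rewrite -e2 in e4; move/intr_inj: e3 => e3; move/intr_inj: e4 => e4.
  by rewrite [y]surjective_pairing [y.1]surjective_pairing [x]surjective_pairing [x.1]surjective_pairing er e3 e4.
rewrite rmorphN mulNr in e3; rewrite rmorphN mulNr -e2 in e4.
have e5 : (y.1.2)%:~R = - (x.1.2)%:~R :> R by rewrite [in RHS]e1 e3 mulNr.
rewrite -rmorphN in e5; rewrite -rmorphN in e4.
move/intr_inj: e5 => e5; move/intr_inj: e4 => e4.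
by rewrite [y]surjective_pairing [y.1]surjective_pairing /neg er e5 e4.
Qed.

(* E and - E have the same geodesic, so a geodesic is that of one or of two forms
   of the class of Q. *)
Definition sheets : nat := (`[< bqf_equiv (bqf_scale (-1) Q) Q >]).+1.

Let count_ends x : x \in Es -> count_mem (ends x) (map ends Es) = sheets.
Proof.
move=> xE; have [hx [u gu]] := (EsP x).1 xE.
have [Dx nx] := equiv_disc hx.
have nn : neg x != x.
  apply/eqP => /(congr1 (fun y => y.1.1)) /= h; have := nonsquare_bqf_r nx; rewrite /=.
  by move: h; clear; lia.
rewrite count_map (@eq_in_count _ _ (predU (pred1 x) (pred1 (neg x)))); last first.
  move=> y yE /=; have [hy _] := (EsP y).1 yE; apply/eqP/orP => [/(same_ends hx hy)[->|->]|].
  - by left.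
  - by right.
  - by case=> /eqP -> //; rewrite /ends lo_neg hi_neg.
have := count_predUI (pred1 x) (pred1 (neg x)) Es.
rewrite (@eq_count _ (predI _ _) pred0) ?count_pred0 ?addn0; last first.
  by move=> y /=; apply/negP => /andP[/eqP -> /eqP h]; rewrite -h eqxx in nn.
move=> ->; rewrite !count_uniq_mem // xE add1n /sheets; congr (nat_of_bool _).+1.
apply/idP/asboolP => [/EsP[h _]|h].
  have [g gg hg] := h; have [g' gg' hg'] := bqf_equiv_sym hx.
  exists (g' *m g); first by rewrite unitmx_mul gg'.
  by rewrite -bqf_actM -hg bqf_mk_neg bqf_act_scale -hg'.
apply/EsP; split; last by exists u; rewrite /geo lo_neg hi_neg.
have [g gg hg] := h; have [g' gg' hg'] := hx.
exists (g' *m g); first by rewrite unitmx_mul gg'.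
by rewrite -bqf_actM -hg bqf_mk_neg bqf_act_scale -hg'.
Qed.

Let arc_fin W x : W `<=` @gauss_domain R -> bqf_equiv (bqf_mk x) Q ->
  mu (arc_preimage W x) \is a fin_num.
Proof.
move=> WG hE; rewrite ge0_fin_numE ?lebesgue_ge0 //.
apply: le_lt_trans (le_lebesgue (arc_preimage_bound WG hE)) _.
by rewrite lebesgue_measure_itv /=; case: ifP => _; rewrite ltry.
Qed.

Lemma gamma_measureE W : W `<=` @gauss_domain R ->
  \sum_(x <- Es) fine (mu (arc_preimage W x)) = fine (gamma_measure Q W) *+ sheets.
Proof.
move=> WG.
pose F (ab : R * R) := mu [set u | W (geodesic ab.1 ab.2 u)].
have e1 : gamma_measure Q W = (\sum_(ab <- undup (map ends Es)) F ab)%E.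
  rewrite /gamma_measure; apply: esum_seq; first exact: undup_uniq.
  - by move=> ab; apply: lebesgue_ge0.
  - move=> ab; rewrite mem_undup => /mapP[x xE ->]; apply/zeros_equiv.
    by exists (bqf_mk x) => //; have [] := (EsP x).1 xE.
  - move=> ab /zeros_equiv[E hE ->]; rewrite mem_undup => nE.
    rewrite [X in mu X](_ : _ = set0) ?measure0 //; apply/seteqP; split=> // u /= Wu.
    move: nE; apply/negP; rewrite negbK; apply/mapP; exists (bqf_r E, bqf_s E, bqf_t E).
      by apply/EsP; rewrite bqf_mkE; split=> //; exists u; exact: WG.
    by rewrite /ends bqf_mkE.
have e2 : gamma_measure Q W = (\sum_(ab <- undup (map ends Es)) fine (F ab))%:E.
  rewrite e1 -sumEFin; apply: eq_big_seq => ab; rewrite mem_undup => /mapP[x xE ->].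
  by rewrite fineK //; apply: (@arc_fin W x) => //; have [] := (EsP x).1 xE.
rewrite e2 /= -sumrMnl.
transitivity (\sum_(ab <- map ends Es) fine (F ab)); first by rewrite big_map.
rewrite -(big_undup_iterop_count +%R); apply: eq_big_seq => ab.
rewrite mem_undup => /mapP[x xE ->]; rewrite (count_ends xE).
by rewrite /sheets; case: `[< _ >].
Qed.

Lemma gamma_measure_null W x : x \in Es -> gamma_measure Q W = 0%E ->
  mu (arc_preimage W x) = 0%E.
Proof.
move=> xE h; apply/eqP; rewrite eq_le lebesgue_ge0 andbT -[leRHS]h.
apply: esum_ge; exists [set ends x]; last by rewrite fsbig_set1.
split; first exact: finite_set1.
by move=> _ ->; apply/zeros_equiv; exists (bqf_mk x) => //; have [] := (EsP x).1 xE.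
Qed.

Lemma gamma_measure_gt0 : 0 < fine (gamma_measure Q (@gamma_image R Q)).
Proof.
have [E [hE [x [y [xy hxy]]]]] := geodesic_meets_domain R D0 nD.
have s0 : (0 < sheets)%N by [].
rewrite -(pmulrn_lgt0 _ s0) -gamma_measureE; last exact: gamma_image_domain.
pose z := (bqf_r E, bqf_s E, bqf_t E).
have zE : z \in Es.
  by apply/EsP; rewrite bqf_mkE; split=> //; exists x; apply: hxy; rewrite lexx ltW.
rewrite (big_rem _ zE) /=; apply: ltr_pwDl; last first.
  by apply: sumr_ge0 => w _; rewrite fine_ge0 // lebesgue_ge0.
apply: (@lt_le_trans _ _ (y - x)); first by rewrite subr_gt0.
rewrite -lee_fin fineK; last by apply: arc_fin; [exact: gamma_image_domain | rewrite bqf_mkE].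
have -> : (y - x)%:E = mu `[x, y].
  by rewrite lebesgue_measure_itv /= lte_fin xy.
apply: le_lebesgue => u; rewrite /= in_itv /= => hu; rewrite /arc_preimage /= bqf_mkE.
by apply: geo_gamma_image => //; apply: hxy.
Qed.

End GammaMeasure.

(** * Asymptotics *)

Section AffineArguments.
Variables (R : realType) (p q nu K eps tau : R).
Hypotheses (pq : p < q) (nu0 : 0 < nu) (eps1 : eps = 1 \/ eps = -1).

Definition affine_count : R -> set R -> R :=
  count_on (hyp_box p q nu K) (hyp_in p q nu) (fun v => eps * hyp_arg p q v + tau).

Let c : R := 3%:R / (2%:R * nu * (q - p)).

Lemma affine_upper (x y : R) : x <= y -> upper_density affine_count `[x, y] (c * (y - x)).
Proof.
move=> xy; have [x' [y' [xy' exy h]]] : exists x' y' : R, [/\ x' <= y', y' - x' = y - x &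
    forall a, eps * a + tau \in `[x, y] -> a \in `[x', y']].
  case: eps1 => ->; [exists (x - tau), (y - tau) | exists (tau - y), (tau - x)]; split=> //; try lra.
    by move=> a; rewrite !in_itv /= => /andP[h1 h2]; apply/andP; split; lra.
  by move=> a; rewrite !in_itv /= => /andP[h1 h2]; apply/andP; split; lra.
rewrite -exy => e e0; apply: filterS (@hyp_upper R p q nu K pq nu0 _ _ xy' e e0) => N; apply: le_trans.
rewrite ler_nat; apply: sub_count => v /asboolP[Pv Sv]; apply/asboolP; split=> //; exact: h.
Qed.

Lemma affine_lower (x y : R) : x <= y -> - (K - `|tau|) <= x -> y <= K - `|tau| ->
  lower_density affine_count `]x, y[ (c * (y - x)).
Proof.
move=> xy Kx Ky; have t1 := ler_norm tau; have t2 := ler_norm (- tau); rewrite normrN in t2.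
have [x' [y' [xy' exy [Kx' Ky'] h]]] : exists x' y' : R, [/\ x' <= y', y' - x' = y - x, - K <= x' /\ y' <= K &
    forall a, a \in `]x', y'[ -> eps * a + tau \in `]x, y[].
  case: eps1 => ->; [exists (x - tau), (y - tau) | exists (tau - y), (tau - x)]; split=> //; try lra.
  by move=> a; rewrite !in_itv /= => /andP[h1 h2]; apply/andP; split; lra.
  by move=> a; rewrite !in_itv /= => /andP[h1 h2]; apply/andP; split; lra.
rewrite -exy => e e0; apply: filterS (hyp_lower pq nu0 xy' Kx' Ky' e0) => N /le_trans; apply.
rewrite ler_nat; apply: sub_count => v /asboolP[Pv Sv]; apply/asboolP; split=> //; exact: h.
Qed.

End AffineArguments.

Lemma sum_cvg_ratio (R : realType) (I : eqType) (r : seq I) (F : I -> R -> R) (v : I -> R) :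
  (forall x, x \in r -> F x N / N @[N --> +oo] --> v x) ->
  (\sum_(x <- r) F x N) / N @[N --> +oo] --> \sum_(x <- r) v x.
Proof.
elim: r => [|x r ih] h.
  under eq_fun do rewrite big_nil mul0r.
  by rewrite big_nil; exact: cvg_cst.
under eq_fun do rewrite big_cons mulrDl; rewrite big_cons; apply: cvgD; first exact/h/mem_head.
by apply: ih => y yr; apply: h; rewrite inE yr orbT.
Qed.

Section Asymptotics.
Variables (R : realType) (Q Q0 : bqf int).
Hypotheses (D0 : 0 < bqf_disc Q) (nD : nonsquare (bqf_disc Q)).
Hypotheses (r_lt0 : bqf_r Q0 < 0) (prim : bqf_primitive Q0) (hQ : bqf_equiv Q0 Q).
Variables (e f h : int) (cub : nat * int -> int * int * int * int).
Hypotheses (e0 : 0 < e) (h0 : 0 < h).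
Hypothesis cubP : forall v, apolar_to Q0 (cub v) /\
  ((cub v).1.1.1 = e * v.1%:Z /\ (cub v).1.1.2 = f * v.1%:Z + h * v.2).
Hypothesis cub_surj : forall C, apolar_to Q0 C -> 0 < C.1.1.1 -> exists2 v, (0 < v.1)%N & C = cub v.
Variables (Es : seq (int * int * int)) (mx : int * int * int -> 'M[int]_2)
  (eps tau : int * int * int -> R).
Hypothesis uEs : uniq Es.
Hypothesis EsP : forall x, x \in Es <->
  bqf_equiv (bqf_mk x) Q /\ exists u : R, gauss_domain (geo (bqf_mk x) u).
Hypothesis mxP : forall x, bqf_equiv (bqf_mk x) Q ->
  [/\ mx x \in unitmx, bqf_flip (bqf_mk x) = bqf_act (mx x) (bqf_flip Q0),
    eps x = 1 \/ eps x = -1 &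
    forall u, moebius (anti_mx (mx x)) (geo Q0 u) = geo (bqf_mk x) (eps x * u + tau x)].

Local Notation mu := (@lebesgue_measure R).
Local Notation p := (slope_lo R Q0 e f h).
Local Notation q := (slope_hi R Q0 e f h).
Local Notation nu := (norm_coef R Q0 h).

Let D0' : 0 < bqf_disc Q0 := (equiv_disc D0 nD hQ).1.
Let nD' : nonsquare (bqf_disc Q0) := (equiv_disc D0 nD hQ).2.
Let pq : p < q := slope_lt R D0' nD' f e0 h0.
Let nu0 : 0 < nu := norm_coef_gt0 R r_lt0 h0.

Definition arg_bound : R := arc_bound R Q + \sum_(x <- Es) `|tau x|.
Definition density_const : R := 3%:R / (2%:R * nu * (q - p)).

Lemma density_const_gt0 : 0 < density_const.
Proof. by rewrite divr_gt0 // mulr_gt0 ?subr_gt0 // mulr_gt0. Qed.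

Let cnt x := affine_count p q nu arg_bound (eps x) (tau x).

Let tau_bound x : x \in Es -> `|tau x| <= \sum_(x <- Es) `|tau x|.
Proof. by move=> xE; rewrite (big_rem _ xE) /= lerDl sumr_ge0. Qed.

Let EsP' x : x \in Es -> [/\ bqf_equiv (bqf_mk x) Q, mx x \in unitmx,
  bqf_flip (bqf_mk x) = bqf_act (mx x) (bqf_flip Q0) &
  forall u, moebius (anti_mx (mx x)) (geo Q0 u) = geo (bqf_mk x) (eps x * u + tau x)].
Proof. by move=> /EsP[hx _]; have [] := mxP hx. Qed.

Let Es_all x : bqf_equiv (bqf_mk x) Q ->
  (exists u : R, gauss_domain (geo (bqf_mk x) u)) -> x \in Es.
Proof. by move=> h1 h2; apply/EsP. Qed.

Variable W : set R[i].
Hypotheses (W_sub : W `<=` gamma_image Q) (W_cont : continuity_set Q W).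

Let WG : W `<=` @gauss_domain R.
Proof. by move=> z /W_sub/gamma_image_domain. Qed.

Definition inner_preimage (x : int * int * int) : set R :=
  [set u | W (geo (bqf_mk x) u) /\ gauss_interior (geo (bqf_mk x) u)].

Let arc_cvg x (V : set R) : x \in Es -> inner_preimage x `<=` V -> V `<=` arc_preimage W x ->
  cnt x N V / N @[N --> +oo] --> density_const * fine (mu (arc_preimage W x)).
Proof.
move=> xE hV VW; have [hx _] := (EsP x).1 xE; have [_ _ e1 _] := mxP hx.
have [Dx nx] := equiv_disc D0 nD hx.
have walls := walls_null R Dx nx.
have hb : mu (closure V `\` interior V) = 0%E.
  apply/eqP; rewrite eq_le lebesgue_ge0 andbT.
  have hsub := @preimage_boundary R (bqf_mk x) Dx nx (gamma_image Q) W V WG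
    (fun u => geo_gamma_image D0 nD hx (u := u)) (fun u w i => hV u (conj w i)) VW.
  apply: le_trans (le_lebesgue hsub) _; apply: le_trans (lebesgue_subadd _ _) _.
  by rewrite walls adde0; have := gamma_measure_null D0 nD EsP xE W_cont; rewrite /arc_preimage => ->.
have eV : mu V = mu (arc_preimage W x).
  apply/eqP; rewrite eq_le le_lebesgue //=.
  rewrite -[leRHS]adde0 -walls; apply: le_trans (lebesgue_subadd _ _); apply: le_lebesgue => u Wu.
  by have [gi|ngi] := pselect (gauss_interior (geo (bqf_mk x) u)); [left; apply: hV | right; split=> //; exact: WG].
have K0 : 0 <= arc_bound R Q.
  rewrite /arc_bound addr_ge0 // ln_ge0 //; have : 1 <= (bqf_disc Q)%:~R :> R by rewrite ler1z -gtz0_ge1.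
  by lra.
have tb := tau_bound xE.
have [up lw] : upper_density (cnt x) V (density_const * fine (mu V)) /\
    lower_density (cnt x) V (density_const * fine (mu V)).
  apply: (@null_boundary_density R (cnt x) _ _ _ density_const (arc_bound R Q)) => //.
  - exact: count_on_sub.
  - exact: count_onU_le.
  - exact: count_onU_ge.
  - exact/ltW/density_const_gt0.
  - by move=> y z yz _ _; exact: affine_upper.
  - by move=> y z yz h1 h2; apply: affine_lower => //; rewrite /arg_bound; move: tb h1 h2; lra.
  - by move=> u /VW; exact: arc_preimage_bound.
by rewrite -eV; exact: density_cvg.
Qed.

Let reducible v := exists a b : int, coprimez a b /\ cubic_root (cub v) a b.
Let red (N : R) : R := (count (fun v => `[< reducible v >]) (hyp_box p q nu arg_bound N))%:R.

Let red_cvg : red N / N @[N --> +oo] --> (0 : R).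
Proof.
apply/cvgrPdist_le => d d0; near=> N.
have N0 : 0 < N by near: N; apply: nbhs_pinfty_gt; rewrite num_real.
rewrite sub0r normrN ger0_norm ?divr_ge0 ?ler0n ?(ltW N0) // ler_pdivrMr //.
near: N; exact: (reducible_sparse r_lt0 D0' nD' e0 h0 cubP).
Unshelve. all: by end_near. Qed.

Let N_ringsP (X : R) : 0 < X -> meets_classes (@order_iso R) (counted Q X W) (N_rings Q X W) /\
  (N_rings Q X W)%:R <= \sum_(x <- Es) cnt x (bound_of Q0 X) (arc_preimage W x).
Proof.
move=> X0; pose N : R := bound_of Q0 X.
pose codes := [seq (x, v) | x <- Es, v <- [seq v <- hyp_box p q nu arg_bound N |
  `[< hyp_in p q nu N v /\ arc_preimage W x (eps x * hyp_arg p q v + tau x) >]]].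
have hc O : counted Q X W O -> exists2 j, j \in codes & coded_by cub j O.
  move=> hO; have [[x v] /= [xE hv Wj cj]] := counted_code r_lt0 D0' nD' prim hQ e0 h0 cubP cub_surj EsP' Es_all X0 hO.
  exists (x, v) => //; apply/allpairsPdep; exists x, v; split=> //.
  rewrite mem_filter; apply/andP; split; first exact/asboolP.
  apply: mem_hyp_box => //; rewrite -ler_norml.
  have [hx _] := (EsP x).1 xE; have [_ _ e1 _] := mxP hx.
  have : arc_preimage W x (eps x * hyp_arg p q v + tau x) by [].
  move/(arc_preimage_bound D0 nD WG hx); rewrite /= ?in_itv /= => /andP[h1 h2].
  have tb := tau_bound xE; have t1 := ler_norm (tau x); have t2 := ler_norm (- tau x); rewrite normrN in t2.
  by rewrite /arg_bound ler_norml; case: e1 h1 h2 => ->; rewrite ?mul1r ?mulN1r => h1 h2; apply/andP; split; lra.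
have ci j (O1 O2 : cubic_order R) : coded_by cub j O1 -> coded_by cub j O2 -> order_iso O1 O2 by exact: code_iso.
have mP : meets_classes (@order_iso R) (counted Q X W) (N_rings Q X W).
  apply: (xgetPex 0%N (P := [set n | meets_classes (@order_iso R) (counted Q X W) n])).
  by apply: (meets_classes_exists (@order_iso_sym R) ci hc).
split=> //; have := meets_classes_le ci hc mP; rewrite -(ler_nat R) => /le_trans; apply.
rewrite size_allpairs_dep sumnE big_map natr_sum; apply: ler_sum => x _.
by rewrite size_filter.
Qed.

Let rings_lower (X : R) : 0 < X ->
  \sum_(x <- Es) (cnt x (bound_of Q0 X) (inner_preimage x) - red (bound_of Q0 X)) <= (N_rings Q X W)%:R.
Proof.
move=> X0; pose N : R := bound_of Q0 X.
pose A x v := `[< hyp_in p q nu N v /\ inner_preimage x (eps x * hyp_arg p q v + tau x) >].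
pose codes := [seq (x, v) | x <- Es, v <- [seq v <- hyp_box p q nu arg_bound N | A x v && ~~ `[< reducible v >]]].
have cP x v : (x, v) \in codes -> [/\ x \in Es, hyp_in p q nu N v,
    inner_preimage x (eps x * hyp_arg p q v + tau x) & ~ reducible v].
  move=> /allpairsPdep[x' [v' [xE + [-> ->]]]]; rewrite mem_filter => /andP[/andP[/asboolP[h1 h2] nr] _].
  by split=> // hr; move/negP: nr; apply; apply/asboolP.
have dom z : gauss_interior z -> @gauss_domain R z.
  by case=> /andP[a1 a2] a3 a4; split=> //; [rewrite !ltW | exact: ltW].
have := meets_classes_ge (@order_iso_sym R) (@order_iso_trans R) (c := coded_by cub) (D := codes) _ _ _ (N_ringsP X0).1.
move=> hge; have : (size codes <= N_rings Q X W)%N.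
  apply: hge.
  - apply: allpairs_uniq_dep => // [x _|[x v] [x' v'] _ _ /= [-> ->] //].
    exact/filter_uniq/hyp_box_uniq.
  - move=> [x v] /cP[xE hv [Wj gj] nr].
    apply: (code_counted r_lt0 D0' nD' prim hQ e0 h0 cubP EsP' (j := (x, v))) => //; first exact: dom.
    by move=> a b cab hr; apply: nr; exists a, b.
  - move=> [x v] [x' v'] O1 O2 /cP[xE hv [Wj gj] nr] /cP[xE' hv' [Wj' gj'] nr'] c1 c2.
    apply: (code_inj r_lt0 D0' nD' prim e0 h0 cubP EsP' (j := (x, v)) (j' := (x', v'))) hv hv' gj (dom _ gj') c1 c2 => //.
rewrite -(ler_nat R); apply: le_trans.
rewrite size_allpairs_dep sumnE big_map natr_sum; apply: ler_sum => x _.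
rewrite size_filter lerBlDr -natrD ler_nat -count_predUI; apply: leq_trans (leq_addr _ _).
apply: sub_count => v /= hA; rewrite -/(A x v) in hA *; rewrite hA /=.
by case: `[< _ >].
Qed.

Let bound_cvg : bound_of Q0 X @[X --> +oo] --> (+oo : set_system R).
Proof.
apply/cvgryPge => A; near=> X.
have D1 : 0 < (bqf_disc Q0)%:~R :> R by rewrite ltr0z.
have hX : `|A| ^+ 2 * (bqf_disc Q0)%:~R / 3%:R <= X by near: X; apply: nbhs_pinfty_ge; rewrite num_real.
apply: le_trans (ler_norm A) _; rewrite -[leLHS]ger0_norm ?normr_ge0 // -sqrtr_sqr /bound_of.
apply: ler_wsqrtr; rewrite ler_pdivlMr // [3%:R * X]mulrC.
by rewrite -ler_pdivrMr.
Unshelve. all: by end_near. Qed.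

Lemma N_rings_density : (N_rings Q X W)%:R / bound_of Q0 X @[X --> +oo] -->
  density_const * (sheets Q)%:R * fine (gamma_measure Q W).
Proof.
have -> : density_const * (sheets Q)%:R * fine (gamma_measure Q W) =
    \sum_(x <- Es) density_const * fine (mu (arc_preimage W x)).
  by rewrite -mulr_sumr (gamma_measureE D0 nD uEs EsP WG) -mulrA mulr_natl.
have up : (\sum_(x <- Es) cnt x (bound_of Q0 X) (arc_preimage W x)) / bound_of Q0 X @[X --> +oo] -->
    \sum_(x <- Es) density_const * fine (mu (arc_preimage W x)).
  have hs : (\sum_(x <- Es) cnt x N (arc_preimage W x)) / N @[N --> +oo] -->
      \sum_(x <- Es) density_const * fine (mu (arc_preimage W x)).
    by apply: (@sum_cvg_ratio R _ Es (fun x N => cnt x N (arc_preimage W x))) => x xE; apply: arc_cvg => // u [].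
  exact: (cvg_comp (bound_of Q0) _ bound_cvg hs).
have lw : (\sum_(x <- Es) (cnt x (bound_of Q0 X) (inner_preimage x) - red (bound_of Q0 X))) / bound_of Q0 X @[X --> +oo] -->
    \sum_(x <- Es) density_const * fine (mu (arc_preimage W x)).
  have hs : (\sum_(x <- Es) (cnt x N (inner_preimage x) - red N)) / N @[N --> +oo] -->
      \sum_(x <- Es) density_const * fine (mu (arc_preimage W x)).
    apply: (@sum_cvg_ratio R _ Es (fun x N => cnt x N (inner_preimage x) - red N)) => x xE.
    under eq_fun do rewrite mulrBl; rewrite -[density_const * _]subr0; apply: cvgB; last exact: red_cvg.
    by apply: arc_cvg => // u [].
  exact: (cvg_comp (bound_of Q0) _ bound_cvg hs).
apply: squeeze_cvgr lw up; near=> X.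
have X0 : 0 < X by near: X; apply: nbhs_pinfty_gt; rewrite num_real.
have B0 : 0 <= (bound_of Q0 X)^-1 by rewrite invr_ge0 sqrtr_ge0.
by rewrite !ler_wpM2r // ?rings_lower //; have [_] := N_ringsP X0.
Unshelve. all: by end_near. Qed.

End Asymptotics.

Lemma N_rings_asymptotic (R : realType) (Q : bqf int) :
  bqf_primitive Q -> 0 < bqf_disc Q -> nonsquare (bqf_disc Q) ->
  exists (N : R -> R) (c : R), [/\ 0 < c, \forall X \near +oo, 0 < N X &
    forall W, W `<=` gamma_image Q -> continuity_set Q W ->
      (N_rings Q X W)%:R / N X @[X --> +oo] --> c * fine (gamma_measure Q W)].
Proof.
move=> pQ D0 nD; have [Q0 hQ r0] := negative_form D0 nD.
have [D1 nD1] := equiv_disc D0 nD hQ.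
have prim := bqf_primitive_equiv hQ pQ.
have [e [f [h [cub [e0 h0 cubP cub_surj]]]]] := apolar_param (ltr0_neq0 r0).
have [Es [uEs EsP]] := classes_in_domain R D0 nD.
have F x : {met : 'M[int]_2 * R * R | bqf_equiv (bqf_mk x) Q ->
  [/\ met.1.1 \in unitmx, bqf_flip (bqf_mk x) = bqf_act met.1.1 (bqf_flip Q0),
    met.1.2 = 1 \/ met.1.2 = -1 &
    forall u, moebius (anti_mx met.1.1) (geo Q0 u) = geo (bqf_mk x) (met.1.2 * u + met.2)]}.
  apply: cid; have [hx|nx] := pselect (bqf_equiv (bqf_mk x) Q); last by exists (0, 0, 0).
  have [m mu em] : bqf_equiv (bqf_flip (bqf_mk x)) (bqf_flip Q0).
    apply: bqf_equiv_trans (bqf_equiv_flip _) (bqf_equiv_trans hx _).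
    exact: bqf_equiv_trans (bqf_equiv_sym hQ) (bqf_equiv_sym (bqf_equiv_flip _)).
  have [eps [tau [he ht]]] := geo_transport R D1 nD1 mu em.
  by exists (m, eps, tau).
have mxP x := svalP (F x).
exists (bound_of Q0), (density_const R Q0 e f h * (sheets Q)%:R); split.
- by rewrite mulr_gt0 ?ltr0n // (@density_const_gt0 R Q Q0 D0 nD r0 hQ e f h e0 h0).
- have : \forall X \near +oo, 0 < X :> R by apply: nbhs_pinfty_gt; rewrite num_real.
  by apply: filterS => X X0; rewrite sqrtr_gt0 divr_gt0 ?ltr0z // mulr_gt0.
- move=> W W_sub W_cont.
  exact: (N_rings_density D0 nD r0 prim hQ e0 h0 cubP cub_surj uEs EsP mxP W_sub W_cont).
Qed.

Theorem theorem7p13 (R : realType) (Q : bqf int)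
    (Q_primitive : bqf_primitive Q)
    (Q_indefinite : bqf_indefinite Q)
    (D_nonsquare : ~ exists n : int, bqf_disc Q = n ^+ 2)
    (D_fundamental : fundamental_discriminant (bqf_disc Q) \/
      exists2 d : int, bqf_disc Q = - (3 * d) & fundamental_discriminant d)
    (W : set R[i])
    (W_sub : W `<=` gamma_image Q)
    (W_cont : continuity_set Q W) :
  (N_rings Q X W)%:R / (N_rings Q X (gamma_image Q))%:R @[X --> +oo%R] -->
    fine (gamma_measure Q W) / fine (gamma_measure Q (gamma_image Q)).
Proof.
have D0 := bqf_indefinite_disc Q_indefinite D_nonsquare.
have [N [c [c0 N0 hN]]] := N_rings_asymptotic R Q_primitive D0 D_nonsquare.
have [Es [uEs EsP]] := classes_in_domain R D0 D_nonsquare.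
have g0 := gamma_measure_gt0 D0 D_nonsquare uEs EsP.
have hW := hN W W_sub W_cont.
have hG : continuity_set Q (@gamma_image R Q).
  by rewrite /continuity_set boundary_gamma_image gamma_measure0.
have hI := hN (gamma_image Q) (fun _ => id) hG.
have -> : fine (gamma_measure Q W) / fine (gamma_measure Q (@gamma_image R Q)) =
    (c * fine (gamma_measure Q W)) / (c * fine (gamma_measure Q (@gamma_image R Q))).
  by rewrite invfM mulrACA divff ?mul1r // gt_eqF.
apply: cvg_trans (cvgM hW (cvgV _ hI)); last by rewrite mulf_neq0 ?gt_eqF.
apply: near_eq_cvg; near=> X.
have NX : N X != 0 by rewrite gt_eqF //; near: X.
suff E : (N_rings Q X W)%:R / N X * ((N_rings Q X (@gamma_image R Q))%:R / N X)^-1 =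
    (N_rings Q X W)%:R / (N_rings Q X (@gamma_image R Q))%:R by exact: E.
by rewrite invfM invrK mulrACA mulVf // mulr1.
Unshelve. all: by end_near. Qed.
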